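(* Consider an MDP $(\mathbb{X},\mathbb{U},\mathcal{T},c)$ with finite $\mathbb{U}$ and bounded $c$, a quantization of $\mathbb{X}$ with finite set of representative states $\mathbb{Y}$ and weighting measures $\{\mu_y\}_{y\in\mathbb{Y}}$, and the finite model $(\mathbb{Y},\mathbb{U},P,C)$ (all defined in the context). Assume there is $\beta<1$ such that for all $y,y'\in\mathbb{Y}$ and $u,u'\in\mathbb{U}$, $$\frac12\sum_{j}\left|P(y_j|y,u)-P(y_j|y',u')\right|\le\beta<1.$$ Let $Q_t$ and $\hat Q_t$ be generated by the synchronous quantized Q-learning algorithm (defined in the context) with $\alpha_t=\frac1{t+1}$. Let $\hat\rho$ be the optimal average cost of the finite model and let $Q^*:\mathbb{Y}\times\mathbb{U}\to\mathbb{R}$ satisfy $$\hat\rho+Q^*(y,u)=C(y,u)+\sum_{y'\in\mathbb{Y}}P(y'|y,u)\min_{v\in\mathbb{U}}Q^*(y',v)\quad\text{for all }(y,u).$$ For the reference pair $(y_0,u_0)$ put $\hat Q^*(y,u)=Q^*(y,u)-Q^*(y_0,u_0)$ and $\hat V^*(y)=\min_u\hat Q^*(y,u)$. Then, almost surely, $Q_t$ converges to $Q^*$ in the span semi-norm and $\hat Q_t$ converges to $\hat Q^*$ in the uniform norm. Moreover $$\hat\rho+\hat Q^*(y_0,u_0)=C(y_0,u_0)+\sum_{y_1\in\mathbb{Y}}\hat V^*(y_1)P(y_1|y_0,u_0).$$ Accordingly, for the learned policy $\hat\pi(x)\in\arg\min_{u}\hat Q^*(q(x),u)$, with $\rho$,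 $\rho(\hat\pi)$ the optimal average cost and the average cost of $\hat\pi$ in the original MDP (independent of the initial state under the conditions stated in each item, $\rho(\hat\pi)$ being used only in (ii), (iii)), $D$ the diameter of $\mathbb{X}$, and $L_{\mathbb{X}}$ the quantization error: (i) under the Lipschitz Condition with $K_{\mathcal{T}}<1$, $|\rho-\hat\rho|\le\frac{K_c}{1-K_{\mathcal{T}}}L_{\mathbb{X}}$; (ii) under the Minorization Condition with $\kappa:=1-\nu(\mathbb{X})>0$ and the Lipschitz Condition, for every $\delta\in(0,1]$ with $K_{\mathcal{T}}<(1/\kappa)^{(1-\delta)/\delta}$, $$|\rho-\hat\rho|\le\frac{K_cD^{1-\delta}}{1-K_{\mathcal{T}}^\delta\kappa^{1-\delta}}(L_{\mathbb{X}})^\delta\quad\text{and}\quad\rho(\hat\pi)-\rho\le\frac{2K_cD^{1-\delta}}{(1-\kappa)(1-K_{\mathcal{T}}^\delta\kappa^{1-\delta})}(L_{\mathbb{X}})^\delta;$$ (iii) under the Minorization Condition with $\kappa=1-\nu(\mathbb{X})>0$ and the Weak Continuity Condition, if for each $n$ a quantization with $L_{\mathbb{X}}=\frac1n$ is used and $\pi_n$ is the corresponding learned policy, then $\lim_{n\to\infty}\rho(\pi_n)=\rho$.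
   Context: MDP. $(\mathbb{X},d_{\mathbb{X}})$ is a complete separable metric state space, $\mathbb{U}$ a finite action space, $\mathcal{T}(dx_1|x,u)$ a stochastic kernel, $c:\mathbb{X}\times\mathbb{U}\to\mathbb{R}$ a bounded measurable one-stage cost. The average cost of a policy $\pi$ from $x$ is $J(x,\pi)=\limsup_{T\to\infty}\frac1TE^\pi_x\left[\sum_{t=0}^{T-1}c(X_t,U_t)\right]$; the optimal average cost is the infimum over all (history-dependent, possibly randomized) admissible policies. Quantization and finite model. $\{B_i\}_{i=0}^{M-1}$ is a finite partition of $\mathbb{X}$ into Borel bins, with representative states $y_i\in B_i$; $\mathbb{Y}=\{y_0,\dots,y_{M-1}\}$; $q(x)=y_i$ if $x\in B_i$. $\mu$ is a probability (weight) measure on $\mathbb{X}$ with $\mu(B_i)>0$ for all $i$, and $\mu_{y_i}(A)=\mu(A)/\mu(B_i)$ for Borel $A\subset B_i$. Put $$C(y_i,u)=\int_{B_i}c(x,u)\mu_{y_i}(dx),\qquad P(y_j|y_i,u)=\int_{B_i}\mathcal{T}(B_j|x,u)\mu_{y_i}(dx).$$ Quantization error. $L(x)=\int_{B_i}d_{\mathbb{X}}(x,x')\mu_{y_i}(dx')$ for $x\in B_i$; $L_{\mathbb{X}}=\sup_xL(x)$. Synchronous quantized Q-learning algorithm. Given an arbitrary initial $Q_0:\mathbb{Y}\times\mathbb{U}\to\mathbb{R}$ and a fixed reference pair $(y_0,u_0)\in\mathbb{Y}\times\mathbb{U}$, at each $t=0,1,2,\dots$ and for each $(y_i,u_j)\in\mathbb{Y}\times\mathbb{U}$,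 sample (independently across iterations) $x_i\sim\mu_{y_i}$ and $X_1^{i,j}\sim\mathcal{T}(\cdot|x_i,u_j)$, and set $$Q_{t+1}(y_i,u_j)=(1-\alpha_t)Q_t(y_i,u_j)+\alpha_t\left(c(x_i,u_j)+\min_vQ_t(q(X_1^{i,j}),v)\right),$$ $$\hat Q_{t+1}(y_i,u_j)=Q_{t+1}(y_i,u_j)-Q_{t+1}(y_0,u_0).$$ The span semi-norm is $\|f\|_{sp}=\max f-\min f$. Minorization Condition: there is a positive measure $\nu$ on $\mathbb{X}$ with $\nu(\mathbb{X})>0$ and $\mathcal{T}(B|x,u)\ge\nu(B)$ for all Borel $B$ and all $(x,u)$. Lipschitz Condition: $\mathbb{X}$ is compact, $\mathbb{U}$ is finite, and there are finite $K_c,K_{\mathcal{T}}$ with $|c(x,u)-c(x',u)|\le K_cd_{\mathbb{X}}(x,x')$ and $W_1(\mathcal{T}(\cdot|x,u),\mathcal{T}(\cdot|x',u))\le K_{\mathcal{T}}d_{\mathbb{X}}(x,x')$ for all $x,x',u$ ($W_1$ the first-order Wasserstein distance). Weak Continuity Condition: $\mathbb{U}$ is finite, $\mathbb{X}$ is compact, $c$ is bounded and continuous, and $\mathcal{T}(\cdot|x_n,u_n)\to\mathcal{T}(\cdot|x,u)$ weakly whenever $(x_n,u_n)\to(x,u)$. *)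

(* Defs.v *)
From HB Require Import structures.
From mathcomp Require Import all_boot all_order all_algebra.
From mathcomp Require Import all_classical all_reals all_analysis.
From mathcomp Require Import measurable_realfun.
Set Implicit Arguments.
Unset Strict Implicit.
Unset Printing Implicit Defensive.
Import Order.TTheory GRing.Theory Num.Theory.
Import numFieldNormedType.Exports.
Local Open Scope classical_set_scope.
Local Open Scope ring_scope.

(** Complete metric spaces.  They are nonempty, because the library's
    completeness and measurable structures are built on pointed types. *)
#[short(type="completeMetricType")]
HB.structure Definition CompleteMetric (R : realType) :=
  { T of Metric R T & CompletePseudoMetric R T }.

Definition separable (T : topologicalType) : Prop :=
  exists2 D : set T, countable D & dense D.

Definition borel (R : realType) (X : completeMetricType R) :=
  g_sigma_algebraType (@open X).

#[short(type="finPointedType")]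
HB.structure Definition FinPointed := { T of Finite T & isPointed T }.

HB.instance Definition _ n := isPointed.Build 'I_n.+1 ord0.

(** A nonempty finite set with its discrete sigma-algebra. *)
Definition discr (T : finPointedType) := g_sigma_algebraType [set: set T].

Lemma discr_measurable (T : finPointedType) (A : set (discr T)) : measurable A.
Proof. exact: sub_sigma_algebra. Qed.

Lemma discr_prod_measurable (S T : finPointedType)
  (A : set (discr S * discr T)) : measurable A.
Proof.
have -> : A = \bigcup_(z in A) ([set z.1] `*` [set z.2]).
  apply/seteqP; split => [[x y] Axy|[x y] [[x' y'] Axy /= [-> ->]]] //.
  by exists (x, y).
apply: fin_bigcup_measurable => [|z _].
  apply: (@sub_finite_set _ _ [set: S * T]) => //; exact: finite_finset.
by apply: measurableX; exact: discr_measurable.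
Qed.


Section kernel_precomposition.
Context d1 d2 d3 (X : measurableType d1) (Y : measurableType d2)
  (Z : measurableType d3) (R : realType).
Context (k : R.-pker Y ~> Z) (f : X -> Y).

Definition kpre (mf : measurable_fun [set: X] f) (x : X) :
  {measure set Z -> \bar R} := k (f x).

Context (mf : measurable_fun [set: X] f).

Let measurable_kpre A : measurable A ->
  measurable_fun [set: X] (kpre mf ^~ A).
Proof.
by move=> mA; apply: (measurableT_comp (measurable_kernel k A mA) mf).
Qed.

HB.instance Definition _ := isKernel.Build _ _ _ _ _ (kpre mf) measurable_kpre.

Let kpre_prob x : kpre mf x [set: Z] = 1%E.
Proof. exact: prob_kernel. Qed.

HB.instance Definition _ :=
  Kernel_isProbability.Build _ _ _ _ _ (kpre mf) kpre_prob.

End kernel_precomposition.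

Section kernel_product.
Context d0 d1 d2 (X : measurableType d0) (Y : measurableType d1)
  (Z : measurableType d2) (R : realType).
Context (k1 : R.-pker X ~> Y) (k2 : R.-pker (X * Y) ~> Z).

(** The library's [mkproduct], as a probability kernel. *)
Definition pkproduct : X -> {measure set (Y * Z) -> \bar R} := mkproduct k1 k2.

Let measurable_pkproduct A : measurable A ->
  measurable_fun [set: X] (pkproduct ^~ A).
Proof. exact: measurable_kproduct. Qed.

HB.instance Definition _ :=
  isKernel.Build _ _ _ _ _ pkproduct measurable_pkproduct.

Let pkproduct_prob x : pkproduct x [set: Y * Z] = 1%E.
Proof.
rewrite /pkproduct/= /kproduct.
transitivity (\int[k1 x]_y (cst 1 y : \bar R))%E; last first.
  by rewrite integral_cst// mul1e prob_kernel.
apply: eq_integral => y _.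
rewrite -[LHS]/(\int[k2 (x, y)]_z (\1_[set: Y * Z] (y, z))%:E)%E.
rewrite (eq_integral (cst 1%E)); last by move=> z _; rewrite indicT.
by rewrite integral_cst// mul1e prob_kernel.
Qed.

HB.instance Definition _ :=
  Kernel_isProbability.Build _ _ _ _ _ pkproduct pkproduct_prob.

End kernel_product.

Section fin_measure.
Context (R : realType) (T : finPointedType) (p : T -> {nonneg R}).

Definition fin_measure (A : set (discr T)) : \bar R :=
  (\sum_j mscale (p j) (dirac (j : discr T)) A)%E.

Let fin_measure0 : fin_measure set0 = 0%E.
Proof. by rewrite /fin_measure big1. Qed.

Let fin_measure_ge0 A : (0 <= fin_measure A)%E.
Proof. exact: sume_ge0. Qed.

Let fin_measure_sigma_additive : semi_sigma_additive fin_measure.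
Proof.
move=> F mF tF mUF; rewrite [X in _ --> X](_ : _ =
    lim ((fun n => \sum_(0 <= i < n) fin_measure (F i))%E @ \oo)).
  by apply: is_cvg_ereal_nneg_natsum => k _; exact: sume_ge0.
rewrite nneseries_sum//; apply: eq_bigr => /= i _.
exact: measure_semi_bigcup.
Qed.

HB.instance Definition _ := isMeasure.Build _ (discr T) R fin_measure
  fin_measure0 fin_measure_ge0 fin_measure_sigma_additive.

End fin_measure.

(** ** Markov decision processes *)

Record mdp (R : realType) d (X : measurableType d) (U : finPointedType) := Mdp {
  cost : X -> U -> R;
  trans : R.-pker (X * discr U) ~> X;
  measurable_cost :
    measurable_fun [set: X * discr U] (fun z => cost z.1 z.2);
  bounded_cost : exists K : R, forall x u, `|cost x u| <= K }.

Section histories.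
Context d (X : measurableType d) (U : finPointedType).

Fixpoint hist_display (t : nat) : measure_display :=
  if t is t'.+1
  then measure_prod_display
         (measure_prod_display (hist_display t', sigma_display [set: set U]), d)
  else d.

(** [hist t] is the type of the histories
    [(X_0, U_0, X_1, ..., U_(t-1), X_t)]. *)
Fixpoint hist (t : nat) : measurableType (hist_display t) :=
  match t return measurableType (hist_display t) with
  | 0 => X
  | t'.+1 => (hist t' * discr U * X)%type
  end.

Definition current (t : nat) : hist t -> X :=
  match t return hist t -> X with
  | 0 => fun x => x
  | _.+1 => fun h => h.2
  end.

Lemma measurable_current t : measurable_fun [set: hist t] (@current t).
Proof. by case: t => [|t]; [exact: measurable_id|exact: measurable_snd]. Qed.

Lemma measurable_current_action d0 (S : measurableType d0) t :
  measurable_fun [set: S * (hist t * discr U)]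
    (fun z => (current z.2.1, z.2.2)).
Proof.
apply: measurable_fun_pair => /=; last exact: measurableT_comp.
apply: (measurableT_comp (@measurable_current t)).
exact: (measurableT_comp measurable_fst measurable_snd).
Qed.

End histories.

Section average_cost.
Context (R : realType) d (X : measurableType d) (U : finPointedType).
Variable M : mdp R X U.

(** Admissible policies: the action at time [t] is drawn from a distribution on
    [U] depending measurably on the history up to time [t]. *)
Definition policy := forall t : nat, R.-pker (hist X U t) ~> discr U.

(** [law pi t x] is the law of [(X_0, U_0, ..., U_(t-1), X_t)] under [pi] when
    [X_0 = x]. *)
Fixpoint law (pi : policy) (t : nat) : R.-pker X ~> hist X U t :=
  match t return R.-pker X ~> hist X U t with
  | 0 => kdirac (@measurable_id _ X setT)
  | t'.+1 =>
      pkproduct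
        (pkproduct (law pi t') (kpre (pi t') measurable_snd))
        (kpre (trans M) (@measurable_current_action _ X U _ X t'))
  end.

(** [total_cost T h] is the cost [c(X_0, U_0) + ... + c(X_(T-1), U_(T-1))]
    along [h]. *)
Fixpoint total_cost (T : nat) : hist X U T -> R :=
  match T return hist X U T -> R with
  | 0 => fun _ => 0
  | T'.+1 => fun h => total_cost h.1.1 + cost M (current h.1.1) h.1.2
  end.

Definition average_cost (pi : policy) (x : X) : \bar R :=
  limn_esup (fun T : nat =>
    (T%:R^-1)%:E * \int[law pi T x]_h (total_cost h)%:E)%E.

Definition optimal_cost (x : X) : \bar R :=
  ereal_inf [set average_cost pi x | pi in [set: policy]].

Definition has_average_cost (pi : policy) (r : R) : Prop :=
  forall x, average_cost pi x = r%:E.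

Definition has_optimal_cost (r : R) : Prop :=
  forall x, optimal_cost x = r%:E.

Definition stationary (f : {mfun X >-> discr U}) : policy := fun t =>
  kdirac (measurableT_comp (@measurable_funPT _ _ _ _ f)
                           (@measurable_current _ X U t)).

End average_cost.
Arguments stationary {R d X U} f.

(** ** Quantization and the finite model *)

Record quantization (R : realType) (X : completeMetricType R) (N : nat) :=
  Quantization {
  bin : 'I_N.+1 -> set X;
  measurable_bin : forall i, measurable (bin i : set (borel X));
  bin_cover : \bigcup_i bin i = [set: X];
  bin_disjoint : trivIset [set: 'I_N.+1] bin;
  representative : 'I_N.+1 -> X;
  bin_representative : forall i, bin i (representative i);
  weight : probability (borel X) R;
  weight_bin_gt0 : forall i, (0 < weight (bin i))%E }.

Section quantization.
Context (R : realType) (X : completeMetricType R) (N : nat).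
Variable q : quantization X N.

Lemma bin_exists x : exists i, bin q i x.
Proof.
have : [set: X] x by [].
by rewrite -(bin_cover q) => -[i _ ?]; exists i.
Qed.

(** [bin_index x] is the [i] such that [x] is in the bin [i].  As
    representatives of distinct bins are distinct, [i] stands for the
    representative state [y_i] throughout. *)
Definition bin_index (x : X) : 'I_N.+1 := projT1 (cid (bin_exists x)).

Definition quantizer (x : X) : X := representative q (bin_index x).

(** The normalized restriction of the weight measure to the bin [i].  The last
    argument of [mnormalize] is a default for null or infinite measures. *)
Definition bin_weight (i : 'I_N.+1) : probability (borel X) R :=
  mnormalize (mrestr (weight q) (measurable_bin q i)) (weight q).

Lemma bin_weight_bin i : bin_weight i (bin q i) = 1%E.
Proof.
rewrite /bin_weight/= /mnormalize/= /mrestr/= setTI.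
have w0 := weight_bin_gt0 q i.
have wfin : weight q (bin q i) \is a fin_num.
  by rewrite fin_num_measure//; exact: measurable_bin.
rewrite gt_eqF//= ifF; last by rewrite lt_eqF// ltey_eq wfin.
rewrite setIid -{1}(fineK wfin) -EFinM divff// fine_eq0//.
by rewrite gt_eqF.
Qed.

Definition quantization_error (x : X) : \bar R :=
  (\int[bin_weight (bin_index x)]_(x' in bin q (bin_index x))
    (mdist x x')%:E)%E.

Definition max_quantization_error : \bar R :=
  ereal_sup [set quantization_error x | x in [set: X]].

Context (U : finPointedType).
Variable M : @mdp R _ (borel X) U.

Definition finite_cost (i : 'I_N.+1) (u : U) : R :=
  (\int[bin_weight i]_(x in bin q i) cost M x u)%R.

Definition finite_trans (i : 'I_N.+1) (u : U) (j : 'I_N.+1) : R :=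
  fine (\int[bin_weight i]_(x in bin q i) trans M (x, u) (bin q j))%E.

Let measurable_trans_bin u j :
  measurable_fun [set: borel X] (fun x => trans M (x, u : discr U) (bin q j)).
Proof.
apply: (@measurable_fun_pair1 _ _ _ (borel X) (discr U) _
  (fun z => trans M z (bin q j)) u).
by apply: measurable_kernel; exact: measurable_bin.
Qed.

Lemma finite_trans_ge0 i u j : 0 <= finite_trans i u j.
Proof. by apply: fine_ge0; exact: integral_ge0. Qed.

Lemma finite_trans_fin_num i u j :
  (\int[bin_weight i]_(x in bin q i) trans M (x, u) (bin q j))%E \is a fin_num.
Proof.
rewrite ge0_fin_numE; last exact: integral_ge0.
apply: (@le_lt_trans _ _ (\int[bin_weight i]_(x in bin q i) 1)%E).
  apply: ge0_le_integral => //.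
  - exact: measurable_bin.
  - by apply: measurable_funTS; exact: measurable_trans_bin.
  - move=> x _; rewrite -(@prob_kernel _ _ _ _ _ (trans M) (x, u)).
    by apply: le_measure => //; rewrite inE//; exact: measurable_bin.
rewrite integral_cst; last exact: measurable_bin.
by rewrite [ltLHS](_ : _ = 1%E) ?ltry// mul1e; exact: bin_weight_bin.
Qed.

Lemma sum_finite_trans i u : \sum_j finite_trans i u j = 1.
Proof.
apply: EFin_inj; rewrite -sumEFin.
under eq_bigr do rewrite /finite_trans fineK ?finite_trans_fin_num//.
rewrite -ge0_integral_sum//; first last.
- by move=> j; apply: measurable_funTS; exact: measurable_trans_bin.
- exact: measurable_bin.
transitivity (\int[bin_weight i]_(x in bin q i) 1)%E; last first.
  rewrite integral_cst; last exact: measurable_bin.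
  by rewrite mul1e; exact: bin_weight_bin.
apply: eq_integral => x _.
rewrite -(@prob_kernel _ _ _ _ _ (trans M) (x, u)) -(bin_cover q).
rewrite measure_fin_bigcup//.
- rewrite (_ : [set: 'I_N.+1] = [set` index_enum 'I_N.+1]); last first.
    by apply/seteqP; split => // j _ /=; rewrite mem_index_enum.
  by rewrite -fsbig_seq// index_enum_uniq.
- exact: finite_finset.
- exact: bin_disjoint.
- by move=> j _; exact: measurable_bin.
Qed.

Definition finite_trans_measure (z : discr 'I_N.+1 * discr U) :
    {measure set (discr 'I_N.+1) -> \bar R} :=
  fin_measure (fun j => NngNum (finite_trans_ge0 z.1 z.2 j)).

Let measurable_finite_trans_measure A : measurable A ->
  measurable_fun [set: discr 'I_N.+1 * discr U] (finite_trans_measure ^~ A).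
Proof. by move=> _ _ B _; exact: discr_prod_measurable. Qed.

HB.instance Definition _ :=
  isKernel.Build _ _ _ _ _ finite_trans_measure measurable_finite_trans_measure.

Let finite_trans_measure_prob z : finite_trans_measure z [set: discr 'I_N.+1] = 1%E.
Proof.
rewrite /finite_trans_measure/= /fin_measure -(sum_finite_trans z.1 z.2) -sumEFin.
by apply: eq_bigr => j _; rewrite /mscale/= diracT mule1.
Qed.

HB.instance Definition _ :=
  Kernel_isProbability.Build _ _ _ _ _ finite_trans_measure finite_trans_measure_prob.

Lemma measurable_finite_cost : measurable_fun [set: discr 'I_N.+1 * discr U]
  (fun z => finite_cost z.1 z.2).
Proof. by move=> _ B _; exact: discr_prod_measurable. Qed.

Lemma bounded_finite_cost : exists K : R, forall i u, `|finite_cost i u| <= K.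
Proof.
exists (\sum_(z : 'I_N.+1 * U) `|finite_cost z.1 z.2|) => i u.
by rewrite (bigD1 (i, u))//= lerDl sumr_ge0.
Qed.

Definition finite_model : @mdp R _ (discr 'I_N.+1) U :=
  @Mdp R _ (discr 'I_N.+1) U finite_cost finite_trans_measure
    measurable_finite_cost bounded_finite_cost.

(** [inf] is [min] here, [U] being finite and nonempty. *)
Definition minU (f : U -> R) : R := inf (range f).

Definition optimality_equation (r : R) (Q : 'I_N.+1 -> U -> R) : Prop :=
  forall i u, r + Q i u = finite_cost i u + \sum_j finite_trans i u j * minU (Q j).

Definition recenter (i0 : 'I_N.+1) (u0 : U) (Q : 'I_N.+1 -> U -> R) :
    'I_N.+1 -> U -> R :=
  fun i u => Q i u - Q i0 u0.

Definition learned_policy (Q : 'I_N.+1 -> U -> R)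
    (f : {mfun borel X >-> discr U}) : Prop :=
  forall x u, Q (bin_index x) (f x) <= Q (bin_index x) u.

(** ** Synchronous quantized Q-learning *)

Context dO (Omega : measurableType dO) (P : probability Omega R).

Definition mutually_independent (F : nat -> set (set Omega)) : Prop :=
  forall (s : seq nat) (E : nat -> set Omega), uniq s ->
    (forall t, t \in s -> F t (E t)) ->
    P (\bigcap_(t in [set` s]) E t) = (\prod_(t <- s) P (E t))%E.

Definition iteration_sigma
    (x x1 : nat -> 'I_N.+1 -> U -> {mfun Omega >-> borel X}) (t : nat) :
    set (set Omega) :=
  <<s \bigcup_(p in [set: 'I_N.+1 * U])
        preimage_set_system [set: Omega]
          (fun w => (x t p.1 p.2 w, x1 t p.1 p.2 w))
          (@measurable _ (borel X * borel X)%type) >>.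

(** At each iteration and for each pair [(i, u)], [x t i u] is drawn from the
    normalized weight measure of the bin [i] and [x1 t i u] from
    [trans M (x t i u, u)]; the iterations are independent, and nothing is
    required of the joint law of the samples of one iteration. *)
Definition sampling
    (x x1 : nat -> 'I_N.+1 -> U -> {mfun Omega >-> borel X}) : Prop :=
  (forall t i u (A B : set (borel X)), measurable A -> measurable B ->
     P ((x t i u @^-1` A) `&` (x1 t i u @^-1` B)) =
     \int[bin_weight i]_(z in A) trans M (z, u) B)%E /\
  mutually_independent (iteration_sigma x x1).

Fixpoint Qlearning (alpha : nat -> R) (Q0 : 'I_N.+1 -> U -> R)
    (x x1 : nat -> 'I_N.+1 -> U -> {mfun Omega >-> borel X})
    (t : nat) (w : Omega) : 'I_N.+1 -> U -> R :=
  if t is t'.+1 then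
    let Q := Qlearning alpha Q0 x x1 t' w in
    fun i u => (1 - alpha t') * Q i u +
      alpha t' * (cost M (x t' i u w) u + minU (Q (bin_index (x1 t' i u w))))
  else Q0.

End quantization.

(** On the finite sets at hand, [sup] and [inf] are [max] and [min]. *)
Definition span_seminorm (R : realType) (S : Type) (U : Type)
    (Q : S -> U -> R) : R :=
  sup (range (uncurry Q)) - inf (range (uncurry Q)).

Definition uniform_norm (R : realType) (S : Type) (U : Type)
    (Q : S -> U -> R) : R :=
  sup (range (fun z => `|uncurry Q z|)).

Section conditions.
Context (R : realType) (X : completeMetricType R) (U : finPointedType).
Variable M : @mdp R _ (borel X) U.

Definition minorization (nu : {measure set (borel X) -> \bar R}) : Prop :=
  (0 < nu [set: X])%E /\
  forall (B : set (borel X)) x u, measurable B ->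
    (nu B <= trans M (x, u) B)%E.

Definition coupling (m m' : {measure set (borel X) -> \bar R}) :
    set (probability (borel X * borel X)%type R) :=
  [set g | forall A : set (borel X), measurable A ->
     g (A `*` setT) = m A /\ g (setT `*` A) = m' A].

Definition wasserstein1 (m m' : {measure set (borel X) -> \bar R}) : \bar R :=
  ereal_inf [set (\int[g]_z (mdist z.1 z.2)%:E)%E | g in coupling m m'].

Definition lipschitz_condition (Kc KT : R) : Prop :=
  [/\ compact [set: X],
      forall x x' u, `|cost M x u - cost M x' u| <= Kc * mdist x x' &
      forall x x' u, (wasserstein1 (trans M (x, u)) (trans M (x', u)) <=
        (KT * mdist x x')%:E)%E].

Definition weak_cvg (m : nat -> {measure set (borel X) -> \bar R})
    (l : {measure set (borel X) -> \bar R}) : Prop :=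
  forall f : X -> R, continuous f -> (exists K, forall x, `|f x| <= K) ->
    (fun n => \int[m n]_x (f x)%:E)%E @ \oo --> (\int[l]_x (f x)%:E)%E.

(** [U] is finite, hence discrete: convergence in [U] is eventual equality.
    Boundedness of the cost is part of [mdp]. *)
Definition weak_continuity_condition : Prop :=
  [/\ compact [set: X],
      forall u, continuous (cost M ^~ u : X -> R) &
      forall (x_ : nat -> X) (u_ : nat -> U) x u,
        x_ @ \oo --> x -> (\forall n \near \oo, u_ n = u) ->
        weak_cvg (fun n => trans M (x_ n, u_ n)) (trans M (x, u))].

Definition diameter : R :=
  sup [set mdist z.1 z.2 | z in [set: X * X]].

End conditions.

(* Main.v *)
Require Import Defs.
From HB Require Import structures.
From mathcomp Require Import all_boot all_order all_algebra.
From mathcomp Require Import all_classical all_reals all_analysis.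
From mathcomp Require Import measurable_realfun.
From mathcomp Require Import ring lra.
Import Order.TTheory GRing.Theory Num.Theory.
Import numFieldNormedType.Exports.
Local Open Scope classical_set_scope.
Local Open Scope ring_scope.

(** The bounds on costs rest on one comparison between Bellman operators; the
    convergence of Q-learning is a separate argument, given last.

    Write [Qval M h x u] for the cost of action [u] at [x] plus the expected
    value of [h] after the transition.  A pair [(r, h)] with [minU (Qval M h x)]
    close to [r + h x] for all [x] ([near_acoe]) pins down the optimal average
    cost from every initial state: using [h] as terminal cost, every policy
    collects at least [r] per stage, and a measurable greedy policy collects no
    more, up to the error ([near_acoe_optimal_cost]).  Solutions up to every
    positive error are enough, since their gains then form a Cauchy family.

    The optimality equation of the finite model says that its Q-function is
    [Qval] of the lifted value function averaged over a bin
    ([optimality_bin_mean]).  Averaging over a bin moves [Qval M h] by at most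
    some [e'], governed by the regularity of [h] and by the quantization error.
    Evaluating the two equations near the extrema of the difference of the two
    value functions bounds the difference of the gains by [e']
    ([gain_comparison]).  Under minorization that difference moreover has
    oscillation at most [2 e' / (1 - kappa)], so the learned policy is
    [2 e' / (1 - kappa)]-optimal ([learned_policy_Qval]).

    It remains to produce regular near solutions.  When [KT < 1], they come from
    discounted problems with discount close to 1, whose values share a Lipschitz
    constant ([lipschitz_near_acoe]).  Under minorization, value iteration with
    the common part [nu] of the transition laws removed contracts by [kappa], and
    it preserves continuity as well as the Hölder bound of every admissible
    exponent [delta] ([minorization_near_acoe]).  The factor
    [KT `^ delta * kappa `^ (1 - delta)] by which it contracts Hölder constants
    is an interpolation between the Wasserstein estimate for Lipschitz functions
    and the estimate by the mass [kappa] for bounded ones ([mean_holder]).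

    For the learning algorithm, the step sizes [1 / (t + 1)] make the iterate at
    time [T] the plain average of the first [T] sampled targets
    ([Qlearning_sum]). Hence the oscillation of the error is at most [beta]
    times the average of its own past values, plus an average of martingale
    differences. These differences grow at most logarithmically, since the
    oscillation of the iterates grows at most like a harmonic sum, and they are
    orthogonal, so a second moment estimate along the cubes shows that their
    averages vanish almost surely ([orthogonal_slln]). The remaining
    deterministic recursion forces convergence to 0 because [beta < 1]
    ([averaged_contraction]). *)

Set Implicit Arguments.
Unset Strict Implicit.
Unset Printing Implicit Defensive.

(** * Means of bounded measurable functions *)

Section bounded_measurable.
Context d (T : measurableType d) (R : realType).
Implicit Types f g : T -> R.

(** Costs are bounded, so all the integrands below belong to this class, on which
    the real-valued integral against a probability measure is linear and
    monotone without further side conditions. *)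
Definition bmeas f : Prop :=
  measurable_fun [set: T] f /\ exists K, forall x, `|f x| <= K.

Lemma bmeas_cst (r : R) : bmeas (fun=> r).
Proof. by split; [exact: measurable_cst|exists `|r|]. Qed.

Lemma bmeasN f : bmeas f -> bmeas (fun x => - f x).
Proof.
move=> [mf [K fK]]; split; first exact: measurableT_comp.
by exists K => x; rewrite normrN.
Qed.

Lemma bmeasD f g : bmeas f -> bmeas g -> bmeas (fun x => f x + g x).
Proof.
move=> [mf [K fK]] [mg [L gL]]; split; first exact: measurable_funD.
by exists (K + L) => x; rewrite (le_trans (ler_normD _ _))// lerD.
Qed.

Lemma bmeasB f g : bmeas f -> bmeas g -> bmeas (fun x => f x - g x).
Proof. by move=> bf bg; apply: bmeasD => //; exact: bmeasN. Qed.

Lemma bmeasM f g : bmeas f -> bmeas g -> bmeas (fun x => f x * g x).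
Proof.
move=> [mf [K fK]] [mg [L gL]]; split; first exact: measurable_funM.
by exists (K * L) => x; rewrite normrM ler_pM.
Qed.

Lemma bmeasZ r f : bmeas f -> bmeas (fun x => r * f x).
Proof. by move=> bf; apply: (bmeasM (bmeas_cst r) bf). Qed.

Lemma bmeas_sum (I : Type) (s : seq I) (F : I -> T -> R) :
  (forall i, bmeas (F i)) -> bmeas (fun x => \sum_(i <- s) F i x).
Proof.
move=> bF; elim: s => [|i s IH].
  by under eq_fun do rewrite big_nil; exact: bmeas_cst.
by under eq_fun do rewrite big_cons; exact: bmeasD.
Qed.

Lemma bmeas_norm f : bmeas f -> bmeas (fun x => `|f x|).
Proof.
move=> [mf [K fK]]; split; first exact: measurableT_comp.
by exists K => x; rewrite normr_id.
Qed.

Lemma bmeas_indic (A : set T) : measurable A -> bmeas (\1_A : T -> R).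
Proof.
move=> mA; split; first exact: measurable_indic.
by exists 1 => x; rewrite indicE; case: (_ \in _); rewrite /= ?normr1 ?normr0.
Qed.

Section integral.
Variables (m : {measure set T -> \bar R}) (D : set T).
Hypothesis mD : measurable D.

Lemma bmeas_integrable f : (m D < +oo)%E -> bmeas f ->
  m.-integrable D (EFin \o f).
Proof.
move=> mDy [mf [K fK]]; apply: measurable_bounded_integrable => //.
  exact: measurable_funTS.
exists K; split; first exact: num_real.
by move=> x Kx t _ /=; exact: le_trans (fK t) (ltW Kx).
Qed.

Hypothesis mD1 : m D = 1%E.

Let mDy : (m D < +oo)%E. Proof. by rewrite mD1 ltry. Qed.
Local Notation E f := (\int[m]_(x in D) f x)%R.

Lemma meanD f g : bmeas f -> bmeas g -> E (fun x => f x + g x) = E f + E g.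
Proof. by move=> ? ?; rewrite RintegralD//; exact: bmeas_integrable. Qed.

Lemma meanB f g : bmeas f -> bmeas g -> E (fun x => f x - g x) = E f - E g.
Proof. by move=> ? ?; rewrite RintegralB//; exact: bmeas_integrable. Qed.

Lemma meanZ r f : bmeas f -> E (fun x => r * f x) = r * E f.
Proof. by move=> ?; rewrite RintegralZl//; exact: bmeas_integrable. Qed.

Lemma meanDcst f r : bmeas f -> E (fun x => f x + r) = E f + r.
Proof.
move=> bf; rewrite (meanD bf (bmeas_cst r)); congr (_ + _).
by rewrite Rintegral_cst// mD1 mulr1.
Qed.

Lemma mean_cst r : E (fun=> r) = r.
Proof. by rewrite Rintegral_cst// mD1 mulr1. Qed.

Lemma mean_sum (I : Type) (s : seq I) (F : I -> T -> R) :
  (forall i, bmeas (F i)) ->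
  E (fun x => \sum_(i <- s) F i x) = \sum_(i <- s) E (F i).
Proof.
move=> bF; elim: s => [|i s IH].
  by under eq_Rintegral do rewrite big_nil; rewrite big_nil mean_cst.
under eq_Rintegral do rewrite big_cons.
by rewrite meanD ?big_cons ?IH//; exact: bmeas_sum.
Qed.

Lemma mean_le f g : bmeas f -> bmeas g -> (forall x, D x -> f x <= g x) ->
  E f <= E g.
Proof. by move=> ? ? ?; apply: le_Rintegral => //; exact: bmeas_integrable. Qed.

Lemma mean_le_cst f r : bmeas f -> (forall x, D x -> f x <= r) -> E f <= r.
Proof.
by move=> bf fr; rewrite -(mean_cst r); apply: mean_le => //; exact: bmeas_cst.
Qed.

Lemma mean_ge_cst f r : bmeas f -> (forall x, D x -> r <= f x) -> r <= E f.
Proof.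
by move=> bf fr; rewrite -(mean_cst r); apply: mean_le => //; exact: bmeas_cst.
Qed.

Lemma mean_norm_le f r : bmeas f -> (forall x, D x -> `|f x| <= r) ->
  `|E f| <= r.
Proof.
move=> bf fr; rewrite ler_norml mean_ge_cst ?mean_le_cst// => x Dx.
  by have := fr x Dx; rewrite ler_norml => /andP[].
by have := fr x Dx; rewrite ler_norml => /andP[].
Qed.

Lemma EFin_mean f : bmeas f -> (E f)%:E = (\int[m]_(x in D) (f x)%:E)%E.
Proof.
move=> bf; rewrite /Rintegral fineK//; apply: integrable_fin_num => //.
exact: bmeas_integrable.
Qed.

End integral.

Lemma mean_le_measure (m1 m2 : {measure set T -> \bar R}) f :
  (forall A, measurable A -> (m1 A <= m2 A)%E) -> (m2 setT < +oo)%E ->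
  bmeas f -> (forall x, 0 <= f x) ->
  (\int[m1]_x f x <= \int[m2]_x f x)%R.
Proof.
move=> m12 m2y bf f0; apply: fine_le.
- apply: integrable_fin_num => //; apply: bmeas_integrable => //.
  by rewrite (le_lt_trans _ m2y)// m12.
- by apply: integrable_fin_num => //; exact: bmeas_integrable.
- apply: ge0_le_measure_integral => //; apply/measurable_EFinP.
  by case: bf.
Qed.

End bounded_measurable.

Lemma bmeas_comp d d' (T : measurableType d) (T' : measurableType d')
    (R : realType) (f : T' -> R) (g : T -> T') :
  measurable_fun [set: T] g -> bmeas f -> bmeas (f \o g).
Proof.
move=> mg [mf [K fK]]; split; first exact: measurableT_comp.
by exists K => x; exact: fK.
Qed.

Section kernel_mean.
Context d d' (X : measurableType d) (Y : measurableType d') (R : realType).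

(** Measurability is known for nonnegative integrands; a bound on [f] makes it
    nonnegative after the addition of a constant. *)
Lemma bmeas_kernel (k : R.-pker X ~> Y) (f : X * Y -> R) : bmeas f ->
  bmeas (fun x => \int[k x]_y f (x, y))%R.
Proof.
move=> bf; have [mf [K fK]] := bf.
have bfx x : bmeas (fun y => f (x, y)).
  split; first exact: measurable_fun_pair2.
  by exists K => y; exact: fK.
split; last first.
  by exists K => x; apply: mean_norm_le => //; exact: prob_kernel.
have -> : (fun x => \int[k x]_y f (x, y))%R =
    (fun x => fine (\int[k x]_y (f (x, y) + K)%:E)%E - K).
  apply/funext => x; rewrite -[fine _]/(\int[k x]_y (f (x, y) + K))%R.
  rewrite (meanD measurableT (prob_kernel x)) ?mean_cst ?addrK//.
    exact: prob_kernel.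
  exact: bmeas_cst.
apply: measurable_funB => //; apply: measurableT_comp => //.
apply: (measurable_fun_integral_finite_kernel (fun z => (f z + K)%:E) k).
  by move=> z; rewrite lee_fin -lerBlDr sub0r lerNnormlW.
by apply/measurable_EFinP; exact: measurable_funD.
Qed.

Lemma bmeas_kernel_snd (k : R.-pker X ~> Y) (f : Y -> R) : bmeas f ->
  bmeas (fun x => \int[k x]_y f y)%R.
Proof.
by move=> bf; apply: (bmeas_kernel k (f := f \o snd)); exact: bmeas_comp.
Qed.

End kernel_mean.

(** Change of variables, for any measure [m] that agrees with the law of [phi],
    such as a marginal of a coupling or a product of independent laws. *)
Lemma mean_image d d' (T : measurableType d) (T' : measurableType d')
    (R : realType) (P : probability T R) (phi : T -> T')
    (m : {measure set T' -> \bar R}) (f : T' -> R) :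
  measurable_fun [set: T] phi ->
  (forall A, measurable A -> m A = P (phi @^-1` A)) -> bmeas f ->
  (\int[m]_y f y = \int[P]_x f (phi x))%R.
Proof.
move=> mphi mE bf; rewrite /Rintegral; congr fine.
pose Y : {mfun T >-> T'} := HB.pack phi (isMeasurableFun.Build _ _ _ _ _ mphi).
rewrite -[RHS](integral_distribution (X := Y) (f := EFin \o f)).
- by apply: (@eq_measure_integral _ _ _ setT (distribution P Y)) => A mA _; exact: mE.
- by apply/measurable_EFinP; case: bf.
- apply: bmeas_integrable => //; last exact: (bmeas_comp mphi bf).
  by rewrite (le_lt_trans (probability_le1 _ _))// ltry.
Qed.

Section pkproduct_integral.
Context d0 d1 d2 (X : measurableType d0) (Y : measurableType d1)
  (Z : measurableType d2) (R : realType).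
Context (k1 : R.-pker X ~> Y) (k2 : R.-pker (X * Y) ~> Z).

(** The kernel that keeps the current point and adjoins the next one: composing
    it with [k1] gives [pkproduct k1 k2], so that iterated integration along a
    composition applies. *)
Let graph (xy : X * Y) (z : Z) : Y * Z := (xy.2, z).

Let mgraph xy : measurable_fun [set: Z] (graph xy).
Proof. by apply: measurable_fun_pair => //. Qed.

Let gmap (xy : X * Y) := pushforward (k2 xy) (graph xy).

Let gmap0 xy : gmap xy set0 = 0%E.
Proof. by rewrite /gmap /pushforward preimage_set0 measure0. Qed.

Let gmap_ge0 xy A : (0 <= gmap xy A)%E.
Proof. exact: measure_ge0. Qed.

Let gmap_sigma_additive xy : semi_sigma_additive (gmap xy).
Proof.
exact: (@measure_semi_sigma_additive _ _ _ (@pushforward _ _ _ _ R (k2 xy) (graph xy))).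
Qed.

HB.instance Definition _ xy := isMeasure.Build _ _ _ (gmap xy)
  (gmap0 xy) (@gmap_ge0 xy) (@gmap_sigma_additive xy).

Let kgraph : X * Y -> {measure set (Y * Z) -> \bar R} := gmap.

Let kgraphE xy A : measurable A ->
  kgraph xy A = (\int[k2 xy]_z (\1_A (xy.2, z))%:E)%E.
Proof.
move=> mA.
have -> : (fun z => (\1_A (xy.2, z))%:E) =
    (fun z => (\1_(graph xy @^-1` A) z)%:E :> \bar R).
  by apply/funext => z; rewrite !indicE; congr ((nat_of_bool _)%:R%:E).
rewrite integral_indic ?setIT//.
by rewrite -[X in measurable X]setTI; exact: mgraph.
Qed.

Let measurable_kgraph A : measurable A ->
  measurable_fun [set: X * Y] (kgraph ^~ A).
Proof.
move=> mA; rewrite (_ : kgraph ^~ A = fun xy => (\int[k2 xy]_z (\1_A (xy.2, z))%:E)%E).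
  exact: kernel.measurable_intker_indic.
by apply/funext => xy; exact: kgraphE.
Qed.

HB.instance Definition _ := isKernel.Build _ _ _ _ _ kgraph measurable_kgraph.

Let kgraph_prob xy : kgraph xy [set: Y * Z] = 1%E.
Proof. by rewrite /kgraph/= /gmap /pushforward preimage_setT prob_kernel. Qed.

HB.instance Definition _ :=
  Kernel_isProbability.Build _ _ _ _ _ kgraph kgraph_prob.

Let bmeas_graph (F : Y * Z -> R) xy : bmeas F -> bmeas (fun z => F (graph xy z)).
Proof. by move=> bF; exact: (bmeas_comp (mgraph xy) bF). Qed.

Let p1 x : k1 x [set: Y] = 1%E. Proof. exact: prob_kernel. Qed.
Let p2 xy : k2 xy [set: Z] = 1%E. Proof. exact: prob_kernel. Qed.
Let p12 x : pkproduct k1 k2 x [set: Y * Z] = 1%E.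
Proof. exact: prob_kernel. Qed.

Lemma mean_pkproduct (F : Y * Z -> R) x : bmeas F ->
  (\int[pkproduct k1 k2 x]_w F w =
   \int[k1 x]_y \int[k2 (x, y)]_z F (y, z))%R.
Proof.
move=> bF; have [mF [K FK]] := bF.
pose G w := F w + K.
have bG : bmeas G by apply: bmeasD => //; exact: bmeas_cst.
suff HG : (\int[pkproduct k1 k2 x]_w G w =
   \int[k1 x]_y \int[k2 (x, y)]_z G (y, z))%R.
  move: HG; rewrite (meanDcst measurableT (p12 x) K bF).
  have step y : (\int[k2 (x, y)]_z G (y, z) = \int[k2 (x, y)]_z F (y, z) + K)%R.
    exact: (meanDcst measurableT (p2 (x, y)) K (bmeas_graph (x, y) bF)).
  under [in RHS]eq_Rintegral do rewrite step.
  rewrite (meanDcst measurableT (p1 x)) => [/addIr //|].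
  have bk : bmeas (fun xy => \int[k2 xy]_z F (graph xy z))%R.
    apply: (bmeas_kernel k2 (f := fun w => F (w.1.2, w.2))).
    apply: (bmeas_comp _ bF); apply: measurable_fun_pair => //.
    exact: measurableT_comp.
  exact: (bmeas_comp (g := pair x) _ bk).
have G0 w : (0 <= (G w)%:E)%E by rewrite lee_fin -lerBlDr sub0r lerNnormlW.
have mG : measurable_fun [set: Y * Z] (EFin \o G).
  by apply/measurable_EFinP; case: bG.
rewrite /Rintegral; congr fine.
rewrite (eq_measure_integral (kcomp k1 kgraph x)); last first.
  move=> A mA _; rewrite /pkproduct/= /kproduct /kcomp.
  by apply: eq_integral => y _; rewrite -[RHS]/(kgraph (x, y) A) kgraphE.
rewrite integral_kcomp//.
apply: eq_integral => y _.
transitivity (\int[k2 (x, y)]_z (G (y, z))%:E)%E; last first.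
  exact/esym/(EFin_mean measurableT (p2 (x, y)) (bmeas_graph (x, y) bG)).
rewrite -[LHS]/(\int[pushforward (k2 (x, y)) (graph (x, y))]_w (G w)%:E)%E.
by rewrite ge0_integral_pushforward.
Qed.

End pkproduct_integral.

(** * Expected costs of policies *)

Section verification.
Context (R : realType) d (X : measurableType d) (U : finPointedType).
Variable M : mdp R X U.

Definition Qval (h : X -> R) (x : X) (u : U) : R :=
  cost M x u + (\int[trans M (x, u)]_y h y)%R.

Lemma bmeas_cost : bmeas (fun z : X * discr U => cost M z.1 z.2).
Proof.
split; first exact: measurable_cost.
by have [K cK] := bounded_cost M; exists K => z; exact: cK.
Qed.

Lemma bmeas_cost1 u : bmeas (cost M ^~ u).
Proof.
apply: (bmeas_comp (g := fun x : X => (x, u : discr U)) _ bmeas_cost).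
exact: measurable_fun_pair.
Qed.

Lemma bmeas_Qval h : bmeas h ->
  bmeas (fun z : X * discr U => Qval h z.1 z.2).
Proof.
move=> bh; apply: bmeasD; first exact: bmeas_cost.
rewrite (_ : (fun _ => _) = fun z => (\int[trans M z]_y h y)%R).
  exact: bmeas_kernel_snd.
by apply/funext => -[].
Qed.

Lemma bmeas_Qval1 h u : bmeas h -> bmeas (Qval h ^~ u).
Proof.
move=> bh.
apply: (bmeas_comp (g := fun x : X => (x, u : discr U)) _ (bmeas_Qval bh)).
exact: measurable_fun_pair.
Qed.

Lemma bmeas_total_cost t : bmeas (@total_cost _ _ _ _ M t).
Proof.
elim: t => [|t IH]; first exact: bmeas_cst.
apply: bmeasD.
  apply: (bmeas_comp (g := fun w : hist X U t.+1 => w.1.1) _ IH).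
  exact: measurableT_comp.
apply: (bmeas_comp (g := fun w : hist X U t.+1 => (current w.1.1, w.1.2))
  _ bmeas_cost).
apply: measurable_fun_pair; last exact: measurableT_comp.
apply: measurableT_comp; first exact: measurable_current.
exact: measurableT_comp.
Qed.

Definition horizon_cost (pi : policy R X U) h t x : R :=
  (\int[law M pi t x]_w (total_cost M w + h (current w)))%R.

Lemma bmeas_horizon h t : bmeas h ->
  bmeas (fun w : hist X U t => total_cost M w + h (current w)).
Proof.
move=> bh; apply: bmeasD; first exact: bmeas_total_cost.
by apply: (bmeas_comp _ bh); exact: measurable_current.
Qed.

Lemma law_prob (pi : policy R X U) t x : law M pi t x [set: _] = 1%E.
Proof. exact: prob_kernel. Qed.

Lemma bmeas_stage (h : X -> R) t : bmeas h ->
  bmeas (fun v : hist X U t * discr U =>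
    total_cost M v.1 + Qval h (current v.1) v.2).
Proof.
move=> bh; apply: bmeasD.
  exact: (bmeas_comp measurable_fst (bmeas_total_cost t)).
apply: (bmeas_comp (g := fun v : hist X U t * discr U => (current v.1, v.2))
  _ (bmeas_Qval bh)).
apply: measurable_fun_pair => //.
by apply: measurableT_comp => //; exact: measurable_current.
Qed.

(** Dynamic programming step: averaging over the last transition turns the
    terminal cost [h] into [Qval h]. *)
Lemma horizon_costS pi h t x : bmeas h ->
  horizon_cost pi h t.+1 x =
  (\int[law M pi t x]_w \int[pi t w]_u
     (total_cost M w + Qval h (current w) u))%R.
Proof.
move=> bh; rewrite /horizon_cost [law _ _ _]/=.
rewrite (mean_pkproduct _ _ _ (bmeas_horizon t.+1 bh)).
rewrite -(mean_pkproduct _ (kpre (pi t) measurable_snd) x (bmeas_stage t bh)).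
apply: eq_Rintegral => -[w u] _ /=.
rewrite -[LHS]/(\int[trans M (current w, u)]_z
  (total_cost M w + cost M (current w) u + h z))%R.
under eq_Rintegral do rewrite addrC.
rewrite (meanDcst measurableT)//; last exact: prob_kernel.
by rewrite addrC addrA.
Qed.

Lemma horizon_cost0 pi h x : bmeas h -> horizon_cost pi h 0 x = h x.
Proof.
move=> [mh _]; rewrite /horizon_cost/= /Rintegral.
rewrite -[X in fine X]/(\int[\d_x]_w ((0 + h w)%:E))%E.
rewrite integral_dirac//; last first.
  by apply/measurable_EFinP; apply: measurable_funD.
by rewrite diracT mul1e/= add0r.
Qed.

(** A subsolution of the optimality equation, taken as terminal cost, gains at
    least [r] at each step, whatever the past of the history and the action. *)
Lemma horizon_cost_ge pi h r x : bmeas h ->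
  (forall y u, r + h y <= Qval h y u) ->
  forall t, h x + t%:R * r <= horizon_cost pi h t x.
Proof.
move=> bh hr; elim => [|t IH]; first by rewrite mul0r addr0 horizon_cost0.
rewrite -natr1 mulrDl mul1r addrA (le_trans (lerD IH (lexx r)))//.
rewrite horizon_costS// /horizon_cost -(meanDcst measurableT) => [||]; last 2 first.
- exact: prob_kernel.
- exact: bmeas_horizon.
apply: (mean_le measurableT); first exact: prob_kernel.
- by apply: bmeasD; [exact: bmeas_horizon|exact: bmeas_cst].
- exact: (bmeas_kernel (pi t) (bmeas_stage t bh)).
move=> w _; apply: (mean_ge_cst measurableT); first exact: prob_kernel.
  exact: (bmeas_comp (g := pair w) _ (bmeas_stage t bh)).
by move=> u _; rewrite -addrA lerD2l addrC.
Qed.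

Lemma horizon_costS_stationary (f : {mfun X >-> discr U}) h t x : bmeas h ->
  horizon_cost (stationary f) h t.+1 x =
  (\int[law M (stationary f) t x]_w
     (total_cost M w + Qval h (current w) (f (current w))))%R.
Proof.
move=> bh; rewrite horizon_costS//; apply: eq_Rintegral => w _.
rewrite /Rintegral -[X in fine X]/(\int[\d_(f (current w) : discr U)]_u
  ((total_cost M w + Qval h (current w) u)%:E))%E.
rewrite integral_dirac//; first by rewrite diracT mul1e.
apply/measurable_EFinP.
by have [] := bmeas_comp (g := pair w) (measurable_pair1 w) (bmeas_stage t bh).
Qed.

Lemma bmeas_stage_stationary (f : {mfun X >-> discr U}) h t : bmeas h ->
  bmeas (fun w : hist X U t =>
    total_cost M w + Qval h (current w) (f (current w))).
Proof.
move=> bh.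
apply: (bmeas_comp (g := fun w : hist X U t => (w, f (current w)))
  _ (bmeas_stage t bh)).
apply: measurable_fun_pair => //.
by apply: measurableT_comp => //; exact: measurable_current.
Qed.

Lemma horizon_cost_stationary_le (f : {mfun X >-> discr U}) h r x : bmeas h ->
  (forall y, Qval h y (f y) <= r + h y) ->
  forall t, horizon_cost (stationary f) h t x <= h x + t%:R * r.
Proof.
move=> bh hr; elim => [|t IH]; first by rewrite mul0r addr0 horizon_cost0.
rewrite -natr1 mulrDl mul1r addrA (le_trans _ (lerD IH (lexx r)))//.
rewrite horizon_costS_stationary// /horizon_cost.
rewrite -(meanDcst measurableT) => [||]; last 2 first.
- exact: prob_kernel.
- exact: bmeas_horizon.
apply: (mean_le measurableT); first exact: prob_kernel.
- exact: bmeas_stage_stationary.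
- by apply: bmeasD; [exact: bmeas_horizon|exact: bmeas_cst].
by move=> w _; rewrite -addrA lerD2l addrC.
Qed.

Lemma horizon_cost_stationary_ge (f : {mfun X >-> discr U}) h r x : bmeas h ->
  (forall y, r + h y <= Qval h y (f y)) ->
  forall t, h x + t%:R * r <= horizon_cost (stationary f) h t x.
Proof.
move=> bh hr; elim => [|t IH]; first by rewrite mul0r addr0 horizon_cost0.
rewrite -natr1 mulrDl mul1r addrA (le_trans (lerD IH (lexx r)))//.
rewrite horizon_costS_stationary// /horizon_cost.
rewrite -(meanDcst measurableT) => [||]; last 2 first.
- exact: prob_kernel.
- exact: bmeas_horizon.
apply: (mean_le measurableT); first exact: prob_kernel.
- by apply: bmeasD; [exact: bmeas_horizon|exact: bmeas_cst].
- exact: bmeas_stage_stationary.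
by move=> w _; rewrite -addrA lerD2l addrC.
Qed.

End verification.

(** * Average costs and near solutions of the optimality equation *)

Section limn_esup.
Context (R : realType).
Implicit Types (u : (\bar R)^nat) (l : \bar R).

Lemma limn_esup_le_near u l : (\forall n \near \oo, (u n <= l)%E) ->
  (limn_esup u <= l)%E.
Proof.
move=> ul; rewrite /limn_esup /limf_esup.
apply: (@le_trans _ _ (ereal_sup (u @` [set n | (u n <= l)%E]))).
  by apply: ereal_inf_lbound; exists [set n | (u n <= l)%E].
by apply: ge_ereal_sup => _ [n /= un <-].
Qed.

Lemma limn_esup_ge_near u l : (\forall n \near \oo, (l <= u n)%E) ->
  (l <= limn_esup u)%E.
Proof.
move=> ul; rewrite /limn_esup /limf_esup.
apply: le_ereal_inf_tmp => _ [V Voo <-].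
have [n [/= Vn un]] := @filter_ex _ \oo _ _ (filterI Voo ul).
by apply: le_trans un _; apply: ereal_sup_ubound; exists n.
Qed.

End limn_esup.

Section average_cost_bounds.
Context (R : realType) d (X : measurableType d) (U : finPointedType).
Variable M : mdp R X U.

Let mean_total pi t x := (\int[law M pi t x]_w total_cost M w)%R.

Let average_costE pi x : average_cost M pi x =
  limn_esup (fun t => (t%:R^-1 * mean_total pi t x)%:E).
Proof.
congr limn_esup; apply/funext => t; rewrite EFinM; congr (_ * _)%E.
apply/esym; apply: EFin_mean => //; first exact: law_prob.
exact: bmeas_total_cost.
Qed.

Let mean_total_horizon pi h K t x : bmeas h -> (forall y, `|h y| <= K) ->
  `|horizon_cost M pi h t x - mean_total pi t x| <= K.
Proof.
move=> bh hK; rewrite -(meanB measurableT (law_prob _ _ _ _)); last 2 first.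
- exact: bmeas_horizon.
- exact: bmeas_total_cost.
apply: (mean_norm_le measurableT (law_prob _ _ _ _)).
  by apply: bmeasB; [exact: bmeas_horizon|exact: bmeas_total_cost].
by move=> w _; rewrite addrC addKr.
Qed.

(** A bounded terminal cost contributes only [O(1/t)] to the mean over [t]
    stages. *)
Lemma average_cost_ge pi h r x : bmeas h ->
  (forall t, h x + t%:R * r <= horizon_cost M pi h t x) ->
  (r%:E <= average_cost M pi x)%E.
Proof.
move=> bh hr; have [_ [K hK]] := bh; rewrite average_costE.
apply/lee_subgt0Pr => e e0; rewrite -EFinB; apply: limn_esup_ge_near.
exists (Num.truncn (2 * K / e)).+1 => //= t /= te; rewrite lee_fin.
have t0 : 0 < t%:R :> R by rewrite ltr0n (leq_trans _ te).
rewrite mulrC ler_pdivlMr//.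
have := hr t; have := mean_total_horizon pi t x bh hK.
have := hK x; rewrite !ler_norml => /andP[h1 h2] /andP[h3 h4] h5.
have te' : 2 * K <= t%:R * e.
  rewrite -ler_pdivrMr//; apply: ltW; rewrite -(@ltr_nat R) in te.
  apply: lt_le_trans (truncnS_gt _) _.
  by rewrite ler_nat; move: te; rewrite ltr_nat.
lra.
Qed.

Lemma average_cost_le pi h r x : bmeas h ->
  (forall t, horizon_cost M pi h t x <= h x + t%:R * r) ->
  (average_cost M pi x <= r%:E)%E.
Proof.
move=> bh hr; have [_ [K hK]] := bh; rewrite average_costE.
apply/lee_addgt0Pr => e e0; rewrite -EFinD; apply: limn_esup_le_near.
exists (Num.truncn (2 * K / e)).+1 => //= t /= te; rewrite lee_fin.
have t0 : 0 < t%:R :> R by rewrite ltr0n (leq_trans _ te).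
rewrite mulrC ler_pdivrMr//.
have := hr t; have := mean_total_horizon pi t x bh hK.
have := hK x; rewrite !ler_norml => /andP[h1 h2] /andP[h3 h4] h5.
have te' : 2 * K <= t%:R * e.
  rewrite -ler_pdivrMr//; apply: ltW; rewrite -(@ltr_nat R) in te.
  apply: lt_le_trans (truncnS_gt _) _.
  by rewrite ler_nat; move: te; rewrite ltr_nat.
lra.
Qed.

End average_cost_bounds.

Section minU.
Context (R : realType) (U : finPointedType).
Implicit Types f g : U -> R.

Lemma minU_attained f : exists u, minU f = f u.
Proof.
have [u _ fu] := @arg_minP _ _ _ (point : U) xpredT f isT.
exists u; apply/le_anti/andP; split; first last.
  by apply: lb_le_inf; [exists (f u), u|move=> _ [v _ <-]; exact: fu].
by apply: ge_inf; [exists (f u) => _ [v _ <-]; exact: fu|exists u].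
Qed.

Lemma minU_le f u : minU f <= f u.
Proof.
apply: ge_inf; last by exists u.
have [v _ fv] := @arg_minP _ _ _ (point : U) xpredT f isT.
by exists (f v) => _ [w _ <-]; exact: fv.
Qed.

Lemma minU_ge f r : (forall u, r <= f u) -> r <= minU f.
Proof. by move=> rf; have [u ->] := minU_attained f. Qed.

Lemma minU_leD f g r : (forall u, f u <= g u + r) -> minU f <= minU g + r.
Proof.
by move=> fg; have [u ->] := minU_attained g; exact: le_trans (minU_le f u) (fg u).
Qed.

Lemma minU_dist f g r : (forall u, `|f u - g u| <= r) -> `|minU f - minU g| <= r.
Proof.
move=> fg; rewrite ler_distl lerBlDr.
by apply/andP; split; apply: minU_leD => u; have := fg u;
  rewrite ler_distl => /andP[]; lra.
Qed.

Lemma minUD f r : minU (fun u => f u + r) = minU f + r.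
Proof.
apply/le_anti/andP; split; first exact: minU_leD.
by rewrite -lerBrDr; apply: minU_leD => u; rewrite addrK.
Qed.

End minU.

Section selection.
Context (R : realType) d (X : measurableType d) (U : finPointedType).

(** A measurable minimizer: scan the finite action set, keeping the current
    best candidate. *)
Fixpoint best_action (g : X -> U -> R) (s : seq U) (x : X) : discr U :=
  if s is u :: s' then
    if g x u <= g x (best_action g s' x) then u else best_action g s' x
  else point.

Lemma best_action_le g s x u : u \in s -> g x (best_action g s x) <= g x u.
Proof.
elim: s => // v s IH; rewrite inE => /predU1P[->|us] /=.
  by case: ifPn => //; rewrite -ltNge => /ltW.
by case: ifPn => [gv|_]; [exact: le_trans gv (IH us)|exact: IH].
Qed.

Lemma measurable_best_action (g : X -> U -> R) s :
  measurable_fun [set: X * discr U] (fun z => g z.1 z.2) ->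
  measurable_fun [set: X] (best_action g s).
Proof.
move=> mg; elim: s => [|u s IH] /=; first exact: measurable_cst.
have mg1 (f : X -> discr U) : measurable_fun [set: X] f ->
    measurable_fun [set: X] (fun x => g x (f x)).
  move=> mf; apply: (measurableT_comp (f := fun z : X * discr U => g z.1 z.2)
    (g := fun x => (x, f x))) => //.
  exact: measurable_fun_pair.
apply: measurable_fun_ifT => //.
by apply: measurable_fun_ler; [exact: (mg1 (fun=> u))|exact: mg1].
Qed.

Lemma measurable_minU (g : X -> U -> R) :
  measurable_fun [set: X * discr U] (fun z => g z.1 z.2) ->
  measurable_fun [set: X] (fun x => minU (g x)).
Proof.
move=> mg; rewrite (_ : (fun x => _) = fun x => g x (best_action g (enum U) x)).
  apply: (measurableT_comp (f := fun z : X * discr U => g z.1 z.2)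
    (g := fun x => (x, best_action g (enum U) x))) => //.
  apply: measurable_fun_pair => //; exact: measurable_best_action.
apply/funext => x; apply/le_anti/andP; split; first exact: minU_le.
by apply: minU_ge => u; apply: best_action_le; rewrite mem_enum.
Qed.

Lemma bmeas_minU (g : X -> U -> R) :
  bmeas (fun z : X * discr U => g z.1 z.2) -> bmeas (fun x => minU (g x)).
Proof.
move=> [mg [K gK]]; split; first exact: measurable_minU.
by exists K => x; have [u ->] := minU_attained (g x); exact: (gK (x, u)).
Qed.

End selection.

(** The approximate values form a Cauchy family as the error decreases, and all
    the values of [g] are their limit. *)
Lemma near_constant (R : realType) (X : pointedType) (g : X -> \bar R) :
  (forall e, 0 < e -> exists r : R, forall x, ((r - e)%:E <= g x <= (r + e)%:E)%E) ->
  exists rho : R, forall x, g x = rho%:E.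
Proof.
move=> H; have [r rg] := H 1 ltr01.
have fin x : exists v, g x = v%:E.
  have := rg x.
  case: (g x) => [v _|/andP[]|/andP[]]; by [exists v|].
have [rho grho] := fin point; exists rho => x; have [v gv] := fin x.
rewrite gv; congr EFin.
apply/eqP; rewrite -subr_eq0 -normr_le0; apply/ler_addgt0Pr => e e0.
have e2 : 0 < e / 2 by rewrite divr_gt0.
have [r' r'g] := H _ e2.
have := r'g x; have := r'g point.
rewrite grho gv !lee_fin => /andP[? ?] /andP[? ?].
rewrite ler_distl; lra.
Qed.

Section approximate_optimality.
Context (R : realType) d (X : measurableType d) (U : finPointedType).
Variable M : mdp R X U.

(** The average cost optimality equation, up to an error [e]: [r] is the gain
    and [h] the relative value function. *)
Definition near_acoe (e r : R) (h : X -> R) : Prop :=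
  bmeas h /\ forall x, `|minU (Qval M h x) - (r + h x)| <= e.

Lemma near_acoe_average_cost_ge e r h pi x : near_acoe e r h ->
  ((r - e)%:E <= average_cost M pi x)%E.
Proof.
move=> [bh hr]; apply: (average_cost_ge bh); apply: horizon_cost_ge => // y u.
apply: le_trans (minU_le _ u).
by have := hr y; rewrite ler_distl => /andP[]; lra.
Qed.

(** The lower bound holds for every policy, the upper bound for a greedy one. *)
Lemma near_acoe_optimal_cost e r h x : near_acoe e r h ->
  ((r - e)%:E <= optimal_cost M x <= (r + e)%:E)%E.
Proof.
move=> eh; have [bh hr] := eh; apply/andP; split.
  by apply: le_ereal_inf_tmp => _ [pi _ <-]; exact: near_acoe_average_cost_ge eh.
have mQ : measurable_fun [set: X * discr U] (fun z => Qval M h z.1 z.2).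
  by have [] := bmeas_Qval M bh.
pose f : {mfun X >-> discr U} := HB.pack (best_action (Qval M h) (enum U))
  (isMeasurableFun.Build _ _ _ _ _ (measurable_best_action (enum U) mQ)).
apply: (@le_trans _ _ (average_cost M (stationary f) x)).
  by apply: ereal_inf_lbound; exists (stationary f).
apply: (average_cost_le bh); apply: horizon_cost_stationary_le => // y.
apply: (@le_trans _ _ (minU (Qval M h y))).
  by apply: minU_ge => u; apply: best_action_le; rewrite mem_enum.
by have := hr y; rewrite ler_distl => /andP[]; lra.
Qed.

Lemma near_acoe_has_optimal_cost :
  (forall e, 0 < e -> exists r h, near_acoe e r h) ->
  exists rho, has_optimal_cost M rho.
Proof.
move=> H; apply: near_constant => e /H[r [h rh]]; exists r => x.
exact: near_acoe_optimal_cost rh.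
Qed.

Lemma near_acoe_rho e r h rho : near_acoe e r h -> has_optimal_cost M rho ->
  `|rho - r| <= e.
Proof.
move=> rh orho; have := near_acoe_optimal_cost point rh.
by rewrite orho !lee_fin => /andP[? ?]; rewrite ler_distl; lra.
Qed.

End approximate_optimality.

(** * Concave powers, Lipschitz functions and Wasserstein distance *)

Section power_functions.
Context (R : realType).
Implicit Types (r s t delta : R).

(** Young's inequality with exponents [1 / delta] and [1 / (1 - delta)], rescaled
    by [s]. *)
Lemma powR_tangent r s delta : 0 <= r -> 0 < s -> 0 < delta -> delta <= 1 ->
  r `^ delta <= s `^ delta + delta * s `^ (delta - 1) * (r - s).
Proof.
move=> r0 s0 d0; rewrite le_eqVlt => /predU1P[->|d1].
  by rewrite subrr powRr0 !powRr1//; lra.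
have s' : s `^ delta = s * s `^ (delta - 1).
  by rewrite mulrC -{3}(powRr1 (ltW s0)) -powRD ?subrK// gt_eqF// implybT.
have ->: r = s * (r / s) by rewrite mulrC divfK// gt_eqF.
have t0 : 0 <= r / s by rewrite divr_ge0// ltW.
rewrite powRM// ?(ltW s0)//; set t := r / s in t0 *.
have : t `^ delta <= delta * t + (1 - delta).
  have := @conjugate_powR _ (t `^ delta) 1 delta^-1 (1 - delta)^-1.
  rewrite mulr1 powR1 -powRrM mulfV ?gt_eqF// powRr1// !invrK mul1r mulrC.
  apply; rewrite ?powR_ge0// ?invr_gt0//; lra.
rewrite -(ler_pM2l (powR_gt0 delta s0)) => /le_trans; apply.
rewrite s'; set p := s `^ (delta - 1); have : 0 <= s * p.
  by rewrite mulr_ge0 ?powR_ge0// ltW.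
nra.
Qed.

(** Tangents are available at positive points only; this recovers the estimate at
    the endpoint [0] by continuity. *)
Lemma ler_powR_lim a c r delta : 0 < delta -> 0 <= r ->
  (forall s, 0 < s -> r <= s -> a <= c * s `^ delta) -> a <= c * r `^ delta.
Proof.
move=> d0; rewrite le_eqVlt => /predU1P[<-|r0] H; last exact: H.
rewrite powR0 ?gt_eqF// mulr0; apply/ler_addgt0Pr => e e0; rewrite add0r.
have c1 : 0 < `|c| + 1 by rewrite ltr_wpDl.
pose s := (e / (`|c| + 1)) `^ delta^-1.
have s0 : 0 < s by apply: powR_gt0; exact: divr_gt0.
apply: le_trans (H s s0 (ltW s0)) _.
rewrite -powRrM mulVf ?gt_eqF// powRr1 ?divr_ge0 ?(ltW e0) ?(ltW c1)//.
rewrite mulrA ler_pdivrMr// mulrC ler_wpM2l ?(ltW e0)//.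
by rewrite (le_trans (ler_norm c))// lerDl.
Qed.

End power_functions.

Section near_fixpoint.
Context (R : realType) (X : Type).
Implicit Types h f g : X -> R.

(** An approximate contraction principle: consecutive iterates from [0] get
    geometrically close, and they stay in any class [P] stable under the map, so
    the almost fixed point is as regular as the iterates. *)
Lemma near_fixpoint (P : (X -> R) -> Prop) (S : (X -> R) -> X -> R) (k e : R) :
  0 <= k -> k < 1 -> 0 < e ->
  P (fun=> 0) -> (forall h, P h -> P (S h)) ->
  (forall h, P h -> exists K, forall x, `|h x| <= K) ->
  (forall f g r, P f -> P g -> (forall x, `|f x - g x| <= r) ->
     forall x, `|S f x - S g x| <= k * r) ->
  exists2 h, P h & forall x, `|S h x - h x| <= e.
Proof.
move=> k0 k1 e0 P0 PS Pbnd contr.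
pose v n := iter n S (fun=> 0).
have Pv n : P (v n) by elim: n => //= n; exact: PS.
have [K vK] := Pbnd _ (Pv 1%N).
have step n x : `|v n.+1 x - v n x| <= k ^+ n * K.
  elim: n x => [|n IH] x; first by rewrite expr0 mul1r subr0.
  by rewrite exprS -mulrA; exact: (contr (v n.+1) (v n) _ (Pv _) (Pv _) IH).
have : (fun n => k ^+ n * K) @ \oo --> (0 * K : R).
  by apply: cvgM; [apply: cvg_expr; rewrite ger0_norm|exact: cvg_cst].
rewrite mul0r => /cvgrPdist_le /(_ e e0)[n _ /(_ n (leqnn _))] /=.
rewrite sub0r normrN => kn; exists (v n) => // x.
exact: le_trans (step n x) (le_trans (ler_norm _) kn).
Qed.

End near_fixpoint.

Section metric_facts.
Context (R : realType) (X : completeMetricType R).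

Lemma continuous_borel (f : X -> R) : continuous f ->
  measurable_fun [set: borel X] (f : borel X -> R).
Proof.
move=> /continuousP cf; apply: (measurability _ (RGenOpens.measurableE R)).
move=> _ [_ [a [b ->] <-]]; rewrite setTI; apply: sub_sigma_algebra.
by apply: cf; exact: interval_open.
Qed.

Lemma lipschitz_continuous L (f : X -> R) :
  (forall x y, `|f x - f y| <= L * mdist x y) -> continuous f.
Proof.
move=> fL x; apply/cvgrPdist_lt => e e0.
have L0 : 0 < `|L| + 1 by rewrite ltr_wpDl.
apply: filterS (nbhsx_ballx x _ (divr_gt0 e0 L0)) => y.
rewrite ballEmdist/= ltr_pdivlMr// => xy; apply: le_lt_trans (fL x y) _.
apply: le_lt_trans xy; rewrite mulrC ler_wpM2l ?mdist_ge0//.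
by rewrite (le_trans (ler_norm L))// lerDl.
Qed.

Lemma mdist_lipschitz (z x y : X) : `|mdist x z - mdist y z| <= 1 * mdist x y.
Proof.
rewrite mul1r ler_distl.
have := metric_triangle x y z; have := metric_triangle y x z.
by rewrite (metric_sym y x); lra.
Qed.

Lemma compact_mdist_bounded : compact [set: X] ->
  exists D, forall x y : X, mdist x y <= D.
Proof.
move=> cX.
have : \forall K \near +oo, [set: X] `<=` (fun y => mdist (point : X) y <= K).
  apply: (proj1 (compact_near_coveringP _) cX _ _
    (fun K y => mdist (point : X) y <= K)) => x _.
  exists (ball x 1, [set K | mdist (point : X) x + 1 <= K]) => /=.
    by split; [exact: nbhsx_ballx|exact: nbhs_pinfty_ge (num_real _)].
  move=> [y K] [/= + HK]; rewrite ballEmdist/= => xy.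
  apply: le_trans (metric_triangle _ x _) _; apply: le_trans HK.
  by rewrite lerD2l ltW.
move=> /filter_ex[K HK]; exists (K + K) => x y.
apply: le_trans (metric_triangle _ point _) _.
by rewrite lerD// ?[mdist x _]metric_sym; exact: HK.
Qed.

(** Uniform continuity of a bounded function, with the small and the large
    distances merged into a modulus that is affine, hence can be averaged. *)
Lemma compact_affine_modulus (g : X -> R) (B e : R) : compact [set: X] ->
  continuous g -> (forall x, `|g x| <= B) -> 0 < e ->
  exists2 C, 0 <= C & forall x y, `|g x - g y| <= e + C * mdist x y.
Proof.
move=> cX cg gB e0.
have B0 : 0 <= B := le_trans (normr_ge0 _) (gB point).
have : \forall C \near +oo, [set: X] `<=`
    (fun x => 0 <= C /\ forall y, `|g x - g y| <= e + C * mdist x y).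
  apply: (proj1 (compact_near_coveringP _) cX _ _ (fun C x => 0 <= C /\ _)).
  move=> x _.
  have e2 : 0 < e / 2 by rewrite divr_gt0.
  have : \forall y \near x, `|g x - g y| < e / 2.
    by have /cvgrPdist_lt/(_ _ e2) := cg x.
  move=> /nbhs_ballP[r /= r0 xr].
  have r2 : 0 < r / 2 by rewrite divr_gt0.
  exists (ball x (r / 2), [set C | 2 * B / (r / 2) <= C]) => /=.
    by split; [exact: nbhsx_ballx|exact: nbhs_pinfty_ge (num_real _)].
  move=> [y C] [/= xy HC].
  have C0 : 0 <= C by rewrite (le_trans _ HC)// divr_ge0 ?mulr_ge0// ltW.
  split => // z; have [yz|yz] := ltP (mdist y z) (r / 2).
    have gy : `|g x - g y| < e / 2.
      by apply: xr; apply: le_ball xy; rewrite ler_pdivrMr// ler_pMr//; lra.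
    have gz : `|g x - g z| < e / 2.
      apply: xr; move: xy; rewrite !ballEmdist/= => xy.
      by apply: le_lt_trans (metric_triangle _ y _) _; rewrite (splitr r) ltrD.
    have := mulr_ge0 C0 (mdist_ge0 y z).
    move: gy gz; rewrite !ltr_distl ler_distl => /andP[? ?] /andP[? ?] ?; lra.
  have : 2 * B <= C * mdist y z.
    rewrite ler_pdivrMr// in HC; apply: le_trans HC _.
    by rewrite ler_wpM2l.
  have := gB y; have := gB z; rewrite !ler_norml => /andP[? ?] /andP[? ?] ?.
  lra.
move=> /filter_ex[C HC]; exists C; first by have [] := HC point I.
by move=> x; have [] := HC x I.
Qed.

Section inf_convolution.
Variables (f : X -> R) (K L : R).
Hypotheses (fK : forall x, `|f x| <= K) (L0 : 0 <= L).

(** The largest minorant of [f] with Lipschitz constant [L]. *)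
Definition inf_conv (x : X) : R := inf (range (fun z => f z + L * mdist x z)).

Let lb x z : - K <= f z + L * mdist x z.
Proof.
have := fK z; rewrite ler_norml => /andP[? _].
by have := mulr_ge0 L0 (mdist_ge0 x z); lra.
Qed.

Lemma inf_conv_le x z : inf_conv x <= f z + L * mdist x z.
Proof. by by apply: ge_inf; [exists (- K) => _ [y _ <-]; exact: lb|exists z]. Qed.

Lemma inf_conv_ge x r : (forall z, r <= f z + L * mdist x z) -> r <= inf_conv x.
Proof.
move=> rf; apply: lb_le_inf; first by exists (f x + L * mdist x x), x.
by move=> _ [z _ <-]; exact: rf.
Qed.

Lemma inf_conv_lipschitz x y :
  `|inf_conv x - inf_conv y| <= L * mdist x y.
Proof.
suff H a b : inf_conv a - L * mdist a b <= inf_conv b.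
  by rewrite ler_distl [in X in X <= _]metric_sym H/= -lerBlDr H.
apply: inf_conv_ge => z; rewrite lerBlDr; apply: le_trans (inf_conv_le a z) _.
rewrite -addrA lerD2l -mulrDr ler_wpM2l// addrC; exact: metric_triangle.
Qed.

Lemma inf_conv_bound x : `|inf_conv x| <= K.
Proof.
rewrite ler_norml inf_conv_ge//=.
apply: le_trans (inf_conv_le x x) _.
by rewrite mdistxx mulr0 addr0; have := fK x; rewrite ler_norml => /andP[].
Qed.

Lemma bmeas_inf_conv : bmeas (inf_conv : borel X -> R).
Proof.
split; last by exists K; exact: inf_conv_bound.
by apply: continuous_borel; apply: lipschitz_continuous; exact: inf_conv_lipschitz.
Qed.

End inf_convolution.

Definition holder (delta H : R) (f : X -> R) : Prop :=
  forall x y, `|f x - f y| <= H * mdist x y `^ delta.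

End metric_facts.

Section wasserstein.
Context (R : realType) (X : completeMetricType R).

Let ge0_le_integral_any d (T : measurableType d)
    (m : {measure set T -> \bar R}) (f g : T -> \bar R) :
  (forall x, 0 <= f x)%E -> (forall x, f x <= g x)%E ->
  (\int[m]_x f x <= \int[m]_x g x)%E.
Proof.
move=> f0 fg; rewrite !ge0_integralTE// => [|x]; last exact: le_trans (f0 x) _.
apply: ereal_sup_le => _ [h hf <-]; exists h => //= x.
exact: le_trans (hf x) (fg x).
Qed.

Let mean_coupling_fst (m m' : {measure set (borel X) -> \bar R}) g
    (f : borel X -> R) : coupling m m' g -> bmeas f ->
  (\int[m]_x f x = \int[g]_z f z.1)%R.
Proof.
move=> cg bf; apply: (mean_image measurable_fst) => // A mA.
have [<- _] := cg A mA; congr (g _).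
by apply/seteqP; split => -[x y] // [].
Qed.

Let mean_coupling_snd (m m' : {measure set (borel X) -> \bar R}) g
    (f : borel X -> R) : coupling m m' g -> bmeas f ->
  (\int[m']_x f x = \int[g]_z f z.2)%R.
Proof.
move=> cg bf; apply: (mean_image measurable_snd) => // A mA.
have [_ <-] := cg A mA; congr (g _).
by apply/seteqP; split => -[x y] // [].
Qed.

(** The easy half of Kantorovich duality. *)
Lemma wasserstein1_lipschitz (m m' : {measure set (borel X) -> \bar R})
    (f : borel X -> R) L w :
  m [set: _] = 1%E -> m' [set: _] = 1%E ->
  bmeas f -> 0 <= L -> (forall x y, `|f x - f y| <= L * mdist x y) ->
  (wasserstein1 m m' <= w%:E)%E ->
  (\int[m]_x f x - \int[m']_x f x <= L * w)%R.
Proof.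
move=> m1 m'1 bf; rewrite le_eqVlt => /predU1P[<-|L0] fL ww.
  have fc x : f x = f point.
    apply/eqP; rewrite -subr_eq0 -normr_le0.
    by have := fL x point; rewrite mul0r.
  under eq_Rintegral do rewrite fc.
  under [X in _ - X]eq_Rintegral do rewrite fc.
  by rewrite (mean_cst measurableT m1) (mean_cst measurableT m'1) subrr mul0r.
rewrite -ler_pdivrMl//; apply/ler_addgt0Pr => e e0.
have : (wasserstein1 m m' < (w + e)%:E)%E.
  by apply: le_lt_trans ww _; rewrite lte_fin ltrDl.
move=> /ereal_inf_lt[_ [g cg <-] gw]; rewrite -lee_fin; apply: le_trans (ltW gw).
have b1 : bmeas (fun z : borel X * borel X => f z.1).
  exact: (bmeas_comp measurable_fst bf).
have b2 : bmeas (fun z : borel X * borel X => f z.2).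
  exact: (bmeas_comp measurable_snd bf).
have g1 := probability_setT g.
rewrite (mean_coupling_fst cg bf) (mean_coupling_snd cg bf).
rewrite -(meanB measurableT g1 b1 b2) -(meanZ measurableT g1 _ (bmeasB b1 b2)).
apply: (@le_trans _ _ (\int[g]_z `|L^-1 * (f z.1 - f z.2)|)%:E%R).
  rewrite lee_fin; apply: (mean_le measurableT g1).
  - exact: bmeasZ (bmeasB b1 b2).
  - exact: bmeas_norm (bmeasZ _ (bmeasB b1 b2)).
  - by move=> z _; exact: ler_norm.
rewrite (EFin_mean measurableT g1); last first.
  exact: bmeas_norm (bmeasZ _ (bmeasB b1 b2)).
apply: ge0_le_integral_any => z; rewrite lee_fin//.
by rewrite normrM gtr0_norm ?invr_gt0// ler_pdivrMl.
Qed.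

End wasserstein.

(** * Minorized and continuous transition kernels *)

Section minorization.
Context (R : realType) (X : completeMetricType R) (U : finPointedType).
Variable M : @mdp R _ (borel X) U.
Variable nu : {measure set (borel X) -> \bar R}.
Hypothesis nuM : minorization M nu.

Local Notation kappa := (1 - fine (nu [set: X])).
Local Notation mean x u f := (\int[trans M (x, u)]_y f y)%R.
Local Notation numean f := (\int[nu]_y f y)%R.

Let trans1 x u : trans M (x, u) [set: _] = 1%E.
Proof. exact: prob_kernel. Qed.

Let nu_le1 : (nu [set: X] <= 1)%E.
Proof.
by rewrite -(trans1 point point); have [_] := nuM; apply; exact: measurableT.
Qed.

Let nu_lty : (nu [set: X] < +oo)%E.
Proof. exact: le_lt_trans nu_le1 (ltry 1). Qed.

Lemma minorization_lt1 : kappa < 1.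
Proof.
have [nu0 _] := nuM; rewrite ltrBlDr ltrDl fine_gt0// nu0 /=.
exact: nu_lty.
Qed.

(** Subtracting the common part of the transition laws leaves a positive
    functional of total mass [kappa]. *)
Lemma minorized_mean_le f g r x u : bmeas f -> bmeas g ->
  (forall y, f y <= g y + r) ->
  mean x u f - numean f <= mean x u g - numean g + kappa * r.
Proof.
move=> bf bg fg.
have bgr : bmeas (fun y => g y + r) by apply: bmeasD => //; exact: bmeas_cst.
have H : numean (fun y => g y + r - f y) <= mean x u (fun y => g y + r - f y).
  apply: mean_le_measure.
  - by move=> A mA; have [_] := nuM; apply.
  - by have -> := trans1 x u; rewrite ltry.
  - exact: bmeasB.
  - by move=> y; rewrite subr_ge0.
move: H; rewrite (meanB measurableT (trans1 x u) bgr bf).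
rewrite (meanDcst measurableT (trans1 x u) r bg).
rewrite RintegralB//; [|exact: bmeas_integrable|exact: bmeas_integrable].
rewrite RintegralD//; [|exact: bmeas_integrable|]; last first.
  by apply: bmeas_integrable => //; exact: bmeas_cst.
rewrite Rintegral_cst//; lra.
Qed.

Lemma minorized_mean_dist f g r x u : bmeas f -> bmeas g ->
  (forall y, `|f y - g y| <= r) ->
  `|(mean x u f - numean f) - (mean x u g - numean g)| <= kappa * r.
Proof.
move=> bf bg fg; rewrite ler_distl lerBlDr.
by apply/andP; split; apply: minorized_mean_le => // y; have := fg y;
  rewrite ler_distl => /andP[]; lra.
Qed.

Lemma minorized_mean_bounds f a b x u : bmeas f ->
  (forall y, a <= f y <= b) ->
  kappa * a <= mean x u f - numean f <= kappa * b.
Proof.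
move=> bf fab; have b0 := @bmeas_cst _ (borel X) R 0.
have mean0 : mean x u (fun=> 0) - numean (fun=> 0) = 0.
  by rewrite (mean_cst measurableT (trans1 x u)) Rintegral_cst// mul0r subrr.
apply/andP; split.
  have : mean x u (fun=> 0) - numean (fun=> 0) <=
      mean x u f - numean f + kappa * - a.
    by apply: minorized_mean_le => // y; have /andP[] := fab y; lra.
  by rewrite mean0; lra.
have : mean x u f - numean f <=
    mean x u (fun=> 0) - numean (fun=> 0) + kappa * b.
  by apply: minorized_mean_le => // y; have /andP[] := fab y; lra.
by rewrite mean0; lra.
Qed.

(** Value iteration for the minorized kernel keeps every class of functions that
    it stabilizes; its almost fixed points solve the optimality equation with
    gain [numean h]. *)
Lemma minorization_near_acoe (P : (X -> R) -> Prop) e : 0 <= kappa -> 0 < e ->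
  (forall h, P h -> bmeas (h : borel X -> R)) -> P (fun=> 0) ->
  (forall h, P h -> P (fun x => minU (fun u => Qval M h x u - numean h))) ->
  exists2 h, P h & near_acoe M e (numean h) h.
Proof.
move=> k0 e0 Pb P0 PS.
have [|f g r Pf Pg fg x|h Ph hS] := near_fixpoint k0 minorization_lt1 e0 P0 PS.
- by move=> h /Pb[].
- apply: minU_dist => u.
  have := minorized_mean_dist x u (Pb _ Pf) (Pb _ Pg) fg.
  by rewrite /Qval !ler_distl => /andP[? ?]; lra.
exists h => //; split; first exact: Pb.
move=> x; have := hS x; rewrite minUD.
by rewrite (addrC (numean h)) opprD addrA addrAC.
Qed.

Lemma minorization_has_average_cost (f : {mfun borel X >-> discr U}) :
  0 <= kappa -> exists rhopi, has_average_cost M (stationary f) rhopi.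
Proof.
move=> k0; apply: near_constant => e e0.
pose S (h : X -> R) x := Qval M h x (f x) - numean h.
have bS (h : borel X -> R) : bmeas h -> bmeas (S h : borel X -> R).
  move=> bh; apply: bmeasD; last exact: bmeas_cst.
  apply: (bmeas_comp (g := fun x => (x, f x)) _ (bmeas_Qval M bh)).
  exact: measurable_fun_pair.
have P0 := @bmeas_cst _ (borel X) R 0.
have [||h bh hS] := @near_fixpoint R X (fun h => bmeas (h : borel X -> R)) S
  kappa e k0 minorization_lt1 e0 P0 bS.
- by move=> h [].
- move=> g h r bg bh gh x.
  have := minorized_mean_dist x (f x) bg bh gh.
  by rewrite /S /Qval !ler_distl => /andP[? ?]; lra.
exists (numean h) => x; apply/andP; split.
  apply: (average_cost_ge bh); apply: horizon_cost_stationary_ge => // y.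
  by have := hS y; rewrite /S ler_distl => /andP[]; lra.
apply: (average_cost_le bh); apply: horizon_cost_stationary_le => // y.
by have := hS y; rewrite /S ler_distl => /andP[]; lra.
Qed.

Section holder.
Variables (KT : R).
Hypothesis KT0 : 0 <= KT.
Hypothesis TL : forall x x' u,
  (wasserstein1 (trans M (x, u)) (trans M (x', u)) <= (KT * mdist x x')%:E)%E.
Hypothesis k0 : 0 < kappa.

(** Interpolation: a Hölder function is the sum of its inf-convolution, which is
    Lipschitz and sees the Wasserstein distance, and a small remainder, which
    sees only the mass [kappa]; the tangent at [s] balances the two parts. *)
Let mean_holder_le delta H f s x x' u : 0 < delta -> delta <= 1 -> 0 <= H ->
  bmeas (f : borel X -> R) -> holder delta H f -> 0 < s ->
  KT * mdist x x' <= kappa * s ->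
  mean x u f - mean x' u f <= kappa * H * s `^ delta.
Proof.
move=> d0 d1 H0 bf fH s0 ds.
pose L := H * (delta * s `^ (delta - 1)).
have L0 : 0 <= L by rewrite !mulr_ge0 ?powR_ge0// ltW.
have [_ [K fK]] := bf.
pose f1 : borel X -> R := inf_conv f L.
have b1 : bmeas f1 := bmeas_inf_conv fK L0.
pose b := H * s `^ delta - L * s.
have f1_ge y : f y - b <= f1 y.
  apply: inf_conv_ge => z.
  have := fH y z; rewrite ler_distl => /andP[_ fyz].
  have := powR_tangent (mdist_ge0 y z) s0 d0 d1.
  by move=> /(ler_wpM2l H0); rewrite /b /L; lra.
have f1_le y : f1 y <= f y.
  by have := inf_conv_le fK L0 y y; rewrite mdistxx mulr0 addr0.
have bf1 : bmeas (fun y => f y - f1 y) by exact: bmeasB.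
have fb y : 0 <= f y - f1 y <= b by have := f1_ge y; have := f1_le y; lra.
have split_mean z : mean z u f = mean z u f1 + mean z u (fun y => f y - f1 y).
  by rewrite (meanB measurableT (trans1 z u) bf b1) addrC subrK.
have /andP[_ r1] := minorized_mean_bounds x u bf1 fb.
have /andP[r2 _] := minorized_mean_bounds x' u bf1 fb.
have := wasserstein1_lipschitz (trans1 x u) (trans1 x' u) b1 L0
  (inf_conv_lipschitz fK L0) (TL x x' u).
have := ler_wpM2l L0 ds.
rewrite !split_mean; move: r1 r2; rewrite /b; lra.
Qed.

Lemma mean_holder delta H f x x' u : 0 < delta -> delta <= 1 -> 0 <= H ->
  bmeas (f : borel X -> R) -> holder delta H f ->
  `|mean x u f - mean x' u f| <=
    H * (KT `^ delta * kappa `^ (1 - delta)) * mdist x x' `^ delta.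
Proof.
move=> d0 d1 H0 bf fH; have m0 := mdist_ge0 x x'.
have -> : H * (KT `^ delta * kappa `^ (1 - delta)) * mdist x x' `^ delta =
    kappa * H * (KT * mdist x x' / kappa) `^ delta.
  rewrite !powRM ?mulr_ge0 ?invr_ge0// ?(ltW k0)//.
  have -> : kappa `^ (1 - delta) = kappa * (kappa^-1) `^ delta.
    rewrite powRB ?(gt_eqF k0) ?implybT// powRr1 ?(ltW k0)//.
    by rewrite -(powR_inv1 (ltW k0)) -powRrM mulN1r powRN.
  by ring.
apply: ler_powR_lim => // [|s s0 rs].
  by rewrite divr_ge0 ?mulr_ge0// ltW.
move: rs; rewrite ler_pdivrMr// (mulrC s) => rs.
rewrite ler_distl lerBlDr -!lerBlDl; apply/andP; split.
  by apply: mean_holder_le => //; rewrite metric_sym.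
exact: mean_holder_le.
Qed.

End holder.

End minorization.

Section continuity.
Context (R : realType) (X : completeMetricType R) (U : finPointedType).
Variable M : @mdp R _ (borel X) U.

(** Weak continuity of the kernel is given along sequences. *)
Lemma sequentially_continuous (g : X -> R) :
  (forall (y : nat -> X) x, y @ \oo --> x -> g \o y @ \oo --> g x) ->
  continuous g.
Proof.
move=> gseq x; apply/cvgrPdist_lt => e e0; apply: contrapT => Hn.
have far n : exists y, mdist x y < n.+1%:R^-1 /\ e <= `|g x - g y|.
  apply: contrapT => Hy; apply: Hn.
  have n0 : 0 < n.+1%:R^-1 :> R by rewrite invr_gt0.
  apply: filterS (nbhsx_ballx x _ n0) => y; rewrite ballEmdist/= => xy.
  by rewrite ltNge; apply/negP => gxy; apply: Hy; exists y.
have /choice[y Hy] := far.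
have yx : y @ \oo --> x.
  apply/cvg_ballP => r r0; near=> n; rewrite ballEmdist/=.
  have [/lt_trans + _] := Hy n; apply.
  near: n; exact: (near_infty_natSinv_lt (PosNum r0)).
have /cvgrPdist_lt/(_ e e0) [n _ /(_ n (leqnn _))] := gseq _ _ yx.
by rewrite /= ltNge; have [_ ->] := Hy n.
Unshelve. all: by end_near. Qed.

Hypothesis wcM : weak_continuity_condition M.

Lemma continuous_Qval (h : X -> R) u : bmeas (h : borel X -> R) ->
  continuous h -> continuous (fun x => Qval M h x u).
Proof.
move=> bh ch; have [_ cc cT] := wcM.
apply: sequentially_continuous => y x yx.
apply: cvgD.
  exact: (cvg_comp _ _ yx (cc u x)).
have u_u : \forall n \near \oo, (fun _ : nat => u) n = u by apply: nearW.
have [_ hK] := bh.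
have := cT y (fun=> u) x u yx u_u h ch hK.
have mE z : (\int[trans M (z, u)]_y (h y)%:E)%E = (\int[trans M (z, u)]_y h y)%R%:E.
  by rewrite -(EFin_mean measurableT)//; exact: prob_kernel.
rewrite mE; under eq_fun do rewrite mE.
by move/fine_cvgP => -[_].
Qed.

Lemma continuous_minU (g : X -> U -> R) : (forall u, continuous (g ^~ u)) ->
  continuous (fun x => minU (g x)).
Proof.
move=> cg x; apply/cvgrPdist_le => e e0.
have : \forall y \near x, forall u, `|g x u - g y u| <= e.
  apply: filter_forall => u.
  by have /cvgrPdist_le/(_ e e0) := cg u x.
by apply: filterS => y gy; exact: minU_dist.
Qed.

End continuity.

(** * Averages over bins and the finite model *)

Section averages.
Context (R : realType) (X : completeMetricType R) (N : nat).
Variable q : quantization X N.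

Definition bin_mean (i : 'I_N.+1) (f : X -> R) : R :=
  (\int[bin_weight q i]_(x in bin q i) f x)%R.

Let mbin i : measurable (bin q i : set (borel X)).
Proof. exact: measurable_bin. Qed.

Lemma bin_indexP x : bin q (bin_index q x) x.
Proof. by rewrite /bin_index; case: cid. Qed.

Lemma bin_index_eq i x : bin q i x -> bin_index q x = i.
Proof.
move=> ix; apply/eqP; apply: contrapT => /negP ne.
have /trivIsetP/(_ (bin_index q x) i I I ne) := @bin_disjoint _ _ _ q.
by move/seteqP => -[/(_ x)] + _; apply; split => //; exact: bin_indexP.
Qed.

Lemma indic_bin j x : \1_(bin q j) x = (bin_index q x == j)%:R :> R.
Proof.
rewrite indicE; congr (nat_of_bool _)%:R; apply/idP/eqP.
  by rewrite inE; exact: bin_index_eq.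
by move=> <-; rewrite inE; exact: bin_indexP.
Qed.

Lemma bin_functionE (V : 'I_N.+1 -> R) x :
  V (bin_index q x) = \sum_j V j * \1_(bin q j) x.
Proof.
rewrite (bigD1 (bin_index q x))//= indic_bin eqxx mulr1 big1 ?addr0// => j.
by rewrite indic_bin eq_sym => /negbTE ->; rewrite mulr0.
Qed.

Lemma bmeas_bin_function (V : 'I_N.+1 -> R) :
  bmeas (fun x : borel X => V (bin_index q x)).
Proof.
under eq_fun do rewrite bin_functionE.
apply: bmeas_sum => j; apply: bmeasZ; exact: bmeas_indic.
Qed.

Let mean1 i := bin_weight_bin q i.

Lemma bin_mean_le i f g r : bmeas (f : borel X -> R) -> bmeas (g : borel X -> R) ->
  (forall x, bin q i x -> f x <= g x + r) -> bin_mean i f <= bin_mean i g + r.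
Proof.
move=> bf bg fg.
rewrite /bin_mean -(meanDcst (mbin i) (mean1 i) r bg).
apply: (mean_le (mbin i) (mean1 i) bf) => //.
by apply: bmeasD => //; exact: bmeas_cst.
Qed.

End averages.

Section quantization_error.
Context (R : realType) (X : completeMetricType R) (N : nat).
Variables (q : quantization X N) (D : R).
Hypothesis XD : forall x y : X, mdist x y <= D.

Local Notation LX := (fine (max_quantization_error q)).

Let mbin i : measurable (bin q i : set (borel X)).
Proof. exact: measurable_bin. Qed.

Lemma bmeas_mdist (x : X) : bmeas (fun y : borel X => mdist x y).
Proof.
split; last by exists D => y; rewrite ger0_norm ?mdist_ge0.
apply: continuous_borel; apply: (@lipschitz_continuous _ _ 1) => y z.
by rewrite (metric_sym x y) (metric_sym x z); exact: mdist_lipschitz.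
Qed.

Let qe x : quantization_error q x =
  (bin_mean q (bin_index q x) (fun y => mdist x y))%:E.
Proof.
by rewrite /quantization_error EFin_mean//; [exact: bin_weight_bin|exact: bmeas_mdist].
Qed.

Let LXE : max_quantization_error q = LX%:E.
Proof.
rewrite fineK// ge0_fin_numE.
  apply: (@le_lt_trans _ _ D%:E); last exact: ltry.
  apply: ge_ereal_sup => _ [x _ <-]; rewrite qe lee_fin.
  by apply: mean_le_cst => //; [exact: bin_weight_bin|exact: bmeas_mdist].
apply: (@le_trans _ _ (quantization_error q point)).
  by apply: integral_ge0 => y _; rewrite lee_fin mdist_ge0.
by apply: ereal_sup_ubound; exists point.
Qed.

Lemma bin_mean_mdist x : bin_mean q (bin_index q x) (fun y => mdist x y) <= LX.
Proof. by rewrite -lee_fin -LXE -qe; apply: ereal_sup_ubound; exists x. Qed.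

Lemma quantization_error_ge0 : 0 <= LX.
Proof.
apply: le_trans (bin_mean_mdist point).
by apply: Rintegral_ge0 => y _; exact: mdist_ge0.
Qed.

Lemma quantization_error_le : LX <= D.
Proof.
rewrite -lee_fin -LXE; apply: ge_ereal_sup => _ [x _ <-]; rewrite qe lee_fin.
by apply: mean_le_cst => //; [exact: bin_weight_bin|exact: bmeas_mdist].
Qed.

Lemma bin_mean_affine g a b x : bmeas (g : borel X -> R) -> 0 <= b ->
  (forall y, `|g x - g y| <= a + b * mdist x y) ->
  `|bin_mean q (bin_index q x) g - g x| <= a + b * LX.
Proof.
move=> bg b0 gx; have m1 := bin_weight_bin q (bin_index q x).
have bb : bmeas (fun y : borel X => b * mdist x y).
  exact/bmeasZ/bmeas_mdist.
have HL : bin_mean q (bin_index q x) (fun y => b * mdist x y) <= b * LX.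
  rewrite /bin_mean (meanZ (mbin _) m1 _ (bmeas_mdist x)).
  by rewrite ler_wpM2l//; exact: bin_mean_mdist.
have c0 : bin_mean q (bin_index q x) (fun=> g x) = g x.
  exact: (mean_cst (mbin _) m1).
have bc := @bmeas_cst _ (borel X) R (g x).
have bgc : bmeas (fun y : borel X => g x - g y) by exact: bmeasB.
have bcg : bmeas (fun y : borel X => g y - g x) by exact: bmeasB.
have e1 : bin_mean q (bin_index q x) (fun y => g y - g x) =
    bin_mean q (bin_index q x) g - g x.
  by rewrite /bin_mean (meanB (mbin _) m1 bg bc) (mean_cst (mbin _) m1).
have e2 : bin_mean q (bin_index q x) (fun y => g x - g y) =
    g x - bin_mean q (bin_index q x) g.
  by rewrite /bin_mean (meanB (mbin _) m1 bc bg) (mean_cst (mbin _) m1).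
have h1 : bin_mean q (bin_index q x) (fun y => g y - g x) <=
    bin_mean q (bin_index q x) (fun y => b * mdist x y) + a.
  by apply: bin_mean_le => // y _; have := gx y; rewrite ler_distl => /andP[]; lra.
have h2 : bin_mean q (bin_index q x) (fun y => g x - g y) <=
    bin_mean q (bin_index q x) (fun y => b * mdist x y) + a.
  by apply: bin_mean_le => // y _; have := gx y; rewrite ler_distl => /andP[]; lra.
by move: h1 h2; rewrite e1 e2 ler_distl => h1 h2; apply/andP; split; lra.
Qed.

(** Jensen's inequality for the concave power, by means of its tangents. *)
Lemma bin_mean_holder g delta H x : bmeas (g : borel X -> R) ->
  0 < delta -> delta <= 1 -> 0 <= H -> holder delta H g ->
  `|bin_mean q (bin_index q x) g - g x| <= H * LX `^ delta.
Proof.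
move=> bg d0 d1 H0 gH; apply: ler_powR_lim => //.
  exact: quantization_error_ge0.
move=> s s0 Ls; pose p := delta * s `^ (delta - 1).
have p0 : 0 <= p by rewrite mulr_ge0 ?powR_ge0// ltW.
have := @bin_mean_affine g (H * (s `^ delta - p * s)) (H * p) x bg
  (mulr_ge0 H0 p0).
move=> /(_ _)/le_trans; apply => [y|].
  apply: le_trans (gH x y) _; rewrite -mulrA -mulrDr ler_wpM2l//.
  have := powR_tangent (mdist_ge0 x y) s0 d0 d1; rewrite -/p; lra.
rewrite -mulrA -mulrDr ler_wpM2l//.
have := ler_wpM2l p0 Ls; lra.
Qed.

End quantization_error.

Section comparison.
Context (R : realType) (X : completeMetricType R) (N : nat) (U : finPointedType).
Variables (q : quantization X N) (M : @mdp R _ (borel X) U).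
Variables (rhohat : R) (Q : 'I_N.+1 -> U -> R).
Hypothesis Qopt : optimality_equation q M rhohat Q.

Let mbin i : measurable (bin q i : set (borel X)).
Proof. exact: measurable_bin. Qed.

Let trans1 x u : trans M (x, u) [set: _] = 1%E.
Proof. exact: prob_kernel. Qed.

Lemma finite_transE i u j : finite_trans q M i u j =
  bin_mean q i (fun x => \int[trans M (x, u)]_y \1_(bin q j) y)%R.
Proof.
rewrite /finite_trans /bin_mean /Rintegral; congr fine.
apply: eq_integral => x _.
rewrite integral_indic// setIT fineK// ge0_fin_numE//.
apply: (@le_lt_trans _ _ (trans M (x, u) [set: X])); last first.
  by have -> := trans1 x u; rewrite ltry.
by apply: le_measure; rewrite ?inE//; exact: measurableT.
Qed.

Lemma bmeas_trans (f : X -> R) u : bmeas (f : borel X -> R) ->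
  bmeas (fun x : borel X => \int[trans M (x, u)]_y f y)%R.
Proof.
move=> bf; apply: (bmeas_comp (g := fun x : borel X => (x, u : discr U)) _
  (bmeas_kernel_snd (trans M) bf)).
exact: measurable_fun_pair.
Qed.

Lemma sum_finite_transE (V : 'I_N.+1 -> R) i u :
  \sum_j finite_trans q M i u j * V j =
  bin_mean q i (fun x => \int[trans M (x, u)]_y V (bin_index q y))%R.
Proof.
have bj j : bmeas (\1_(bin q j) : borel X -> R) by exact: bmeas_indic.
under eq_bigr => j _.
  rewrite finite_transE mulrC /bin_mean.
  rewrite -(meanZ (mbin i) (bin_weight_bin q i) _ (bmeas_trans u (bj j))).
  over.
rewrite -(mean_sum (mbin i) (bin_weight_bin q i)); last first.
  by move=> j; apply: bmeasZ; exact: bmeas_trans.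
apply: eq_Rintegral => x _.
under [RHS]eq_Rintegral do rewrite bin_functionE.
rewrite (mean_sum measurableT (trans1 x u)); last first.
  by move=> j; exact: bmeasZ.
by apply: eq_bigr => j _; rewrite (meanZ measurableT (trans1 x u)).
Qed.

Definition bin_value (x : X) : R := minU (Q (bin_index q x)).

Lemma bmeas_bin_value : bmeas (bin_value : borel X -> R).
Proof. exact: (bmeas_bin_function q (fun i => minU (Q i))). Qed.

(** The Q-function of the finite model is that of the original model for the
    lifted value function, averaged over a bin. *)
Lemma optimality_bin_mean i u :
  rhohat + Q i u = bin_mean q i (fun x => Qval M bin_value x u).
Proof.
rewrite Qopt (sum_finite_transE (fun j => minU (Q j))) /finite_cost.
rewrite /bin_mean (meanD (mbin i) (bin_weight_bin q i))//.
  exact: bmeas_cost1.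
exact: (bmeas_trans u bmeas_bin_value).
Qed.

Lemma optimality_bin_value x :
  rhohat + bin_value x =
  minU (fun u => bin_mean q (bin_index q x) (fun y => Qval M bin_value y u)).
Proof.
rewrite addrC -minUD; congr minU; apply/funext => u.
by rewrite addrC optimality_bin_mean.
Qed.

Variables (e e' r : R) (h : X -> R).
Hypothesis rh : near_acoe M e r h.
Hypothesis Qvar : forall x u,
  `|bin_mean q (bin_index q x) (fun y => Qval M h y u) - Qval M h x u| <= e'.

Let bh : bmeas (h : borel X -> R). Proof. by case: rh. Qed.

Let w x := bin_value x - h x.

Let bw : bmeas (w : borel X -> R).
Proof. by apply: bmeasB => //; exact: bmeas_bin_value. Qed.

Let QvalE x u : Qval M bin_value x u =
  Qval M h x u + (\int[trans M (x, u)]_y w y)%R.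
Proof.
rewrite /Qval -addrA -(meanD measurableT (trans1 x u) bh bw); congr (_ + _).
by apply: eq_Rintegral => y _; rewrite /w addrC subrK.
Qed.

Let upper m x : (forall y u, \int[trans M (y, u)]_z w z <= m)%R ->
  w x <= r - rhohat + (e + e') + m.
Proof.
move=> wm; have [_ /(_ x) hx] := rh.
have : rhohat + bin_value x <= minU (Qval M h x) + (e' + m).
  rewrite optimality_bin_value; apply: minU_leD => u.
  apply: (@le_trans _ _ (bin_mean q (bin_index q x) (fun y => Qval M h y u) + m)).
    apply: bin_mean_le.
    - exact: (bmeas_Qval1 M u bmeas_bin_value).
    - exact: (bmeas_Qval1 M u bh).
    - by move=> y _; rewrite QvalE lerD2l.
  by have := Qvar x u; rewrite ler_distl => /andP[? ?]; lra.
by move: hx; rewrite ler_distl /w => /andP[? ?]; lra.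
Qed.

Let lower m x : (forall y u, m <= \int[trans M (y, u)]_z w z)%R ->
  r - rhohat - (e + e') + m <= w x.
Proof.
move=> wm; have [_ /(_ x) hx] := rh.
have : minU (Qval M h x) <= rhohat + bin_value x + (e' - m).
  rewrite optimality_bin_value; apply: minU_leD => u.
  have : bin_mean q (bin_index q x) (fun y => Qval M h y u) <=
         bin_mean q (bin_index q x) (fun y => Qval M bin_value y u) - m.
    apply: bin_mean_le.
    - exact: (bmeas_Qval1 M u bh).
    - exact: (bmeas_Qval1 M u bmeas_bin_value).
    - by move=> y _; rewrite QvalE; have := wm y u; lra.
  by have := Qvar x u; rewrite ler_distl => /andP[? ?]; lra.
by move: hx; rewrite ler_distl /w => /andP[? ?]; lra.
Qed.

Let wsup x : w x <= sup (range w).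
Proof.
have [_ [K wK]] := bw; apply: ub_le_sup; last by exists x.
by exists K => _ [y _ <-]; have := wK y; rewrite ler_norml => /andP[].
Qed.

Let winf x : inf (range w) <= w x.
Proof.
have [_ [K wK]] := bw; apply: ge_inf; last by exists x.
by exists (- K) => _ [y _ <-]; have := wK y; rewrite ler_norml => /andP[].
Qed.

Let w0 : range w !=set0. Proof. by exists (w point), point. Qed.

(** A bound on [w] propagates through both optimality equations with a loss of
    [e + e'] and a drift [r - rhohat]; at the extrema of [w] there is no room
    for a larger drift. *)
Lemma gain_comparison : `|r - rhohat| <= e + e'.
Proof.
have hs : sup (range w) <= r - rhohat + (e + e') + sup (range w).
  apply: ge_sup => // _ [x _ <-]; apply: upper => y u.
  exact: (mean_le_cst measurableT (trans1 y u) bw).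
have hi : r - rhohat - (e + e') + inf (range w) <= inf (range w).
  apply: lb_le_inf => // _ [x _ <-]; apply: lower => y u.
  exact: (mean_ge_cst measurableT (trans1 y u) bw).
by rewrite ler_norml; apply/andP; split; lra.
Qed.

Section learned_policy.
Variable nu : {measure set (borel X) -> \bar R}.
Hypothesis nuM : minorization M nu.
Local Notation kappa := (1 - fine (nu [set: X])).
Hypothesis k0 : 0 <= kappa.

(** The mean of [w] under [nu] is common to all states and actions, and what is
    left of the transition laws contracts the oscillation of [w] by [kappa]. *)
Lemma value_span : (1 - kappa) * (sup (range w) - inf (range w)) <= 2 * (e + e').
Proof.
have wb y : inf (range w) <= w y <= sup (range w) by rewrite winf wsup.
have kb y u := minorized_mean_bounds nuM y u bw wb.
have hs : sup (range w) <=
    r - rhohat + (e + e') + ((\int[nu]_y w y)%R + kappa * sup (range w)).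
  apply: ge_sup => // _ [x _ <-]; apply: upper => y u.
  by have := kb y u => /andP[_]; lra.
have hi : r - rhohat - (e + e') + ((\int[nu]_y w y)%R + kappa * inf (range w)) <=
    inf (range w).
  apply: lb_le_inf => // _ [x _ <-]; apply: lower => y u.
  by have := kb y u => /andP[+ _]; lra.
lra.
Qed.

(** A minimizer for the finite model is nearly a minimizer for the original one,
    because [bin_value - h] has a small oscillation. *)
Lemma learned_policy_Qval (f : X -> U) x :
  (forall u, Q (bin_index q x) (f x) <= Q (bin_index q x) u) ->
  Qval M h x (f x) <= r + 2 * (e + e') / (1 - kappa) + h x.
Proof.
move=> fx; have [u0 hu0] := minU_attained (Qval M h x).
have k1 : 0 < 1 - kappa by have := minorization_lt1 nuM; lra.
pose s := sup (range w) - inf (range w).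
have ss : s <= 2 * (e + e') / (1 - kappa).
  by rewrite ler_pdivlMr// mulrC; exact: value_span.
have wb y : inf (range w) <= w y <= sup (range w) by rewrite winf wsup.
have kb y u := minorized_mean_bounds nuM y u bw wb.
pose A g := bin_mean q (bin_index q x) g.
have QA u : A (fun y => Qval M bin_value y u) =
    A (fun y => Qval M h y u) + A (fun y => \int[trans M (y, u)]_z w z)%R.
  rewrite /A /bin_mean; under eq_Rintegral do rewrite QvalE.
  rewrite (meanD (mbin _) (bin_weight_bin q _))//.
    exact: (bmeas_Qval1 M u bh).
  exact: (bmeas_trans u bw).
have AQ : A (fun y => Qval M bin_value y (f x)) <= A (fun y => Qval M bin_value y u0).
  by rewrite /A -!optimality_bin_mean lerD2l.
have Aw : A (fun y => \int[trans M (y, u0)]_z w z)%R <=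
    A (fun y => \int[trans M (y, f x)]_z w z)%R + kappa * s.
  apply: bin_mean_le; [exact: (bmeas_trans _ bw)|exact: (bmeas_trans _ bw)|].
  move=> y _; have := kb y u0; have := kb y (f x).
  by rewrite /s => /andP[? ?] /andP[? ?]; lra.
have [_ /(_ x)] := rh; rewrite hu0 ler_distl => /andP[h1 h2].
have := Qvar x (f x); have := Qvar x u0; rewrite !ler_distl => /andP[? ?] /andP[? ?].
have e0 : 0 <= e by have [_ /(_ x)] := rh; exact: le_trans.
have ks : (1 - kappa) * s <= 2 * (e + e') := value_span.
have e'0 : 0 <= e' := le_trans (normr_ge0 _) (Qvar x u0).
rewrite !QA /A in AQ; rewrite /A in Aw.
have E : 2 * (e + e') / (1 - kappa) =
    2 * (e + e') + kappa * (2 * (e + e') / (1 - kappa)).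
  by field; rewrite gt_eqF.
have kY := ler_wpM2l k0 ss.
move: E kY Aw; set Y := _ / (1 - kappa); set kY := kappa * Y.
by set ks' := kappa * s; clearbody Y kY ks'; lra.
Qed.

End learned_policy.

End comparison.

(** * Independence, a law of large numbers and a recursion *)

Section independence.
Context d (Omega : measurableType d) (R : realType) (P : probability Omega R).
Variables (G H : set (set Omega)).
Hypotheses (mG : G `<=` measurable) (mH : H `<=` measurable).
Hypotheses (GT : G setT) (GI : setI_closed G).
Hypothesis GH : forall A B, G A -> <<s H >> B -> P (A `&` B) = (P A * P B)%E.

Let sH_measurable : <<s H >> `<=` (measurable : set (set Omega)).
Proof. by apply: smallest_sub => //; exact: sigma_algebra_measurable. Qed.

Let sG_measurable : <<s G >> `<=` (measurable : set (set Omega)).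
Proof. by apply: smallest_sub => //; exact: sigma_algebra_measurable. Qed.

Let Pfin A : measurable A -> P A \is a fin_num.
Proof. by move=> mA; exact: fin_num_measure. Qed.

Lemma independent_sigma A B : <<s G >> A -> <<s H >> B ->
  P (A `&` B) = (P A * P B)%E.
Proof.
move=> sA sB; have mB := sH_measurable sB.
have PB0 : (0 <= fine (P B)) by rewrite fine_ge0.
have E C : mscale (NngNum PB0) P C = (P C * P B)%E.
  by rewrite /mscale/= muleC fineK// Pfin.
rewrite -E -[LHS]/(mrestr P mB A).
apply: (g_sigma_algebra_measure_unique G mG (fun=> setT) (fun=> GT) _
  (mrestr P mB) (mscale (NngNum PB0) P)) => //.
- by apply/seteqP; split => // x _; exists 0%N.
- by move=> C GC; apply: (eq_trans (GH GC sB)); rewrite -E.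
- move=> k; rewrite -[X in (X < _)%E]/(P (setT `&` B)) setTI.
  by rewrite (le_lt_trans (probability_le1 _ _))// ltry.
Qed.

Local Notation OG := (g_sigma_algebraType G).
Local Notation OH := (g_sigma_algebraType H).

(** Independence of two sigma-algebras says that the diagonal map sends [P] to a
    product measure, so the product formula is Fubini's theorem. *)
Lemma mean_indep (Y : OG -> R) (Z : OH -> R) : bmeas Y -> bmeas Z ->
  (\int[P]_w (Y w * Z w) = (\int[P]_w Y w) * (\int[P]_w Z w))%R.
Proof.
move=> bY bZ.
have mi : measurable_fun [set: Omega] (id : Omega -> OG).
  by move=> _ A sA; rewrite setTI; exact: sG_measurable.
have mj : measurable_fun [set: Omega] (id : Omega -> OH).
  by move=> _ A sA; rewrite setTI; exact: sH_measurable.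
pose i : {mfun Omega >-> OG} := HB.pack (id : Omega -> OG)
  (isMeasurableFun.Build _ _ _ _ _ mi).
pose j : {mfun Omega >-> OH} := HB.pack (id : Omega -> OH)
  (isMeasurableFun.Build _ _ _ _ _ mj).
pose PG : probability OG R := distribution P i.
pose PH : probability OH R := distribution P j.
pose ij : {mfun Omega >-> (OG * OH)%type} := HB.pack (fun w : Omega => (w, w) : OG * OH)
  (isMeasurableFun.Build _ _ _ _ _ (measurable_fun_pair mi mj)).
pose f (z : OG * OH) := Y z.1 * Z z.2.
have bf : bmeas f.
  apply: bmeasM; first exact: (bmeas_comp measurable_fst).
  exact: (bmeas_comp measurable_snd).
have PE A : measurable A -> (PG \x PH)%E A = P (ij @^-1` A).
  move=> mA; rewrite -[RHS]/(distribution P ij A).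
  apply: product_measure_unique => // A1 A2 mA1 mA2.
  by rewrite -[LHS]/(P (A1 `&` A2)); exact: independent_sigma.
rewrite -[LHS]/(\int[P]_w f (ij w))%R -(mean_image _ PE bf)//.
have intf : (PG \x PH)%E.-integrable setT (EFin \o f).
  have PET : ((PG \x PH)%E setT <= 1)%E by rewrite PE// preimage_setT probability_setT.
  exact: (bmeas_integrable measurableT (le_lt_trans PET (ltry 1)) bf).
rewrite [LHS]/Rintegral -[X in fine X](integral12_prod_meas1 intf).
have EY : (\int[P]_w Y w = \int[PG]_w Y w)%R.
  exact/esym/(mean_image (P := P) (m := PG) mi _ bY).
have EZ : (\int[P]_w Z w = \int[PH]_w Z w)%R.
  exact/esym/(mean_image (P := P) (m := PH) mj _ bZ).
rewrite EY EZ mulrC -(meanZ measurableT (probability_setT PG) _ bY).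
rewrite [RHS]/Rintegral; congr fine; apply: eq_integral => w _.
rewrite -[LHS]/(\int[PH]_z (Y w * Z z)%:E)%E.
rewrite -(EFin_mean measurableT (probability_setT PH) (bmeasZ _ bZ)).
by rewrite (meanZ measurableT (probability_setT PH) _ bZ) mulrC.
Qed.

End independence.

Section deterministic.
Context (R : realType).

(** Bootstrapping: a bound [B] on a tail improves to [beta * B + eta] on a later
    tail, because the terms that precede the first tail have a vanishing weight
    in the average. *)
Lemma averaged_contraction (beta : R) (s eps : R^nat) :
  0 <= beta -> beta < 1 -> (forall t, 0 <= s t) -> eps @ \oo --> (0 : R) ->
  (forall T, s T.+1 * T.+1%:R <=
    beta * (\sum_(t < T.+1) s t) + eps T.+1 * T.+1%:R) ->
  s @ \oo --> (0 : R).
Proof.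
move=> b0 b1 s0 eps0 sT.
have small e : 0 < e -> exists T0, forall t, (T0 <= t)%N -> eps t <= e.
  move=> e0; have /cvgrPdist_le/(_ e e0)[T0 _ HT] := eps0.
  exists T0 => t /HT/=; rewrite sub0r normrN; exact: le_trans (ler_norm _).
have [B sB] : exists B, forall t, s t <= B.
  have [T0 HT0] := small 1 ltr01.
  pose B := \sum_(t < T0.+1) s t + (1 - beta)^-1.
  have q0 : 0 < (1 - beta)^-1 by rewrite invr_gt0; lra.
  exists B; elim/ltn_ind => t IH.
  have [tT|tT] := leqP t T0.
    have : s t <= \sum_(t < T0.+1) s t.
      by rewrite (bigD1 (Ordinal (tT : (t < T0.+1)%N)))//= lerDl sumr_ge0.
    by rewrite /B; lra.
  case: t tT IH => // t tT IH.
  have t0 : 0 < t.+1%:R :> R by rewrite ltr0n.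
  have : \sum_(k < t.+1) s k <= B * t.+1%:R.
    rewrite mulr_natr -[in leRHS](card_ord t.+1) -sumr_const.
    by apply: ler_sum => k _; exact: IH.
  have := sT t; have := HT0 t.+1 (ltnW tT).
  move=> e1 st sumB.
  have : s t.+1 * t.+1%:R <= (beta * B + 1) * t.+1%:R.
    have := ler_wpM2l b0 sumB; have := ler_wpM2r (ltW t0) e1; lra.
  rewrite ler_pM2r// => /le_trans; apply.
  have S0 : 0 <= \sum_(t < T0.+1) s t by rewrite sumr_ge0.
  have : (1 - beta) * (1 - beta)^-1 = 1 by rewrite divff// gt_eqF//; lra.
  have := mulr_ge0 (_ : 0 <= 1 - beta) S0; rewrite /B; lra.
have improve b e : 0 < e -> (exists T0, forall t, (T0 <= t)%N -> s t <= b) ->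
    exists T0, forall t, (T0 <= t)%N -> s t <= beta * b + e.
  move=> e0 [T0 HT0].
  have e2 : 0 < e / 2 by rewrite divr_gt0.
  have [T1 HT1] := small _ e2.
  pose C := \sum_(k < T0) (s k - b).
  exists (maxn (maxn T0 T1) (Num.truncn (2 * `|C| / e)).+1).+1 => -[//|t].
  rewrite ltnS !geq_max -andbA => /and3P[tT0 tT1 tC].
  have t0 : 0 < t.+1%:R :> R by rewrite ltr0n.
  have sumb : \sum_(k < t.+1) s k <= C + b * t.+1%:R.
    rewrite mulr_natr -[in leRHS](card_ord t.+1) -sumr_const -lerBlDr -sumrB.
    rewrite -(big_mkord xpredT (fun k => s k - b)).
    rewrite (@big_cat_nat _ _ _ T0)//=; last exact: leqW.
    rewrite big_mkord gerDl big_nat_cond; apply: sumr_le0 => k.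
    by rewrite andbT => /andP[kT _]; rewrite subr_le0; exact: HT0.
  have Ct : C <= (e / 2) * t.+1%:R.
    apply: le_trans (ler_norm C) _.
    have : 2 * `|C| / e <= t.+1%:R.
      by apply: le_trans (ltW (truncnS_gt _)) _; rewrite ler_nat leqW.
    by rewrite ler_pdivrMr//; lra.
  have := sT t; have := HT1 t.+1 (leqW tT1).
  move=> e1 st.
  rewrite -(ler_pM2r t0).
  have := ler_wpM2l b0 sumb; have := ler_wpM2r (ltW t0) e1.
  have : beta * C <= e / 2 * t.+1%:R.
    apply: le_trans (ler_wpM2l b0 Ct) _.
    rewrite ler_piMl ?(ltW b1)// mulr_ge0// ltW//.
  lra.
apply/cvgrPdist_le => e e0.
pose eta := (1 - beta) * (e / 2).
have eta0 : 0 < eta by rewrite mulr_gt0 ?divr_gt0//; lra.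
have bounds k : exists T0, forall t, (T0 <= t)%N -> s t <= beta ^+ k * B + e / 2.
  elim: k => [|k IH].
    by exists 0%N => t _; rewrite expr0 mul1r (le_trans (sB t))//; lra.
  have [T0 HT0] := improve _ _ eta0 IH; exists T0 => t /HT0.
  by rewrite exprS /eta; lra.
have : (fun n => beta ^+ n * B) @ \oo --> (0 * B : R).
  by apply: cvgM; [apply: cvg_expr; rewrite ger0_norm|exact: cvg_cst].
have e2 : 0 < e / 2 by rewrite divr_gt0.
rewrite mul0r => /cvgrPdist_le /(_ _ e2)[k _ /(_ k (leqnn _))] /=.
rewrite sub0r normrN => bk; have [T0 HT0] := bounds k.
exists T0 => // t /= /HT0; rewrite sub0r normrN ger0_norm//.
by have := le_trans (ler_norm _) bk; lra.
Qed.

Definition harmonic_sum (t : nat) : R := \sum_(k < t) k.+1%:R^-1.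

Lemma harmonic_sum_le_powR gamma t : 0 < gamma -> gamma <= 1 ->
  harmonic_sum t <= gamma^-1 * t%:R `^ gamma.
Proof.
move=> g0 g1; rewrite /harmonic_sum; elim: t => [|t IH].
  by rewrite big_ord0 mulr_ge0 ?powR_ge0// invr_ge0 ltW.
have t0 : 0 < t.+1%:R :> R by rewrite ltr0n.
rewrite big_ord_recr/=; apply: le_trans (lerD IH (lexx _)) _.
rewrite -(ler_pM2l g0) mulrDr !mulVKf ?gt_eqF//.
have := powR_tangent (ler0n R t) t0 g0 g1.
have : t.+1%:R^-1 <= t.+1%:R `^ (gamma - 1) :> R.
  rewrite -powR_inv1 ?ler0n// ler_powR ?ler1n//; lra.
have -> : t%:R - t.+1%:R = -1 :> R by rewrite -[t.+1%:R]natr1; ring.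
move=> /(ler_wpM2l (ltW g0)) h1; rewrite mulrN1 => h2.
by apply: le_trans (lerD (lexx _) h1) _; rewrite -lerBrDr.
Qed.

(** Along the cubes, a bound of order [sqrt k] on the terms makes the second
    moments of the averages summable and the gaps between cubes negligible. *)
Lemma harmonic_sum_cube k : harmonic_sum (k.+1 ^ 3) <= 6 * Num.sqrt k.+1%:R.
Proof.
have := @harmonic_sum_le_powR 6^-1 (k.+1 ^ 3) _ _.
rewrite invrK natrX -powR_mulrn ?ler0n// -powRrM.
have -> : 3%:R * 6^-1 = 2^-1 :> R by field.
rewrite powR12_sqrt ?ler0n//; apply; lra.
Qed.

Lemma cube_bracket (T : nat) : (0 < T)%N ->
  exists m, (m.+1 ^ 3 <= T < m.+2 ^ 3)%N.
Proof.
elim: T => // -[_ _|T /(_ isT)[m /andP[m1 m2]] _]; first by exists 0%N.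
have [h|h] := ltnP T.+2 (m.+2 ^ 3); first by exists m; rewrite h (leq_trans m1).
by exists m.+1; rewrite h/= (leq_ltn_trans m2)// ltn_exp2r.
Qed.

Lemma cvg_average_cubes (S B : R^nat) (C : R) :
  0 <= C -> (forall t, `|S t.+1 - S t| <= B t) ->
  (forall s t, (s <= t)%N -> B s <= B t) ->
  (forall k, B (k.+1 ^ 3)%N <= C * Num.sqrt k.+1%:R) ->
  (fun k => S (k.+1 ^ 3)%N / (k.+1 ^ 3)%N%:R) @ \oo --> (0 : R) ->
  (fun t => S t / t%:R) @ \oo --> (0 : R).
Proof.
move=> C0 SB Bmono Bcube S0.
have incr s n : `|S (s + n)%N - S s| <= n%:R * B (s + n)%N.
  elim: n => [|n IH]; first by rewrite addn0 subrr normr0 mul0r.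
  have tri := ler_distD (S (s + n)%N) (S (s + n).+1) (S s).
  have Bn : B (s + n)%N <= B (s + n).+1 by exact: Bmono.
  have := SB (s + n)%N; have := ler_wpM2l (ler0n R n) Bn.
  by rewrite addnS -[n.+1%:R]natr1 mulrDl mul1r; lra.
have key T m : (m.+1 ^ 3 <= T < m.+2 ^ 3)%N ->
    `|S T / T%:R| <= `|S (m.+1 ^ 3)%N / (m.+1 ^ 3)%N%:R| +
      14 * C * (Num.sqrt m.+2%:R)^-1.
  move=> /andP[mT Tm].
  have a0 : 0 < m.+1%:R :> R by rewrite ltr0n.
  have m0 : 0 < (m.+1 ^ 3)%N%:R :> R by rewrite ltr0n expn_gt0.
  have T0 : 0 < T%:R :> R by apply: lt_le_trans m0 _; rewrite ler_nat.
  have ST : `|S T| <= `|S (m.+1 ^ 3)%N| +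
      ((m.+2 ^ 3)%N%:R - (m.+1 ^ 3)%N%:R) * (C * Num.sqrt m.+2%:R).
    have := incr (m.+1 ^ 3)%N (T - m.+1 ^ 3)%N; rewrite subnKC// => ST.
    have BT : B T <= C * Num.sqrt m.+2%:R.
      by apply: le_trans (Bcube m.+1); apply: Bmono; exact: ltnW.
    have BT0 : 0 <= B T by apply: le_trans (SB T); exact: normr_ge0.
    have : `|S T - S (m.+1 ^ 3)%N| <=
        ((m.+2 ^ 3)%N%:R - (m.+1 ^ 3)%N%:R) * (C * Num.sqrt m.+2%:R).
      apply: le_trans ST _; apply: ler_pM => //.
      rewrite -natrB ?ler_nat; last by rewrite leq_exp2r.
      by apply: leq_sub2r; exact: ltnW.
    have := ler_normD (S T - S (m.+1 ^ 3)%N) (S (m.+1 ^ 3)%N).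
    by rewrite subrK; lra.
  pose r := Num.sqrt m.+2%:R : R.
  have r0 : 0 < r by rewrite sqrtr_gt0 ltr0n.
  have rr : r * r = m.+1%:R + 1 by rewrite -expr2 sqr_sqrtr ?ler0n// natr1.
  rewrite normrM normfV (gtr0_norm T0) ler_pdivrMr//.
  apply: le_trans ST _.
  have mT' : (m.+1 ^ 3)%N%:R <= T%:R :> R by rewrite ler_nat.
  apply: (@le_trans _ _ ((`|S (m.+1 ^ 3)%N / (m.+1 ^ 3)%N%:R| + 14 * C * r^-1)
      * (m.+1 ^ 3)%N%:R)); last first.
    by rewrite ler_wpM2l// addr_ge0// !mulr_ge0// invr_ge0 ltW.
  rewrite [leRHS]mulrDl normrM normfV (gtr0_norm m0) divfK ?gt_eqF// lerD2l -/r.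
  rewrite -(ler_pM2r r0) -[leLHS]mulrA -[C * r * r]mulrA rr.
  have -> : 14 * C * r^-1 * (m.+1 ^ 3)%N%:R * r = 14 * C * (m.+1 ^ 3)%N%:R.
    by field; rewrite gt_eqF.
  have a1 : 1 <= m.+1%:R :> R by rewrite ler1n.
  rewrite !natrX -[m.+2%:R]natr1; move: (m.+1%:R) a1 => a a1.
  have -> : ((a + 1) ^+ 3 - a ^+ 3) * (C * (a + 1)) =
    C * ((3 * a ^+ 2 + 3 * a + 1) * (a + 1)) by ring.
  have -> : 14 * C * a ^+ 3 = C * (14 * a ^+ 3) by ring.
  apply: ler_wpM2l => //.
  have : 0 <= a * (a - 1) by rewrite mulr_ge0; lra.
  have : 0 <= a ^+ 2 * (a - 1) by rewrite mulr_ge0 ?sqr_ge0; lra.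
  rewrite !exprS expr0; lra.
apply/cvgrPdist_le => e e0.
have e2 : 0 < e / 2 by rewrite divr_gt0.
have /cvgrPdist_le/(_ _ e2)[m0 _ Hm0] := S0.
pose m1 := maxn m0 (Num.truncn ((14 * C / (e / 2)) ^+ 2)).+1.
exists (m1.+1 ^ 3)%N => // T /= m1T.
have [|m mT] := @cube_bracket T; first by apply: leq_trans m1T; rewrite expn_gt0.
have : (m1 <= m)%N.
  have /andP[_ Tm] := mT; have := leq_ltn_trans m1T Tm.
  by rewrite ltn_exp2r.
rewrite geq_max => /andP[m0m tm].
rewrite sub0r normrN; apply: le_trans (key T m mT) _.
have := Hm0 m m0m; rewrite /= sub0r normrN => h1.
suff : 14 * C * (Num.sqrt m.+2%:R)^-1 <= e / 2 by lra.
have r0 : 0 < Num.sqrt m.+2%:R :> R by rewrite sqrtr_gt0 ltr0n.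
rewrite ler_pdivrMr// [leRHS]mulrC -(ler_pdivrMr _ _ e2).
have c0 : 0 <= 14 * C / (e / 2) by apply: divr_ge0 (ltW e2); apply: mulr_ge0.
rewrite -[leLHS](ger0_norm c0) -sqrtr_sqr ler_wsqrtr//.
apply: le_trans (ltW (truncnS_gt _)) _; rewrite ler_nat.
by apply: leq_trans tm _; rewrite (leq_trans (leqnSn m)).
Qed.

End deterministic.

Section law_of_large_numbers.
Context d (Omega : measurableType d) (R : realType) (P : probability Omega R).

Local Notation E f := (\int[P]_w f w)%R.

Let P1 : P [set: Omega] = 1%E. Proof. exact: probability_setT. Qed.

(** By monotone convergence the sum of the squares is integrable, hence almost
    surely finite. *)
Lemma ae_cvg_square_summable (Y : nat -> Omega -> R) (K : R) :
  (forall k, bmeas (Y k)) ->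
  (forall n, \sum_(k < n) E (fun w => Y k w ^+ 2) <= K) ->
  {ae P, forall w, (fun k => Y k w) @ \oo --> (0 : R)}.
Proof.
move=> bY sumY.
have bY2 k : bmeas (fun w => Y k w ^+ 2).
  by under eq_fun do rewrite expr2; exact: bmeasM.
have mY2 k : measurable_fun [set: Omega] (fun w => (Y k w ^+ 2)%:E).
  by apply/measurable_EFinP; case: (bY2 k).
pose F w := (\sum_(k <oo) (Y k w ^+ 2)%:E)%E.
have F0 w : (0 <= F w)%E.
  by apply: nneseries_ge0 => n _ _; rewrite lee_fin sqr_ge0.
have mF : measurable_fun [set: Omega] F.
  by apply: ge0_emeasurable_sum => [k w _ _|k _]; [rewrite lee_fin sqr_ge0|exact: mY2].
have intF : P.-integrable setT F.
  apply/integrableP; split => //.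
  under eq_integral do rewrite gee0_abs//.
  rewrite integral_nneseries//; last by move=> n w _; rewrite lee_fin sqr_ge0.
  apply: (@le_lt_trans _ _ K%:E); last exact: ltry.
  apply: lime_le.
    apply: is_cvg_nneseries => n _ _; apply: integral_ge0 => w _.
    by rewrite lee_fin sqr_ge0.
  apply: nearW => n; rewrite big_mkord.
  under eq_bigr => k _ do rewrite -(EFin_mean measurableT P1 (bY2 k)).
  by rewrite sumEFin lee_fin.
have := integrable_ae measurableT intF.
apply: filterS => w /(_ I) Fw.
have sq : (fun k => Y k w ^+ 2) @ \oo --> (0 : R).
  apply: cvg_series_cvg_0; apply: nondecreasing_is_cvgn.
    apply/nondecreasing_seqP => n; rewrite /series/= big_nat_recr//= lerDl.
    exact: sqr_ge0.
  exists (fine (F w)) => _ [n _ <-]; rewrite -lee_fin fineK// /series/= -sumEFin.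
  by apply: nneseries_lim_ge => k _ _; rewrite lee_fin sqr_ge0.
apply/cvgrPdist_le => e e0; have e2 : 0 < e ^+ 2 by rewrite exprn_gt0.
have /cvgrPdist_le/(_ _ e2) := sq.
apply: filterS => k; rewrite !sub0r !normrN ger0_norm ?sqr_ge0//.
by rewrite -[X in X <= _]real_normK ?num_real// ler_pXn2r// nnegrE// ltW.
Qed.

(** Orthogonality bounds the second moment of the partial sums, hence gives the
    result along the cubes; the growth bound on the terms fills the gaps. *)
Lemma orthogonal_slln (w_ : nat -> Omega -> R) (B : R^nat) (C : R) :
  0 <= C -> (forall t, bmeas (w_ t)) -> (forall t w, `|w_ t w| <= B t) ->
  (forall s t, (s <= t)%N -> B s <= B t) ->
  (forall k, B (k.+1 ^ 3)%N <= C * Num.sqrt k.+1%:R) ->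
  (forall s t, (s < t)%N -> E (fun w => w_ s w * w_ t w) = 0) ->
  {ae P, forall w, (fun T => (\sum_(t < T) w_ t w) / T%:R) @ \oo --> (0 : R)}.
Proof.
move=> C0 bw wB Bmono Bcube orth.
pose S T w := \sum_(t < T) w_ t w.
have bS T : bmeas (S T) by exact: bmeas_sum.
have B0 t : 0 <= B t := le_trans (normr_ge0 _) (wB t point).
have ES T : E (fun w => S T w ^+ 2) <= T%:R * B T ^+ 2.
  suff H n : (n <= T)%N -> E (fun w => S n w ^+ 2) <= n%:R * B T ^+ 2 by exact: H.
  elim: n => [_|n IH nT].
    rewrite mul0r; under eq_Rintegral do rewrite /S big_ord0 expr0n/=.
    by rewrite (mean_cst measurableT P1).
  have bSw : bmeas (fun w => S n w * w_ n w) by exact: bmeasM.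
  have bS2 : bmeas (fun w => S n w ^+ 2).
    by under eq_fun do rewrite expr2; exact: bmeasM.
  have bw2 : bmeas (fun w => w_ n w ^+ 2).
    by under eq_fun do rewrite expr2; exact: bmeasM.
  have b2 : bmeas (fun w => 2 * (S n w * w_ n w)) by exact: bmeasZ.
  have -> : E (fun w => S n.+1 w ^+ 2) =
      E (fun w => S n w ^+ 2 + 2 * (S n w * w_ n w) + w_ n w ^+ 2).
    by apply: eq_Rintegral => w _; rewrite /S big_ord_recr/=; ring.
  rewrite (meanD measurableT P1 (bmeasD bS2 b2) bw2) (meanD measurableT P1 bS2 b2).
  rewrite (meanZ measurableT P1 _ bSw).
  have -> : E (fun w => S n w * w_ n w) = 0.
    under eq_Rintegral do rewrite /S mulr_suml.
    have bF (k : 'I_n) : bmeas (fun w => w_ k w * w_ n w) by exact: bmeasM.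
    by rewrite (mean_sum measurableT P1 _ bF) big1// => k _; exact: orth.
  rewrite mulr0 addr0 -natr1 mulrDl mul1r lerD ?IH ?(ltnW nT)//.
  apply: (mean_le_cst measurableT P1 bw2) => w _.
  rewrite -real_normK ?num_real// ler_pXn2r ?nnegrE//.
  by apply: le_trans (wB n w) _; apply: Bmono; exact: ltnW.
have /ae_cvg_square_summable : forall k,
    bmeas (fun w => (k.+1 ^ 3)%N%:R^-1 * S (k.+1 ^ 3)%N w).
  by move=> k; exact: bmeasZ.
move=> /(_ (2 * C ^+ 2)) H.
have term k : E (fun w => ((k.+1 ^ 3)%N%:R^-1 * S (k.+1 ^ 3)%N w) ^+ 2) <=
    C ^+ 2 * (k.+1%:R ^+ 2)^-1.
  have bS2 : bmeas (fun w => S (k.+1 ^ 3)%N w ^+ 2).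
    by under eq_fun do rewrite expr2; exact: bmeasM.
  under eq_Rintegral do rewrite exprMn.
  rewrite (meanZ measurableT P1 _ bS2) exprVn.
  have a0 : 0 < k.+1%:R :> R by rewrite ltr0n.
  rewrite ler_pdivrMl; last by rewrite exprn_gt0// ltr0n expn_gt0.
  apply: le_trans (ES _) _.
  have BC : B (k.+1 ^ 3)%N ^+ 2 <= C ^+ 2 * k.+1%:R.
    rewrite -[k.+1%:R]sqr_sqrtr ?ler0n// -exprMn ler_pXn2r ?nnegrE//.
    by rewrite mulr_ge0// sqrtr_ge0.
  apply: (@le_trans _ _ ((k.+1 ^ 3)%N%:R * (C ^+ 2 * k.+1%:R))).
    by rewrite ler_wpM2l.
  rewrite natrX le_eqVlt; apply/orP; left; apply/eqP; field.
  by rewrite nat1r gt_eqF.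
have sum_sq n : \sum_(k < n.+1) (k.+1%:R ^+ 2)^-1 <= 2 - n.+1%:R^-1 :> R.
  elim: n => [|n IH]; first by rewrite big_ord1 expr1n invr1; lra.
  rewrite big_ord_recr/=; apply: le_trans (lerD IH (lexx _)) _.
  rewrite -[n.+2%:R]natr1; have : 1 <= n.+1%:R :> R by rewrite ler1n.
  move: (n.+1%:R) => a a1.
  have E1 : a^-1 - (a + 1)^-1 - ((a + 1) ^+ 2)^-1 = (a * (a + 1) ^+ 2)^-1.
    by field; rewrite !gt_eqF//; lra.
  have : 0 <= (a * (a + 1) ^+ 2)^-1.
    by rewrite invr_ge0 mulr_ge0 ?sqr_ge0//; lra.
  by rewrite -E1; lra.
have {}H : {ae P, forall w,
    (fun k => (k.+1 ^ 3)%N%:R^-1 * S (k.+1 ^ 3)%N w) @ \oo --> (0 : R)}.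
  apply: H => -[|n]; first by rewrite big_ord0 mulr_ge0// sqr_ge0.
  apply: (@le_trans _ _ (\sum_(k < n.+1) C ^+ 2 * (k.+1%:R ^+ 2)^-1)).
    by apply: ler_sum => k _; exact: term.
  rewrite -mulr_sumr mulrC ler_wpM2r ?sqr_ge0//.
  apply: le_trans (sum_sq n) _.
  by rewrite gerDl oppr_le0 invr_ge0.
apply: filterS H => w Hw.
apply: (cvg_average_cubes C0 _ Bmono Bcube).
  move=> t; rewrite /= big_ord_recr/=; set a := \sum_(k < t) _.
  by have -> : a + w_ t w - a = w_ t w by ring.
by under eq_fun do rewrite mulrC.
Qed.

End law_of_large_numbers.

(** * Quantized Q-learning *)

Section oscillation.
Context (R : realType) (S U : finPointedType).
Implicit Types f g : S -> U -> R.

Let bounded f : exists K, forall i u, `|f i u| <= K.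
Proof.
exists (\sum_(z : S * U) `|f z.1 z.2|) => i u.
by rewrite (bigD1 (i, u))//= lerDl sumr_ge0.
Qed.

Lemma finite_oscillation f : exists2 G, 0 <= G & forall i u j v, f i u - f j v <= G.
Proof.
have [K fK] := bounded f; exists (K + K) => [|i u j v].
  by rewrite addr_ge0// (le_trans _ (fK point point)).
have := fK i u; have := fK j v.
by rewrite !ler_norml => /andP[? ?] /andP[? ?]; lra.
Qed.

Lemma span_seminorm_ge f i u j v : f i u - f j v <= span_seminorm f.
Proof.
have [K fK] := bounded f; rewrite /span_seminorm lerB//.
  apply: ub_le_sup; last by exists (i, u).
  by exists K => _ [[a b] _ <-]; have := fK a b; rewrite ler_norml => /andP[].
apply: ge_inf; last by exists (j, v).
by exists (- K) => _ [[a b] _ <-]; have := fK a b; rewrite ler_norml => /andP[].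
Qed.

Lemma span_seminorm_ge0 f : 0 <= span_seminorm f.
Proof. by have := span_seminorm_ge f point point point point; rewrite subrr. Qed.

Lemma span_seminorm_le f B : (forall i u j v, f i u - f j v <= B) ->
  span_seminorm f <= B.
Proof.
move=> fB; rewrite /span_seminorm lerBlDr.
have ne : range (uncurry f) !=set0 by exists (f point point), (point, point).
apply: ge_sup => // _ [[i u] _ <-] /=.
rewrite -lerBlDl; apply: lb_le_inf => // _ [[j v] _ <-] /=.
by have := fB i u j v; lra.
Qed.

Lemma uniform_norm_le f B : (forall i u, `|f i u| <= B) -> uniform_norm f <= B.
Proof.
move=> fB; apply: ge_sup; first by exists `|f point point|, (point, point).
by move=> _ [[i u] _ <-]; exact: fB.
Qed.

Lemma uniform_norm_ge0 f : 0 <= uniform_norm f.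
Proof.
have [K fK] := bounded f; apply: (@le_trans _ _ `|f point point|) => //.
apply: ub_le_sup; last by exists (point, point).
by exists K => _ [[a b] _ <-]; exact: fK.
Qed.

Lemma minU_oscillation f g B :
  (forall i u j v, f i u - g i u - (f j v - g j v) <= B) ->
  forall i j, minU (f i) - minU (g i) - (minU (f j) - minU (g j)) <= B.
Proof.
move=> fgB i j.
have [u gu] := minU_attained (g i); have [v fv] := minU_attained (f j).
have := minU_le (f i) u; have := minU_le (g j) v; have := fgB i u j v.
by rewrite gu fv; lra.
Qed.

Lemma minU_oscillation1 f B : (forall i u j v, f i u - f j v <= B) ->
  forall i j, minU (f i) - minU (f j) <= B.
Proof.
move=> fB i j; have [v ->] := minU_attained (f j).
by apply: le_trans (fB i v j v); rewrite lerD2r minU_le.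
Qed.

(** Shifting [delta] by its midrange leaves a function of absolute value at most
    [s / 2], paired with a signed vector of total mass 0. *)
Lemma total_variation_bound (I : finPointedType) (a b delta : I -> R) beta s :
  \sum_j a j = \sum_j b j -> 2^-1 * \sum_j `|a j - b j| <= beta ->
  (forall j k, delta j - delta k <= s) ->
  \sum_j a j * delta j - \sum_j b j * delta j <= beta * s.
Proof.
move=> ab tv ds.
have s0 : 0 <= s by have := ds point point; rewrite subrr.
have [k _ mk] := @arg_minP _ _ _ (point : I) xpredT delta isT.
pose c := delta k + s / 2.
have dc j : `|delta j - c| <= s / 2.
  have := ds j k; have := mk j isT; rewrite ler_norml /c => ? ?.
  by apply/andP; split; lra.
have -> : \sum_j a j * delta j - \sum_j b j * delta j =
    \sum_j (a j - b j) * (delta j - c).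
  have -> : \sum_j (a j - b j) * (delta j - c) =
      (\sum_j a j * delta j - \sum_j b j * delta j) -
      (\sum_j a j - \sum_j b j) * c.
    rewrite mulrBl !mulr_suml -!sumrB; apply: eq_bigr => j _; ring.
  by rewrite ab subrr mul0r subr0.
apply: (@le_trans _ _ (\sum_j `|a j - b j| * (s / 2))).
  apply: ler_sum => j _; apply: le_trans (ler_norm _) _.
  by rewrite normrM ler_wpM2l.
rewrite -mulr_suml; have := ler_wpM2r s0 tv; lra.
Qed.

End oscillation.

Section q_learning.
Context (R : realType) (X : completeMetricType R) (N : nat) (U : finPointedType).
Variables (q : quantization X N) (M : @mdp R _ (borel X) U).
Context (dO : measure_display) (Omega : measurableType dO) (P : probability Omega R).
Variables (x x1 : nat -> 'I_N.+1 -> U -> {mfun Omega >-> borel X}).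
Variable Q0 : 'I_N.+1 -> U -> R.
Hypothesis xP : sampling q M P x x1.

Local Notation Qt := (Qlearning q M (fun t => t.+1%:R^-1) Q0 x x1).
Local Notation C := (finite_cost q M).
Local Notation p := (finite_trans q M).
Local Notation E f := (\int[P]_w f w)%R.

Definition state_value t w j := minU (Qt t w j).

(** The martingale differences of the algorithm: the sampled target minus its
    conditional mean given the earlier iterations. *)
Definition noise t i u w : R :=
  (cost M (x t i u w) u - C i u) +
  \sum_j state_value t w j * (\1_(bin q j) (x1 t i u w) - p i u j).

(** With step sizes [1 / (t + 1)], the iterate is the mean of all past targets. *)
Lemma Qlearning_sum T w i u : T%:R * Qt T w i u =
  \sum_(t < T) (C i u + \sum_j p i u j * state_value t w j) + \sum_(t < T) noise t i u w.
Proof.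
elim: T => [|T IH]; first by rewrite !big_ord0 mul0r addr0.
rewrite ![\sum_(t < T.+1) _]big_ord_recr/=.
have -> : T.+1%:R * ((1 - T.+1%:R^-1) * Qt T w i u + T.+1%:R^-1 *
    (cost M (x T i u w) u + minU (Qt T w (bin_index q (x1 T i u w))))) =
    T%:R * Qt T w i u +
    (cost M (x T i u w) u + state_value T w (bin_index q (x1 T i u w))).
  rewrite -[T%:R]/(T.+1.-1%:R) /state_value -[T.+1%:R]natr1 /=; field.
  by rewrite natr1 pnatr_eq0.
rewrite IH (bin_functionE q (state_value T w)) /noise.
have -> : \sum_j state_value T w j * (\1_(bin q j) (x1 T i u w) - p i u j) =
    \sum_j state_value T w j * \1_(bin q j) (x1 T i u w) -
    \sum_j p i u j * state_value T w j.
  by rewrite -sumrB; apply: eq_bigr => j _; rewrite mulrBr (mulrC (p i u j)).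
ring.
Qed.

Let trans1 y u : trans M (y, u) [set: _] = 1%E.
Proof. exact: prob_kernel. Qed.

Section growth.
Variables (K G0 : R).
Hypotheses (cK : forall y u, `|cost M y u| <= K)
  (Q0G : forall i u j v, Q0 i u - Q0 j v <= G0).

Definition growth t := G0 + 2 * K * harmonic_sum R t.

Let K0 : 0 <= K := le_trans (normr_ge0 _) (cK point point).

(** For individual samples the Bellman update is merely nonexpansive in
    oscillation, but each step adds at most [2 K / (t + 1)], so the growth is
    logarithmic; this suffices for the second moments. *)
Lemma Qlearning_growth t w i u j v : Qt t w i u - Qt t w j v <= growth t.
Proof.
elim: t i u j v => [|t IH] i u j v.
  by rewrite /growth /harmonic_sum big_ord0 mulr0 addr0.
have VG a b : state_value t w a - state_value t w b <= growth t.
  exact: minU_oscillation1.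
rewrite /growth /harmonic_sum big_ord_recr/= -/(harmonic_sum R t).
have t0 : 0 < t.+1%:R^-1 :> R by rewrite invr_gt0.
have t1 : t.+1%:R^-1 <= 1 :> R by rewrite invf_le1// ler1n.
move: t.+1%:R^-1 t0 t1 => a a0 a1.
have := VG (bin_index q (x1 t i u w)) (bin_index q (x1 t j v w)).
have := IH i u j v; have := cK (x t i u w) u; have := cK (x t j v w) v.
rewrite !ler_norml -!/(state_value t w _) /growth => /andP[? ?] /andP[? ?] h1 h2.
have h3 : cost M (x t i u w) u - cost M (x t j v w) v <= 2 * K by lra.
have a1' : 0 <= 1 - a by lra.
have := ler_wpM2l a1' h1; have := ler_wpM2l (ltW a0) h2.
have := ler_wpM2l (ltW a0) h3; lra.
Qed.

Lemma noise_bound t i u w : `|noise t i u w| <= 2 * K + growth t.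
Proof.
have VG a b : state_value t w a - state_value t w b <= growth t.
  by apply: minU_oscillation1 => ? ? ? ?; exact: Qlearning_growth.
have CK : `|C i u| <= K.
  apply: (mean_norm_le (measurable_bin q i) (bin_weight_bin q i)) => //.
  exact: bmeas_cost1.
have Vp : \sum_j state_value t w j * (\1_(bin q j) (x1 t i u w) - p i u j) =
    \sum_j p i u j * (state_value t w (bin_index q (x1 t i u w)) - state_value t w j).
  under eq_bigr do rewrite mulrBr; under [RHS]eq_bigr do rewrite mulrBr.
  rewrite !sumrB -bin_functionE -mulr_suml sum_finite_trans mul1r.
  by congr (_ - _); apply: eq_bigr => j _; rewrite mulrC.
have dV : `|\sum_j state_value t w j * (\1_(bin q j) (x1 t i u w) - p i u j)| <= growth t.
  rewrite Vp; apply: le_trans (ler_norm_sum _ _ _) _.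
  rewrite -[leRHS]mul1r -(sum_finite_trans q M i u) mulr_suml; apply: ler_sum => j _.
  rewrite normrM ger0_norm ?finite_trans_ge0// ler_wpM2l ?finite_trans_ge0//.
  rewrite ler_norml VG andbT.
  have := VG j (bin_index q (x1 t i u w)); lra.
rewrite /noise; apply: le_trans (ler_normD _ _) _; apply: lerD => //.
apply: le_trans (ler_normB _ _) _; have := cK (x t i u w) u; lra.
Qed.

End growth.

End q_learning.

Section sampling_filtration.
Context (R : realType) (X : completeMetricType R) (N : nat) (U : finPointedType).
Variables (q : quantization X N) (M : @mdp R _ (borel X) U).
Context (dO : measure_display) (Omega : measurableType dO) (P : probability Omega R).
Variables (x x1 : nat -> 'I_N.+1 -> U -> {mfun Omega >-> borel X}).
Variable Q0 : 'I_N.+1 -> U -> R.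
Hypothesis xP : sampling q M P x x1.

Local Notation Qt := (Qlearning q M (fun t => t.+1%:R^-1) Q0 x x1).
Local Notation C := (finite_cost q M).
Local Notation p := (finite_trans q M).
Local Notation E f := (\int[P]_w f w)%R.
Local Notation V := (state_value q M x x1 Q0).
Local Notation noise := (noise q M x x1 Q0).

Definition sample_events (t : nat) : set (set Omega) :=
  \bigcup_(p in [set: 'I_N.+1 * U])
        preimage_set_system [set: Omega]
          (fun w => (x t p.1 p.2 w, x1 t p.1 p.2 w))
          (@measurable _ (borel X * borel X)%type).

(** The events of the iterations before [t], presented by a generating family
    that is stable under intersection. *)
Definition past_events (t : nat) : set (set Omega) :=
  [set A | exists2 F : nat -> set Omega,
    (forall k, iteration_sigma x x1 k (F k)) &
    A = \bigcap_(k in [set` iota 0 t]) F k].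

Let sigma_setT t : iteration_sigma x x1 t setT.
Proof. exact: (@measurableT _ (g_sigma_algebraType (sample_events t))). Qed.

Let sigma_setI t A B : iteration_sigma x x1 t A -> iteration_sigma x x1 t B ->
  iteration_sigma x x1 t (A `&` B).
Proof. exact: (@measurableI _ (g_sigma_algebraType (sample_events t)) A B). Qed.

Let sample_measurable t : sample_events t `<=` measurable.
Proof.
move=> A [[i u] _ [B mB <-]].
by apply: (measurable_fun_pair (measurable_funPT (x t i u))
  (measurable_funPT (x1 t i u))).
Qed.

Let sigma_measurable t : iteration_sigma x x1 t `<=` measurable.
Proof.
apply: smallest_sub; first exact: sigma_algebra_measurable.
exact: sample_measurable.
Qed.

Let past_measurable t : past_events t `<=` measurable.
Proof.
move=> _ [F mF ->]; apply: fin_bigcap_measurable => // k _.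
exact: sigma_measurable.
Qed.

Let past_setT t : past_events t setT.
Proof.
by exists (fun=> setT) => //; rewrite bigcapT.
Qed.

Let past_setI t : setI_closed (past_events t).
Proof.
move=> _ _ [F mF ->] [G mG ->]; exists (fun k => F k `&` G k) => [k|].
  exact: sigma_setI.
by rewrite bigcapI.
Qed.

(** The product rule for the iterations before [t] and iteration [t] together,
    divided into its first [t] factors and the last one. *)
Let past_indep t A B : past_events t A -> <<s sample_events t >> B ->
  P (A `&` B) = (P A * P B)%E.
Proof.
move=> [F mF ->] mB; have [_ ind] := xP.
pose F' k := if k == t then B else F k.
have F'F k : k \in iota 0 t -> F' k = F k.
  by rewrite mem_iota /F' add0n => /andP[_ kt]; rewrite ltn_eqF.
have mF' k : iteration_sigma x x1 k (F' k).
  by rewrite /F'; case: eqP => [->|].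
have := ind (t :: iota 0 t) F'.
rewrite /= mem_iota add0n ltnn andbF iota_uniq => /(_ isT (fun k _ => mF' k)).
rewrite big_cons {2}/F' eqxx muleC => H.
transitivity ((\prod_(k <- iota 0 t) P (F' k)) * P B)%E.
  rewrite -H; congr (P _); apply/seteqP; split => [w [Fw Bw] k /=|w Fw].
    rewrite inE => /predU1P[->|kt]; first by rewrite /F' eqxx.
    by rewrite F'F//; exact: Fw.
  split => [k /= kt|]; first by rewrite -F'F//; apply: Fw; rewrite /= inE kt orbT.
  by have := Fw t; rewrite /F' eqxx; apply; rewrite /= inE eqxx.
congr (_ * _)%E; rewrite -(ind _ F')//; last exact: iota_uniq.
by congr (P _); apply: eq_bigcapr => k /= kt; rewrite F'F.
Qed.

Let past_subset s t : (s <= t)%N -> past_events s `<=` past_events t.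
Proof.
move=> st A [F mF ->]; exists (fun k => if (k < s)%N then F k else setT).
  by move=> k; case: ifP.
apply/seteqP; split => w Fw k /=; rewrite mem_iota add0n => /andP[_ kt].
  by case: ifP => // ks; apply: Fw; rewrite /= mem_iota add0n.
have := Fw k; rewrite /= mem_iota add0n kt; apply.
exact: leq_trans st.
Qed.

Let sigma_past k t : (k < t)%N -> iteration_sigma x x1 k `<=` past_events t.
Proof.
move=> kt A mA; exists (fun j => if j == k then A else setT).
  by move=> j; case: eqP => [->|].
apply/seteqP; split => w Aw; first by move=> j _ /=; case: eqP.
by have := Aw k; rewrite /= eqxx; apply; rewrite mem_iota add0n.
Qed.

Local Notation OP t := (g_sigma_algebraType (past_events t)).
Local Notation OS t := (g_sigma_algebraType (sample_events t)).

Let past_mono s t (f : Omega -> R) : (s <= t)%N ->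
  bmeas (f : OP s -> R) -> bmeas (f : OP t -> R).
Proof.
move=> st; apply: (bmeas_comp (g := id : OP t -> OP s)) => _ A sA.
rewrite setTI; exact: (sub_sigma_algebra2 (past_subset st) sA).
Qed.

Let bmeas_past t (f : Omega -> R) : bmeas (f : OP t -> R) -> bmeas f.
Proof.
apply: (bmeas_comp (g := id : Omega -> OP t)) => _ A sA.
rewrite setTI; move: A sA; apply: smallest_sub; first exact: sigma_algebra_measurable.
exact: past_measurable.
Qed.

Let bmeas_sample t (f : Omega -> R) : bmeas (f : OS t -> R) -> bmeas f.
Proof.
apply: (bmeas_comp (g := id : Omega -> OS t)) => _ A sA.
by rewrite setTI; exact: (@sigma_measurable t A sA).
Qed.

Let sample_past t (f : Omega -> R) :
  bmeas (f : OS t -> R) -> bmeas (f : OP t.+1 -> R).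
Proof.
apply: (bmeas_comp (g := id : OP t.+1 -> OS t)) => _ A sA.
by rewrite setTI; apply: sub_sigma_algebra; exact: (@sigma_past t t.+1 _ A sA).
Qed.

Let measurable_pair_sample t i u : measurable_fun [set: OS t]
  (fun w : OS t => (x t i u w, x1 t i u w) : borel X * borel X).
Proof.
by move=> _ B mB; apply: sub_sigma_algebra; exists (i, u) => //; exists B.
Qed.

Let bmeas_x t i u (f : borel X -> R) : bmeas f ->
  bmeas ((fun w => f (x t i u w)) : OS t -> R).
Proof.
move=> bf; apply: (bmeas_comp (g := (fun w => x t i u w) : OS t -> borel X) _ bf).
by have /measurable_fun_pairP[] := @measurable_pair_sample t i u.
Qed.

Let bmeas_x1 t i u (f : borel X -> R) : bmeas f ->
  bmeas ((fun w => f (x1 t i u w)) : OS t -> R).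
Proof.
move=> bf; apply: (bmeas_comp (g := (fun w => x1 t i u w) : OS t -> borel X) _ bf).
by have /measurable_fun_pairP[] := @measurable_pair_sample t i u.
Qed.

Let bmeas_minU_fin d (T : measurableType d) (g : T -> U -> R) :
  (forall u, bmeas (g ^~ u)) -> bmeas (fun w => minU (g w)).
Proof.
move=> bg; apply: bmeas_minU; rewrite (_ : (fun z => _) =
    fun z : T * discr U => \sum_u g z.1 u * \1_[set u] z.2); last first.
  apply/funext => -[w u] /=; rewrite (bigD1 u)//= indicE mem_set//= mulr1.
  rewrite big1 ?addr0// => v vu; rewrite indicE memNset ?mulr0//=.
  by move=> /esym/eqP; rewrite (negbTE vu).
apply: bmeas_sum => u; apply: bmeasM; first exact: (bmeas_comp measurable_fst (bg u)).
apply: (bmeas_comp measurable_snd); apply: bmeas_indic; exact: discr_measurable.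
Qed.

Let bmeas_V_of_Q t : (forall i u, bmeas ((fun w => Qt t w i u) : OP t -> R)) ->
  forall j, bmeas ((fun w => V t w j) : OP t -> R).
Proof. by move=> bQ j; apply: bmeas_minU_fin => u; exact: bQ. Qed.

Let bmeas_bin_sample t i u j :
  bmeas ((fun w => \1_(bin q j) (x1 t i u w)) : OS t -> R).
Proof. by apply: bmeas_x1; apply: bmeas_indic; exact: measurable_bin. Qed.

Let bmeas_cost_sample t i u :
  bmeas ((fun w => cost M (x t i u w) u) : OS t -> R).
Proof. exact: bmeas_x (bmeas_cost1 M u). Qed.

Let bmeas_Q t i u : bmeas ((fun w => Qt t w i u) : OP t -> R).
Proof.
elim: t i u => [|t IH] i u; first exact: bmeas_cst.
have bV j : bmeas ((fun w => V t w j) : OP t.+1 -> R).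
  by apply: (past_mono (leqnSn t)); exact: bmeas_V_of_Q.
apply: bmeasD; apply: bmeasZ; first exact: (past_mono (leqnSn t) (IH i u)).
apply: bmeasD; first exact: sample_past (bmeas_cost_sample t i u).
rewrite (_ : (fun w => _) = fun w => \sum_j V t w j * \1_(bin q j) (x1 t i u w)).
  apply: bmeas_sum => j; apply: bmeasM => //.
  exact: sample_past (bmeas_bin_sample t i u j).
by apply/funext => w; rewrite -(bin_functionE q (V t w)).
Qed.

Let bmeas_V t j : bmeas ((fun w => V t w j) : OP t -> R).
Proof. by apply: bmeas_V_of_Q => i u; exact: bmeas_Q. Qed.

Let bmeas_cost_dev t i u :
  bmeas ((fun w => cost M (x t i u w) u - C i u) : OS t -> R).
Proof. by apply: bmeasB; [exact: bmeas_cost_sample|exact: bmeas_cst]. Qed.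

Let bmeas_bin_dev t i u j :
  bmeas ((fun w => \1_(bin q j) (x1 t i u w) - p i u j) : OS t -> R).
Proof. by apply: bmeasB; [exact: bmeas_bin_sample|exact: bmeas_cst]. Qed.

Let bmeas_noise_past t i u : bmeas ((fun w => noise t i u w) : OP t.+1 -> R).
Proof.
apply: bmeasD; first exact: sample_past (bmeas_cost_dev t i u).
apply: bmeas_sum => j; apply: bmeasM; last exact: sample_past (bmeas_bin_dev t i u j).
exact: past_mono (leqnSn t) (bmeas_V t j).
Qed.

Lemma bmeas_noise t i u : bmeas (noise t i u).
Proof. exact: bmeas_past (bmeas_noise_past t i u). Qed.

Let P1 : P [set: Omega] = 1%E. Proof. exact: probability_setT. Qed.

Let bin_weightT i (f : borel X -> R) : bmeas f ->
  (\int[bin_weight q i]_y f y = \int[bin_weight q i]_(y in bin q i) f y)%R.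
Proof.
move=> bf; have mb := measurable_bin q i.
have w1 : bin_weight q i setT = 1%E by exact: probability_setT.
have w1y : (bin_weight q i setT < +oo)%E by have -> := w1; rewrite ltry.
rewrite /Rintegral; congr fine.
rewrite (negligible_integral (N := ~` (bin q i : set (borel X)))) ?setTD ?setCK//.
- exact: measurableC.
- by apply: bmeas_integrable => //; exact: w1y.
- rewrite -setTD measureD//.
  rewrite setTI; transitivity (1 - 1 : \bar R)%E; last by rewrite subee.
  by congr (_ - _)%E; [exact: w1|exact: bin_weight_bin].
Qed.

Let mean_cost_sample t i u : E (fun w => cost M (x t i u w) u) = C i u.
Proof.
have bc : bmeas (fun y : borel X => cost M y u) by exact: bmeas_cost1.
rewrite /finite_cost -(bin_weightT i bc).
apply/esym/(mean_image (P := P) (phi := x t i u)) => // A mA.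
have [H _] := xP; have := H t i u A setT mA measurableT.
rewrite preimage_setT setIT => ->.
under eq_integral => z _ do rewrite prob_kernel.
by rewrite integral_cst// mul1e.
Qed.

Let mean_bin_sample t i u j : E (fun w => \1_(bin q j) (x1 t i u w)) = p i u j.
Proof.
have mj := measurable_bin q j.
have bj : bmeas (\1_(bin q j) : borel X -> R) by exact: bmeas_indic.
have bg := bmeas_trans M u bj.
have [H _] := xP; have := H t i u setT (bin q j) measurableT mj.
rewrite preimage_setT setTI => Px.
rewrite finite_transE /bin_mean -(bin_weightT i bg) /Rintegral.
rewrite -[X in fine X = _]/(\int[P]_w (\1_(x1 t i u @^-1` bin q j) w)%:E)%E.
have mx : measurable (x1 t i u @^-1` bin q j).
  by rewrite -[X in measurable X]setTI; exact: (measurable_funPT (x1 t i u)).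
congr fine; rewrite integral_indic// setIT.
apply: (eq_trans Px); apply: eq_integral => z _.
rewrite -[RHS]/((\int[trans M (z, u)]_y \1_(bin q j) y)%R)%:E.
rewrite (EFin_mean measurableT _ bj); last exact: prob_kernel.
by rewrite integral_indic// setIT.
Qed.

Let mean_past_sample t (Y Z : Omega -> R) :
  bmeas (Y : OP t -> R) -> bmeas (Z : OS t -> R) ->
  E (fun w => Y w * Z w) = E Y * E Z.
Proof.
exact: (mean_indep (@past_measurable t) (@sample_measurable t)
  (past_setT t) (@past_setI t) (@past_indep t)).
Qed.

(** Each term of the later noise is a function of the past times a centered
    function of the current samples. *)
Lemma noise_orthogonal s t i u : (s < t)%N ->
  E (fun w => noise s i u w * noise t i u w) = 0.
Proof.
move=> st.
have bs : bmeas ((fun w => noise s i u w) : OP t -> R).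
  exact: past_mono st (bmeas_noise_past s i u).
have bsV j : bmeas ((fun w => noise s i u w * V t w j) : OP t -> R).
  by apply: bmeasM => //; exact: bmeas_V.
have c0 : E (fun w => cost M (x t i u w) u - C i u) = 0.
  rewrite (meanB measurableT P1 (bmeas_sample (bmeas_cost_sample t i u))
    (bmeas_cst _ _)).
  by rewrite mean_cost_sample (mean_cst measurableT P1) subrr.
have d0 j : E (fun w => \1_(bin q j) (x1 t i u w) - p i u j) = 0.
  rewrite (meanB measurableT P1 (bmeas_sample (bmeas_bin_sample t i u j))
    (bmeas_cst _ _)).
  by rewrite mean_bin_sample (mean_cst measurableT P1) subrr.
have b1 : bmeas (fun w => noise s i u w * (cost M (x t i u w) u - C i u)).
  by apply: bmeasM; [exact: bmeas_noise|exact: bmeas_sample (bmeas_cost_dev t i u)].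
have b2 j : bmeas (fun w => noise s i u w * V t w j *
    (\1_(bin q j) (x1 t i u w) - p i u j)).
  apply: bmeasM; first exact: bmeas_past (bsV j).
  exact: bmeas_sample (bmeas_bin_dev t i u j).
transitivity (E (fun w => noise s i u w * (cost M (x t i u w) u - C i u) +
    \sum_j noise s i u w * V t w j * (\1_(bin q j) (x1 t i u w) - p i u j))).
  apply: eq_Rintegral => w _; rewrite {2}/noise mulrDr mulr_sumr; congr (_ + _).
  by apply: eq_bigr => j _; rewrite mulrA.
rewrite (meanD measurableT P1 b1 (bmeas_sum _ b2)) (mean_sum measurableT P1 _ b2).
rewrite (mean_past_sample bs (bmeas_cost_dev t i u)) c0 mulr0 add0r big1// => j _.
by rewrite (mean_past_sample (bsV j) (bmeas_bin_dev t i u j)) d0 mulr0.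
Qed.

Lemma noise_average i u :
  {ae P, forall w, (fun T => (\sum_(t < T) noise t i u w) / T%:R) @ \oo --> (0 : R)}.
Proof.
have [K cK] := bounded_cost M.
have [G0 G00 QG] := finite_oscillation Q0.
have K0 : 0 <= K := le_trans (normr_ge0 _) (cK point point).
apply: (@orthogonal_slln _ _ _ P (noise ^~ i ^~ u) (fun t => 2 * K + growth K G0 t)
  (14 * K + G0)).
- lra.
- by move=> t; exact: bmeas_noise.
- by move=> t w; apply: noise_bound.
- move=> s t st; rewrite lerD2l /growth lerD2l ler_wpM2l ?mulr_ge0//.
  rewrite /harmonic_sum -!(big_mkord xpredT (fun k => k.+1%:R^-1)).
  rewrite [leRHS](@big_cat_nat _ _ _ s)//= lerDl; apply: sumr_ge0 => k _.
  by rewrite invr_ge0.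
- move=> k; have h1 : 1 <= Num.sqrt k.+1%:R :> R.
    by rewrite -[leLHS]sqrtr1 ler_wsqrtr// ler1n.
  have := harmonic_sum_cube R k; rewrite /growth.
  move: (harmonic_sum _ _) (Num.sqrt _) h1 => h r r1 hr.
  have := ler_wpM2l K0 hr; have := ler_wpM2l K0 r1; have := ler_wpM2l G00 r1.
  lra.
- by move=> s t st; exact: noise_orthogonal.
Qed.

Variables (beta rhohat : R) (Qs : 'I_N.+1 -> U -> R).
Hypothesis beta1 : beta < 1.
Hypothesis tv : forall (y y' : 'I_N.+1) (u u' : U),
  2^-1 * (\sum_j `|p y u j - p y' u' j|) <= beta.
Hypothesis Qopt : optimality_equation q M rhohat Qs.

(** On differences between two state-action pairs the constant [rhohat] cancels
    and the averaged Bellman updates contract by [beta]. *)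
Lemma Qlearning_span_cvg (w : Omega) :
  (forall i u, (fun T => (\sum_(t < T) noise t i u w) / T%:R) @ \oo --> (0 : R)) ->
  (fun t => span_seminorm (fun y u => Qt t w y u - Qs y u)) @ \oo --> (0 : R).
Proof.
move=> Hw; pose S T i u := \sum_(t < T) noise t i u w.
pose eps T := \sum_(z : 'I_N.+1 * U) 2 * `|S T z.1 z.2 / T%:R|.
have b0 : 0 <= beta.
  apply: le_trans (tv point point point point); rewrite mulr_ge0//.
  by apply: sumr_ge0.
apply: (averaged_contraction (eps := eps) b0 beta1).
- by move=> t; exact: span_seminorm_ge0.
- rewrite /eps; elim: (index_enum _) => [|z r IH].
    by under eq_fun do rewrite big_nil; exact: cvg_cst.
  under eq_fun do rewrite big_cons.
  have Sz : (fun T => 2 * `|S T z.1 z.2 / T%:R|) @ \oo --> (0 : R).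
    have := cvgM (cvg_cst (2 : R)) (cvg_norm (Hw z.1 z.2)).
    by rewrite normr0 mulr0; apply.
  by have := cvgD Sz IH; rewrite addr0; apply.
move=> T; set s := span_seminorm _; have T0 : 0 < T.+1%:R :> R by rewrite ltr0n.
rewrite -ler_pdivlMr//; apply: span_seminorm_le => i u j v.
rewrite ler_pdivlMr//.
pose d t k := V t w k - minU (Qs k).
have dosc t k l : d t k - d t l <=
    span_seminorm (fun y u => Qt t w y u - Qs y u).
  apply: minU_oscillation => a b a' b'.
  exact: (span_seminorm_ge (fun y u => Qt t w y u - Qs y u)).
have QE a b : T.+1%:R * (Qt T.+1 w a b - Qs a b) =
    \sum_(t < T.+1) (rhohat + \sum_k p a b k * d t k) + S T.+1 a b.
  rewrite mulrBr Qlearning_sum -/(S T.+1 a b) addrAC; congr (_ + _).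
  have -> : T.+1%:R * Qs a b = \sum_(t < T.+1) Qs a b.
    by rewrite sumr_const card_ord mulr_natl.
  rewrite -sumrB.
  apply: eq_bigr => t _.
  have -> : \sum_k p a b k * d t k =
      \sum_k p a b k * V t w k - \sum_k p a b k * minU (Qs k).
    by rewrite -sumrB; apply: eq_bigr => k _; rewrite -mulrBr.
  by have := Qopt a b; lra.
have Sle a b : `|S T.+1 a b| * 2 <= eps T.+1 * T.+1%:R.
  rewrite /eps mulr_suml (bigD1 (a, b))//=.
  rewrite normrM normfV (gtr0_norm T0) mulrA divfK ?gt_eqF// mulrC lerDl.
  by apply: sumr_ge0 => z _; rewrite !mulr_ge0.
have : \sum_(t < T.+1) (rhohat + \sum_k p i u k * d t k) -
    \sum_(t < T.+1) (rhohat + \sum_k p j v k * d t k) <=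
    beta * \sum_(t < T.+1) span_seminorm (fun y u => Qt t w y u - Qs y u).
  rewrite -sumrB mulr_sumr; apply: ler_sum => t _.
  rewrite opprD addrACA subrr add0r; apply: total_variation_bound => //.
  by rewrite !sum_finite_trans.
have := QE i u; have := QE j v; have := Sle i u; have := Sle j v.
have := ler_norm (S T.+1 i u); have := ler_norm (- S T.+1 j v).
rewrite normrN mulrC; lra.
Qed.

Theorem Qlearning_converges (y0 : 'I_N.+1) (u0 : U) :
  {ae P, forall w : Omega,
    (fun t => span_seminorm (fun y u => Qt t w y u - Qs y u)) @ \oo
      --> (0 : R) /\
    (fun t => uniform_norm
       (fun y u => recenter y0 u0 (Qt t w) y u - recenter y0 u0 Qs y u)) @ \oo
      --> (0 : R)}.
Proof.
have : {ae P, forall w, forall i u,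
    (fun T => (\sum_(t < T) noise t i u w) / T%:R) @ \oo --> (0 : R)}.
  by apply: filter_forall => i; apply: filter_forall => u; exact: noise_average.
apply: filterS => w /Qlearning_span_cvg Hw; split => //.
apply: (squeeze_cvgr _ (cvg_cst 0) Hw); apply: nearW => t.
rewrite uniform_norm_ge0/=; apply: uniform_norm_le => i u.
have := span_seminorm_ge (fun y u => Qt t w y u - Qs y u) i u y0 u0.
have := span_seminorm_ge (fun y u => Qt t w y u - Qs y u) y0 u0 i u.
by rewrite /recenter ler_norml; lra.
Qed.

End sampling_filtration.

(** * Bounds for the original problem *)

Section policy_bounds.
Context (R : realType) (X : completeMetricType R) (N : nat) (U : finPointedType).
Variables (q : quantization X N) (M : @mdp R _ (borel X) U).
Variables (rhohat rho : R) (Q : 'I_N.+1 -> U -> R).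
Hypothesis Qopt : optimality_equation q M rhohat Q.
Hypothesis orho : has_optimal_cost M rho.

Lemma optimal_cost_le_average_cost (pi : policy R (borel X) U) rhopi :
  has_average_cost M pi rhopi -> rho <= rhopi.
Proof.
move=> hpi; rewrite -lee_fin -(orho point) -(hpi point).
by apply: ereal_inf_lbound; exists pi.
Qed.

Section learned.
Variable nu : {measure set (borel X) -> \bar R}.
Hypothesis nuM : minorization M nu.
Local Notation kappa := (1 - fine (nu [set: X])).
Hypothesis k0 : 0 <= kappa.
Variables (i0 : 'I_N.+1) (u0 : U) (f : {mfun borel X >-> discr U}) (rhopi : R).
Hypothesis fQ : learned_policy q (recenter i0 u0 Q) f.
Hypothesis hf : has_average_cost M (stationary f) rhopi.

Lemma learned_policy_near e e' r h : near_acoe M e r h ->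
  (forall x u,
    `|bin_mean q (bin_index q x) (fun y => Qval M h y u) - Qval M h x u| <= e') ->
  rhopi - rho <= e + 2 * (e + e') / (1 - kappa).
Proof.
move=> rh Qvar; have [bh _] := rh.
have rr : `|rho - r| <= e := near_acoe_rho rh orho.
have : rhopi <= r + 2 * (e + e') / (1 - kappa).
  rewrite -lee_fin -(hf point); apply: (average_cost_le bh).
  apply: horizon_cost_stationary_le => // x.
  apply: (learned_policy_Qval Qopt rh Qvar nuM k0) => u.
  by have := fQ x u; rewrite /recenter lerD2r.
by move: rr; rewrite ler_distl => /andP[? ?]; lra.
Qed.

End learned.

Variable e' : R.
Hypothesis He' : forall e, 0 < e -> exists r h, near_acoe M e r h /\
  forall x u,
    `|bin_mean q (bin_index q x) (fun y => Qval M h y u) - Qval M h x u| <= e'.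

Lemma optimal_cost_quantization : `|rho - rhohat| <= e'.
Proof.
apply/ler_addgt0Pr => e e0; have e2 : 0 < e / 2 by rewrite divr_gt0.
have [r [h [rh Qvar]]] := He' e2.
have := near_acoe_rho rh orho; have := gain_comparison Qopt rh Qvar.
rewrite !ler_distl => /andP[? ?] /andP[? ?]; apply/andP; split; lra.
Qed.

Lemma learned_policy_cost nu i0 u0 f rhopi : minorization M nu ->
  0 <= 1 - fine (nu [set: X]) -> learned_policy q (recenter i0 u0 Q) f ->
  has_average_cost M (stationary f) rhopi ->
  rhopi - rho <= 2 * e' / (1 - (1 - fine (nu [set: X]))).
Proof.
move=> nuM k0 fQ hf; have k1 := minorization_lt1 nuM.
have b0 : 0 < 1 - (1 - fine (nu [set: X])) by lra.
have := learned_policy_near nuM k0 fQ hf (e' := e').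
move: (1 - (1 - _)) b0 => b b0 H.
apply/ler_addgt0Pr => e e0.
have c0 : 0 < 1 + 2 / b by rewrite addr_gt0// divr_gt0.
have [r [h [rh Qvar]]] := He' (divr_gt0 e0 c0).
have := H _ _ _ rh Qvar; move/le_trans; apply.
rewrite le_eqVlt; apply/orP; left; apply/eqP.
by field; rewrite !gt_eqF// ?addr_gt0.
Qed.

End policy_bounds.

Section lipschitz.
Context (R : realType) (X : completeMetricType R) (U : finPointedType).
Variable M : @mdp R _ (borel X) U.
Variables (Kc KT D : R).
Hypotheses (Kc0 : 0 <= Kc) (KT0 : 0 <= KT).
Hypothesis cL : forall x x' u, `|cost M x u - cost M x' u| <= Kc * mdist x x'.
Hypothesis TL : forall x x' u,
  (wasserstein1 (trans M (x, u)) (trans M (x', u)) <= (KT * mdist x x')%:E)%E.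
Hypothesis XD : forall x y : X, mdist x y <= D.

Let trans1 x u : trans M (x, u) [set: _] = 1%E.
Proof. exact: prob_kernel. Qed.

Let D0 : 0 <= D := le_trans (mdist_ge0 point point) (XD point point).

Section discounted.
Hypothesis KT1 : KT < 1.
Local Notation K := (Kc / (1 - KT)).

Let K0 : 0 <= K. Proof. by rewrite divr_ge0// subr_ge0 ltW. Qed.

Let KE : Kc + K * KT = K. Proof. by field; rewrite gt_eqF// subr_gt0. Qed.

Let mean_lipschitz (h : X -> R) x y u : bmeas (h : borel X -> R) ->
  (forall a b, `|h a - h b| <= K * mdist a b) ->
  `|(\int[trans M (x, u)]_z h z)%R - (\int[trans M (y, u)]_z h z)%R| <=
    K * KT * mdist x y.
Proof.
move=> bh hL; rewrite ler_distl lerBlDr -!lerBlDl -mulrA; apply/andP; split.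
  rewrite metric_sym; exact: (wasserstein1_lipschitz (trans1 y u) (trans1 x u)
    bh K0 hL (TL y x u)).
exact: (wasserstein1_lipschitz (trans1 x u) (trans1 y u) bh K0 hL (TL x y u)).
Qed.

(** Vanishing discount: the discounted values have a Lipschitz constant that does
    not depend on the discount [1 - eta], so, recentered, they solve the average
    cost equation up to an error of the order of [eta]. *)
Lemma lipschitz_near_acoe e : 0 < e -> exists r h, near_acoe M e r h /\
  forall x y u, `|Qval M h x u - Qval M h y u| <= K * mdist x y.
Proof.
move=> e0; have e2 : 0 < e / 2 by rewrite divr_gt0.
have KD : 0 <= K * D by rewrite mulr_ge0.
(* [K * D] bounds the oscillation of the discounted values, so the error [eta]
   times this oscillation is at most [e / 2] *)
pose eta := (e / 2) / (K * D + e / 2).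
have dpos : 0 < K * D + e / 2 by lra.
have eta0 : 0 < eta by rewrite divr_gt0.
have eta1 : eta <= 1 by rewrite ler_pdivrMr// mul1r lerDr.
have etaKD : eta * (K * D) <= e / 2.
  rewrite mulrAC ler_pdivrMr// mulrC.
  have := mulr_ge0 (ltW e2) (ltW e2); lra.
have a0 : 0 <= 1 - eta by lra.
have a1 : 1 - eta < 1 by lra.
pose P (h : X -> R) := bmeas (h : borel X -> R) /\
  forall x y, `|h x - h y| <= K * mdist x y.
pose Sa (h : X -> R) x u :=
  cost M x u + (1 - eta) * (\int[trans M (x, u)]_y h y)%R.
have P0 : P (fun=> 0).
  split; first exact: bmeas_cst.
  by move=> x y; rewrite subrr normr0 mulr_ge0// mdist_ge0.
have [|||h [bh hL] hS] := @near_fixpoint R X P (fun h x => minU (Sa h x)) _ _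
  a0 a1 e2 P0.
- move=> h [bh hL]; split.
    apply: bmeas_minU; apply: bmeasD; first exact: bmeas_cost.
    apply: bmeasZ; rewrite (_ : (fun _ => _) = fun z => (\int[trans M z]_y h y)%R).
      exact: bmeas_kernel_snd.
    by apply/funext => -[].
  move=> x y; apply: minU_dist => u.
  have := mean_lipschitz x y u bh hL; have := cL x y u.
  rewrite !ler_distl /Sa => /andP[c1 c2] /andP[m1 m2].
  have m0 := mulr_ge0 (mulr_ge0 K0 KT0) (mdist_ge0 x y).
  have E : K * mdist x y = Kc * mdist x y + K * KT * mdist x y by rewrite -mulrDl KE.
  have := ler_wpM2l a0 m1; have := ler_wpM2l a0 m2.
  have := mulr_ge0 (ltW eta0) m0; rewrite E; move: (K * KT * _) => ?.
  by move=> ? ? ?; apply/andP; split; lra.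
- by move=> h [[]].
- move=> f g r [bf _] [bg _] fg x; apply: minU_dist => u.
  rewrite /Sa opprD addrACA subrr add0r -mulrBr normrM ger0_norm// ler_wpM2l//.
  rewrite -(meanB measurableT (trans1 x u) bf bg).
  by apply: (mean_norm_le measurableT (trans1 x u) (bmeasB bf bg)) => y _.
pose h' x := h x - h point.
have bh' : bmeas (h' : borel X -> R) by apply: bmeasB => //; exact: bmeas_cst.
have QE x u : Qval M h' x u = cost M x u + (\int[trans M (x, u)]_y h y)%R - h point.
  rewrite /Qval /h' -addrA.
  by rewrite (meanDcst measurableT (trans1 x u) (- h point) bh).
exists (eta * h point), h'; split; last first.
  move=> x y u; rewrite !QE.
  have := mean_lipschitz x y u bh hL; have := cL x y u.
  have E : K * mdist x y = Kc * mdist x y + K * KT * mdist x y by rewrite -mulrDl KE.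
  rewrite E !ler_distl => /andP[? ?] /andP[? ?]; apply/andP; split; lra.
split => // x.
have near : `|minU (Qval M h' x) - (minU (Sa h x) + (eta - 1) * h point)| <= e / 2.
  rewrite -[X in _ - X]minUD; apply: minU_dist => u; rewrite QE /Sa.
  have hb y : `|h y - h point| <= K * D.
    by apply: le_trans (hL y point) _; rewrite ler_wpM2l.
  have mh : `|(\int[trans M (x, u)]_y h y)%R - h point| <= K * D.
    rewrite -[h point in X in X <= _](mean_cst measurableT (trans1 x u)).
    rewrite -(meanB measurableT (trans1 x u) bh (bmeas_cst _ _)).
    by apply: (mean_norm_le measurableT (trans1 x u) bh') => y _; exact: hb.
  apply: le_trans etaKD.
  have -> : cost M x u + (\int[trans M (x, u)]_y h y)%R - h point -
      (cost M x u + (1 - eta) * (\int[trans M (x, u)]_y h y)%R + (eta - 1) * h point) =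
      eta * ((\int[trans M (x, u)]_y h y)%R - h point) by ring.
  by rewrite normrM (gtr0_norm eta0) ler_wpM2l// ltW.
have := hS x; move: near; rewrite !ler_distl /h' => /andP[? ?] /andP[? ?].
by apply/andP; split; lra.
Qed.

End discounted.

Section minorized.
Variable nu : {measure set (borel X) -> \bar R}.
Hypothesis nuM : minorization M nu.
Local Notation kappa := (1 - fine (nu [set: X])).
Hypothesis k0 : 0 < kappa.

Local Notation theta delta := (KT `^ delta * kappa `^ (1 - delta)).
Local Notation H delta := (Kc * D `^ (1 - delta) / (1 - theta delta)).

(** The exponents for which the minorized kernel contracts Hölder constants. *)
Definition admissible delta :=
  [/\ 0 < delta, delta <= 1 & KT < (1 / kappa) `^ ((1 - delta) / delta)].

Lemma admissible_lt1 delta : admissible delta -> theta delta < 1.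
Proof.
move=> [d0 d1 KTd]; have kd : 0 < kappa `^ (1 - delta) by rewrite powR_gt0.
rewrite -ltr_pdivlMr// mul1r.
have -> : (kappa `^ (1 - delta))^-1 =
    ((1 / kappa) `^ ((1 - delta) / delta)) `^ delta.
  rewrite -powRrM divfK ?gt_eqF// mul1r -(powR_inv1 (ltW k0)) -powRrM mulN1r.
  by rewrite powRN.
by apply: gt0_ltr_powR; rewrite ?nnegrE// powR_ge0.
Qed.

Let H0 delta : admissible delta -> 0 <= H delta.
Proof.
by move=> ad; rewrite divr_ge0 ?mulr_ge0 ?powR_ge0// subr_ge0 ltW// admissible_lt1.
Qed.

Let HE delta : admissible delta ->
  Kc * D `^ (1 - delta) + H delta * theta delta = H delta.
Proof.
by move=> ad; field; rewrite gt_eqF// subr_gt0 admissible_lt1.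
Qed.

Let mdist_powR delta (x y : X) : 0 < delta -> delta <= 1 ->
  mdist x y <= D `^ (1 - delta) * mdist x y `^ delta.
Proof.
move=> d0 d1; have := mdist_ge0 x y; rewrite le_eqVlt => /predU1P[<-|m0].
  by rewrite mulr_ge0// powR_ge0.
rewrite -{1}(powRr1 (ltW m0)) -{1}(subrK delta 1) powRD; last first.
  by rewrite (gt_eqF m0) implybT.
rewrite ler_wpM2r ?powR_ge0// ge0_ler_powR ?nnegrE ?subr_ge0//.
exact: ltW.
Qed.

Lemma Qval_holder delta (h : X -> R) u : admissible delta ->
  bmeas (h : borel X -> R) -> holder delta (H delta) h ->
  holder delta (H delta) (fun x => Qval M h x u).
Proof.
move=> ad bh hH x y; have [d0 d1 _] := ad.
have mH := mean_holder nuM KT0 TL k0 x y u d0 d1 (H0 ad) bh hH.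
have := le_trans (cL x y u) (ler_wpM2l Kc0 (mdist_powR x y d0 d1)).
have -> : H delta * mdist x y `^ delta =
    Kc * D `^ (1 - delta) * mdist x y `^ delta +
    H delta * theta delta * mdist x y `^ delta by rewrite -mulrDl HE.
rewrite -mulrA; move: mH; set a := _ * _ `^ delta; set b := Kc * _.
by rewrite /Qval !ler_distl => /andP[? ?] /andP[? ?]; apply/andP; split; lra.
Qed.

Lemma minorized_near_acoe e : 0 < e -> exists r h,
  near_acoe M e r h /\ forall delta u, admissible delta ->
    holder delta (H delta) (fun x => Qval M h x u).
Proof.
move=> e0.
pose P (h : X -> R) := bmeas (h : borel X -> R) /\
  forall delta, admissible delta -> holder delta (H delta) h.
have [|||h [bh hH] rh] := @minorization_near_acoe _ _ _ M nu nuM P e (ltW k0) e0.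
- by move=> h [].
- split; first exact: bmeas_cst.
  by move=> delta ad x y; rewrite subrr normr0 mulr_ge0 ?H0// powR_ge0.
- move=> h [bh hH]; split.
    apply: bmeas_minU; apply: bmeasB; [exact: bmeas_Qval|exact: bmeas_cst].
  move=> delta ad x y; apply: minU_dist => u.
  rewrite opprB addrA subrK; exact: Qval_holder ad bh (hH _ ad) x y.
exists (\int[nu]_y h y)%R, h; split => // delta u ad.
exact: Qval_holder ad bh (hH _ ad).
Qed.

End minorized.

End lipschitz.

Section continuous.
Context (R : realType) (X : completeMetricType R) (U : finPointedType).
Variable M : @mdp R _ (borel X) U.
Variable nu : {measure set (borel X) -> \bar R}.
Hypotheses (nuM : minorization M nu) (k0 : 0 < 1 - fine (nu [set: X])).
Hypothesis wcM : weak_continuity_condition M.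

Lemma continuous_near_acoe e : 0 < e -> exists r h,
  near_acoe M e r h /\ exists2 C, 0 <= C &
    forall x y u, `|Qval M h x u - Qval M h y u| <= e + C * mdist x y.
Proof.
move=> e0; have [cX _ _] := wcM.
pose P (h : X -> R) := bmeas (h : borel X -> R) /\ continuous h.
have [|||h [bh ch] rh] := @minorization_near_acoe _ _ _ M nu nuM P e (ltW k0) e0.
- by move=> h [].
- by split; [exact: bmeas_cst|move=> x; exact: cvg_cst].
- move=> h [bh ch]; split.
    apply: bmeas_minU; apply: bmeasB; [exact: bmeas_Qval|exact: bmeas_cst].
  apply: continuous_minU => u x; apply: cvgB; last exact: cvg_cst.
  exact: continuous_Qval.
exists (\int[nu]_y h y)%R, h; split => //.
have [_ [B hB]] := bmeas_Qval M bh.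
have HC u : exists C, 0 <= C /\
    forall x y, `|Qval M h x u - Qval M h y u| <= e + C * mdist x y.
  have hBu x : `|Qval M h x u| <= B := hB (x, u : discr U).
  have [C C0 HC] := compact_affine_modulus cX (continuous_Qval wcM bh ch) hBu e0.
  by exists C.
have /choice[C HCu] := HC.
exists (\sum_u C u) => [|x y u]; first by apply: sumr_ge0 => u _; have [] := HCu u.
have [_ /(_ x y)/le_trans] := HCu u; apply.
rewrite lerD2l ler_wpM2r ?mdist_ge0// (bigD1 u)//= lerDl; apply: sumr_ge0 => v _.
by have [] := HCu v.
Qed.

(** A continuous near solution has a modulus that is common to all [n], so the
    loss of the learned policies vanishes with the quantization error. *)
Lemma learned_policies_cvg (N : nat -> nat) (q : forall n, quantization X (N n))
    (y0 : forall n, 'I_(N n).+1) (u0 : nat -> U) (rhohat : nat -> R)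
    (Qs : forall n, 'I_(N n).+1 -> U -> R) (pi : nat -> {mfun borel X >-> discr U}) :
  (forall n : nat, (0 < n)%N ->
    [/\ max_quantization_error (q n) = (n%:R^-1)%:E,
        optimality_equation (q n) M (rhohat n) (Qs n) &
        learned_policy (q n) (recenter (y0 n) (u0 n) (Qs n)) (pi n)]) ->
  exists (rho : R) (rhopi : nat -> R),
    [/\ has_optimal_cost M rho,
        forall n : nat, (0 < n)%N ->
          has_average_cost M (stationary (pi n)) (rhopi n) &
        rhopi @ \oo --> rho].
Proof.
move=> Hn; have [cX _ _] := wcM; have [D XD] := compact_mdist_bounded cX.
have [rho orho] : exists rho, has_optimal_cost M rho.
  apply: near_acoe_has_optimal_cost => e /continuous_near_acoe[r [h [rh _]]].
  by exists r, h.
have /choice[rhopi Hrhopi] n : exists r, has_average_cost M (stationary (pi n)) r.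
  exact: minorization_has_average_cost nuM _ (ltW k0).
exists rho, rhopi; split => //; apply/cvgrPdist_le => e e0.
have k1 := minorization_lt1 nuM.
have b0 : 0 < 1 - (1 - fine (nu [set: X])) by lra.
pose b := 1 - (1 - fine (nu [set: X])).
(* [eta] makes the part of the error that does not depend on [n] equal to
   [e / 2] *)
pose eta := (e / 2) / (1 + 4 / b).
have c0 : 0 < 1 + 4 / b by rewrite addr_gt0// divr_gt0.
have eta0 : 0 < eta by rewrite !divr_gt0.
have [r [h [rh [C C0 HC]]]] := continuous_near_acoe eta0.
have bh : bmeas (h : borel X -> R) by case: rh.
exists (Num.truncn (4 * C / b / e)).+1 => // n /= nC.
have n0 : (0 < n)%N by exact: leq_trans nC.
have [LXn Qopt learned] := Hn n n0.
have LXE : fine (max_quantization_error (q n)) = n%:R^-1 by rewrite LXn.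
have Qvar x u : `|bin_mean (q n) (bin_index (q n) x) (fun y => Qval M h y u) -
    Qval M h x u| <= eta + C * n%:R^-1.
  rewrite -LXE; apply: (bin_mean_affine _ XD (g := fun y => Qval M h y u)) => //.
  exact: bmeas_Qval1.
have := learned_policy_near Qopt orho nuM (ltW k0) learned (Hrhopi n) rh Qvar.
have := optimal_cost_le_average_cost orho (Hrhopi n).
rewrite -/b => h1 h2.
rewrite distrC ger0_norm ?subr_ge0//; apply: le_trans h2 _.
have -> : eta + 2 * (eta + (eta + C / n%:R)) / b =
    eta * (1 + 4 / b) + 2 * C / b * n%:R^-1.
  by field; rewrite (gt_eqF b0) gt_eqF// ltr0n.
rewrite divfK ?gt_eqF//.
suff : 2 * C / b * n%:R^-1 <= e / 2 by lra.
rewrite ler_pdivrMr ?ltr0n//.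
have : 4 * C / b / e <= n%:R.
  by apply: le_trans (ltW (truncnS_gt _)) _; rewrite ler_nat.
rewrite ler_pdivrMr//; lra.
Qed.

End continuous.

(** A negative constant is possible only if all distances vanish; the quantization
    error is then 0 and the constants can be taken to be 0. *)
Lemma lipschitz_condition_cases (R : realType) (X : completeMetricType R)
    (U : finPointedType) (M : @mdp R _ (borel X) U) Kc KT :
  lipschitz_condition M Kc KT ->
  (0 <= Kc /\ 0 <= KT) \/
  (lipschitz_condition M 0 0 /\ forall x y : X, mdist x y = 0).
Proof.
move=> [cX cL TL].
have [d0|/existsNP[x /existsNP[y /eqP xy]]] := pselect (forall x y : X, mdist x y = 0).
  right; split => //; split => // [x y u|x y u].
    by have := cL x y u; rewrite d0 !mulr0.
  by have := TL x y u; rewrite d0 !mulr0.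
left; have m0 : 0 < mdist x y by rewrite lt_neqAle eq_sym xy mdist_ge0.
split; rewrite -(pmulr_lge0 _ m0).
  exact: le_trans (normr_ge0 _) (cL x y point).
rewrite -lee_fin; apply: le_trans (TL x y point).
apply: le_ereal_inf_tmp => _ [g _ <-]; apply: integral_ge0 => z _.
by rewrite lee_fin mdist_ge0.
Qed.

Section quantized_bounds.
Context (R : realType) (X : completeMetricType R) (N : nat) (U : finPointedType).
Variables (q : quantization X N) (M : @mdp R _ (borel X) U).
Variables (rhohat : R) (Q : 'I_N.+1 -> U -> R).
Hypothesis Qopt : optimality_equation q M rhohat Q.
Local Notation LX := (fine (max_quantization_error q)).

Let lipschitz_bound_ge0 Kc KT : 0 <= Kc -> 0 <= KT ->
  lipschitz_condition M Kc KT -> KT < 1 ->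
  exists rho, has_optimal_cost M rho /\ `|rho - rhohat| <= Kc / (1 - KT) * LX.
Proof.
move=> Kc0 KT0 [cX cL TL] KT1; have [D XD] := compact_mdist_bounded cX.
have near := lipschitz_near_acoe Kc0 KT0 cL TL XD KT1.
have [rho orho] : exists rho, has_optimal_cost M rho.
  apply: near_acoe_has_optimal_cost => e /near[r [h [rh _]]].
  by exists r, h.
exists rho; split => //; apply: (optimal_cost_quantization Qopt orho) => e /near.
move=> [r [h [rh hL]]]; exists r, h; split => // x u.
rewrite -[leRHS]add0r; apply: (bin_mean_affine _ XD (g := fun y => Qval M h y u)).
- by apply: bmeas_Qval1; case: rh.
- by rewrite divr_ge0// subr_ge0 ltW.
- by move=> y; rewrite add0r; exact: hL.
Qed.

Let error0 : (forall x y : X, mdist x y = 0) -> LX = 0.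
Proof.
move=> d0; have XD (x y : X) : mdist x y <= 0 by rewrite d0.
by apply/le_anti; rewrite (quantization_error_le q XD) (quantization_error_ge0 q XD).
Qed.

Lemma lipschitz_bound Kc KT : lipschitz_condition M Kc KT -> KT < 1 ->
  exists rho, has_optimal_cost M rho /\ `|rho - rhohat| <= Kc / (1 - KT) * LX.
Proof.
move=> LM KT1; have [[Kc0 KT0]|[LM0 d0]] := lipschitz_condition_cases LM.
  exact: lipschitz_bound_ge0.
have [rho [orho]] := lipschitz_bound_ge0 (lexx 0) (lexx 0) LM0 ltr01.
by rewrite (error0 d0) !mulr0 => ?; exists rho.
Qed.

Section minorized.
Variable nu : {measure set (borel X) -> \bar R}.
Hypothesis nuM : minorization M nu.
Local Notation kappa := (1 - fine (nu [set: X])).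
Hypothesis k0 : 0 < kappa.
Local Notation D := (diameter X).

Let holder_bound_ge0 Kc KT : 0 <= Kc -> 0 <= KT -> lipschitz_condition M Kc KT ->
  exists rho, [/\ has_optimal_cost M rho,
    forall delta, admissible KT nu delta ->
      `|rho - rhohat| <= Kc * D `^ (1 - delta) /
        (1 - KT `^ delta * kappa `^ (1 - delta)) * LX `^ delta &
    forall i0 u0 f rhopi, learned_policy q (recenter i0 u0 Q) f ->
      has_average_cost M (stationary f) rhopi ->
      forall delta, admissible KT nu delta ->
      rhopi - rho <= 2 * Kc * D `^ (1 - delta) /
        ((1 - kappa) * (1 - KT `^ delta * kappa `^ (1 - delta))) * LX `^ delta].
Proof.
move=> Kc0 KT0 [cX cL TL]; have [B XB] := compact_mdist_bounded cX.
have XD (x y : X) : mdist x y <= D.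
  apply: ub_le_sup; last by exists (x, y).
  by exists B => _ [z _ <-]; exact: XB.
have near := minorized_near_acoe Kc0 KT0 cL TL XD nuM k0.
have [rho orho] : exists rho, has_optimal_cost M rho.
  apply: near_acoe_has_optimal_cost => e /near[r [h [rh _]]].
  by exists r, h.
have near' delta : admissible KT nu delta -> forall e, 0 < e -> exists r h,
    near_acoe M e r h /\ forall x u,
    `|bin_mean q (bin_index q x) (fun y => Qval M h y u) - Qval M h x u| <=
      Kc * D `^ (1 - delta) /
        (1 - KT `^ delta * kappa `^ (1 - delta)) * LX `^ delta.
  move=> ad e /near[r [h [rh hH]]]; exists r, h; split => // x u.
  have [d0 d1 _] := ad.
  apply: (bin_mean_holder _ XD (g := fun y => Qval M h y u)) => //; last exact: hH.
    by apply: bmeas_Qval1; case: rh.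
  rewrite divr_ge0 ?mulr_ge0 ?powR_ge0// subr_ge0 ltW//.
  exact: (admissible_lt1 KT0 k0 ad).
exists rho; split => //.
  by move=> delta ad; exact: (optimal_cost_quantization Qopt orho (near' _ ad)).
move=> i0 u0 f rhopi fQ hf delta ad.
have := learned_policy_cost Qopt orho (near' _ ad) nuM (ltW k0) fQ hf.
move/le_trans; apply; rewrite le_eqVlt; apply/orP; left; apply/eqP.
have k1 := minorization_lt1 nuM; have th1 := admissible_lt1 KT0 k0 ad.
move: (KT `^ delta * _) th1 => th th1.
by field; rewrite !gt_eqF//; lra.
Qed.

Lemma holder_bound Kc KT : lipschitz_condition M Kc KT ->
  exists rho, [/\ has_optimal_cost M rho,
    forall delta, admissible KT nu delta ->
      `|rho - rhohat| <= Kc * D `^ (1 - delta) /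
        (1 - KT `^ delta * kappa `^ (1 - delta)) * LX `^ delta &
    forall i0 u0 f rhopi, learned_policy q (recenter i0 u0 Q) f ->
      has_average_cost M (stationary f) rhopi ->
      forall delta, admissible KT nu delta ->
      rhopi - rho <= 2 * Kc * D `^ (1 - delta) /
        ((1 - kappa) * (1 - KT `^ delta * kappa `^ (1 - delta))) * LX `^ delta].
Proof.
move=> LM; have [[Kc0 KT0]|[LM0 d0]] := lipschitz_condition_cases LM.
  exact: holder_bound_ge0.
have [rho [orho H1 H2]] := holder_bound_ge0 (lexx 0) (lexx 0) LM0.
have ad0 delta : admissible KT nu delta -> admissible 0 nu delta.
  by case=> ? ? _; split => //; rewrite powR_gt0// divr_gt0.
exists rho; split => // [delta ad|i0 u0 f rhopi fQ hf delta ad]; have [e0 _ _] := ad.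
  have := H1 delta (ad0 _ ad).
  by rewrite (error0 d0) !powR0 ?gt_eqF// !mulr0.
have := H2 i0 u0 f rhopi fQ hf delta (ad0 _ ad).
by rewrite (error0 d0) !powR0 ?gt_eqF// !mulr0.
Qed.

End minorized.

End quantized_bounds.

Theorem theorem17 (R : realType) (X : completeMetricType R)
    (X_separable : separable X) (U : finPointedType)
    (M : @mdp R _ (borel X) U) :
  (forall (N : nat) (q : quantization X N) (beta : R),
    beta < 1 ->
    (forall (y y' : 'I_N.+1) (u u' : U),
       2^-1 * (\sum_j `|finite_trans q M y u j - finite_trans q M y' u' j|) <= beta) ->
    forall (y0 : 'I_N.+1) (u0 : U) (rhohat : R) (Qs : 'I_N.+1 -> U -> R),
    has_optimal_cost (finite_model q M) rhohat ->
    optimality_equation q M rhohat Qs ->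
    let Qhats := recenter y0 u0 Qs in
    let LX := fine (max_quantization_error q) in
    [/\
      (* convergence of Q-learning *)
      forall (dO : measure_display) (Omega : measurableType dO)
          (P : probability Omega R)
          (x x1 : nat -> 'I_N.+1 -> U -> {mfun Omega >-> borel X})
          (Q0 : 'I_N.+1 -> U -> R),
        sampling q M P x x1 ->
        let Q := Qlearning q M (fun t => t.+1%:R^-1) Q0 x x1 in
        {ae P, forall w : Omega,
          (fun t => span_seminorm (fun y u => Q t w y u - Qs y u)) @ \oo
            --> (0 : R) /\
          (fun t => uniform_norm
             (fun y u => recenter y0 u0 (Q t w) y u - Qhats y u)) @ \oo
            --> (0 : R)},

      rhohat + Qhats y0 u0 =
        finite_cost q M y0 u0 + \sum_y1 minU (Qhats y1) * finite_trans q M y0 u0 y1,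

      (* (i) *)
      forall Kc KT : R, lipschitz_condition M Kc KT -> KT < 1 ->
        exists rho : R, has_optimal_cost M rho /\
          `|rho - rhohat| <= Kc / (1 - KT) * LX
    & (* (ii) *)
      forall (nu : {measure set (borel X) -> \bar R}) (Kc KT : R),
        let kappa := 1 - fine (nu [set: X]) in
        let D := diameter X in
        minorization M nu -> 0 < kappa -> lipschitz_condition M Kc KT ->
        exists rho : R,
          [/\ has_optimal_cost M rho,
              forall delta : R, 0 < delta -> delta <= 1 ->
                KT < (1 / kappa) `^ ((1 - delta) / delta) ->
                `|rho - rhohat| <=
                  Kc * D `^ (1 - delta) /
                    (1 - KT `^ delta * kappa `^ (1 - delta)) * LX `^ delta &
              forall pihat : {mfun borel X >-> discr U},
                learned_policy q Qhats pihat ->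
                exists rhopi : R,
                  has_average_cost M (stationary pihat) rhopi /\
                  forall delta : R, 0 < delta -> delta <= 1 ->
                    KT < (1 / kappa) `^ ((1 - delta) / delta) ->
                    rhopi - rho <=
                      2 * Kc * D `^ (1 - delta) /
                        ((1 - kappa) *
                           (1 - KT `^ delta * kappa `^ (1 - delta))) *
                        LX `^ delta]]) /\
  (* (iii) *)
  (forall nu : {measure set (borel X) -> \bar R},
    minorization M nu -> 0 < 1 - fine (nu [set: X]) ->
    weak_continuity_condition M ->
    forall (N : nat -> nat) (q : forall n, quantization X (N n))
      (y0 : forall n, 'I_(N n).+1) (u0 : nat -> U) (rhohat : nat -> R)
      (Qs : forall n, 'I_(N n).+1 -> U -> R)
      (pi : nat -> {mfun borel X >-> discr U}),
    (forall n : nat, (0 < n)%N ->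
       [/\ max_quantization_error (q n) = (n%:R^-1)%:E,
           has_optimal_cost (finite_model (q n) M) (rhohat n),
           optimality_equation (q n) M (rhohat n) (Qs n) &
           learned_policy (q n) (recenter (y0 n) (u0 n) (Qs n)) (pi n)]) ->
    exists (rho : R) (rhopi : nat -> R),
      [/\ has_optimal_cost M rho,
          forall n : nat, (0 < n)%N ->
            has_average_cost M (stationary (pi n)) (rhopi n) &
          rhopi @ \oo --> rho]).
Proof.
split; last first.
  move=> nu nuM k0 wcM N q y0 u0 rhohat Qs pi Hn.
  apply: (learned_policies_cvg nuM k0 wcM (q := q) (y0 := y0) (u0 := u0)
    (rhohat := rhohat) (Qs := Qs)) => n /Hn[LXn _ Qopt learned].
  by split.
move=> N q beta beta1 tv y0 u0 rhohat Qs _ Qopt Qhats LX; split.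
- move=> dO Omega P x x1 Q0 xP Q.
  exact: (Qlearning_converges Q0 xP beta1 tv Qopt y0 u0).
- have mE j : minU (Qhats j) = minU (Qs j) - Qs y0 u0 by exact: minUD.
  have := Qopt y0 u0.
  have -> : \sum_y1 minU (Qhats y1) * finite_trans q M y0 u0 y1 =
      \sum_y1 finite_trans q M y0 u0 y1 * minU (Qs y1) - Qs y0 u0.
    rewrite -[in RHS](mul1r (Qs y0 u0)) -(sum_finite_trans q M y0 u0) mulr_suml.
    by rewrite -sumrB; apply: eq_bigr => j _; rewrite mE mulrC mulrBr.
  by rewrite /Qhats /recenter subrr; lra.
- by move=> Kc KT; exact: lipschitz_bound.
move=> nu Kc KT kappa D nuM k0 LM.
have [rho [orho H1 H2]] := holder_bound Qopt nuM k0 LM.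
exists rho; split => //.
  by move=> delta d0 d1 KTd; apply: H1; split.
move=> pihat fQ.
have [rhopi hpi] := minorization_has_average_cost nuM pihat (ltW k0).
exists rhopi; split => // delta d0 d1 KTd.
by apply: (H2 y0 u0 pihat rhopi fQ hpi); split.
Qed.
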